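(* Let $p\in[-d,\infty)$ and let $\Phi$ be a locally absolutely square-integrable invariant random complex measure on $\mathbb R^d$. Let $f\in L^1(\mathbb R^d,\mathbb C)$ be Fourier-smooth with exponent $p+\vartheta$ for some $\vartheta>0$, and let $f_r(x)=f(x/r)$ for $r>0$. If $\Phi$ is $p$-uniform, then $$\frac{\mathrm{Var}[\Phi(f_r)]}{r^d}=O(r^{-p})\qquad\text{as } r\to\infty .$$ Conversely, if $\lambda_d(f)=\int f\,d\lambda_d\neq0$ and this asymptotic bound holds, then $\Phi$ is $p$-uniform. Both statements also hold with ''beyond $p$-uniform'' in place of ''$p$-uniform'' and $o(r^{-p})$ in place of $O(r^{-p})$.
   Context: $d\in\mathbb N$, $\lambda_d$ is Lebesgue measure, $B_r=\{x\in\mathbb R^d:\|x\|<r\}$, $B_r^c$ its complement. $(\Omega,\mathcal A,\mathbb P)$ is a probability space with a measurable flow $\{\theta_x:x\in\mathbb R^d\}$ ($\theta_0=\mathrm{id}$, $\theta_{x+y}=\theta_x\theta_y$, $(\omega,x)\mapsto\theta_x\omega$ measurable) preserving $\mathbb P$. A random complex measure $\Phi$ is a random element of the space of complex measures on $\mathbb R^d$ of the form $\mu_1-\mu_2+i(\mu_3-\mu_4)$ with $\mu_j$ locally finite measures ($\sigma$-field generated by evaluations on bounded Borel sets); $|\Phi|$ is its total variation measure and $\Phi(f)=\int f\,d\Phi$. $\Phi$ is invariant if $\Phi(\theta_x\omega,B)=\Phi(\omega,B+x)$ for all $x,\omega$ and bounded Borel $B$, and locally absolutely square-integrable if $\mathbb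 E[|\Phi|(B_1)^2]<\infty$. With $\hat f(k)=\int e^{-i\langle k,x\rangle}f(x)\,dx$, $\mathrm{Cov}[X,Y]=\mathbb E[X\overline Y]-\mathbb E[X]\overline{\mathbb E[Y]}$ and $\mathrm{Var}[X]=\mathrm{Cov}[X,X]$, the Bartlett spectral measure $\hat\beta_\Phi$ of such $\Phi$ is the unique locally finite nonnegative measure on $\mathbb R^d$ with $\mathrm{Cov}[\Phi(f),\Phi(g)]=(2\pi)^{-d}\int\hat f\,\overline{\hat g}\,d\hat\beta_\Phi$ for all bounded measurable compactly supported $f,g:\mathbb R^d\to\mathbb C$. For $p\in[-d,\infty)$, $\Phi$ is $p$-uniform if $\varepsilon^{-d}\hat\beta_\Phi(B_\varepsilon)=O(\varepsilon^p)$ as $\varepsilon\to0$, and beyond $p$-uniform if this holds with $o(\varepsilon^p)$. For $s\in[-d,\infty)$, a function $f\in L^1(\mathbb R^d,\mathbb C)$ is Fourier-smooth with exponent $s$ if there is $c>0$ with $|\hat f(k)|\le c(1+\|k\|)^{-\frac{d+s}2}$ for all $k\in\mathbb R^d$ and, in case $s\le0$, additionally $\int_{B_2^c}\sup_{u\in B_1}|\hat f(r(k+u))|^2\,dk=O(r^{-(d+s)})$ as $r\to\infty$. *)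

(* Defs.v *)
From HB Require Import structures.
From mathcomp Require Import all_boot all_order all_algebra.
From mathcomp Require Import all_classical all_reals all_analysis.
From mathcomp Require Import measurable_realfun.
From mathcomp Require Import complex.

Set Implicit Arguments.
Unset Strict Implicit.
Unset Printing Implicit Defensive.

Import Order.TTheory GRing.Theory Num.Theory.
Import numFieldNormedType.Exports.

Local Open Scope classical_set_scope.
Local Open Scope ring_scope.
Local Open Scope complex_scope.

Fact rV_display : measure_display. Proof. exact: default_measure_display. Qed.

Section rV_measurable.
Context {R : realType} {n : nat}.

(* The product sigma-algebra; [measurable_rV_borel] below shows that it is the
   Borel sigma-algebra of the topology of 'rV[R]_n. *)
Let coors : 'I_n -> 'rV[R]_n -> R := fun i x => x ord0 i.

Let rV_set0 : g_sigma_preimage coors set0.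
Proof. exact: sigma_algebra0. Qed.

Let rV_setC A : g_sigma_preimage coors A -> g_sigma_preimage coors (~` A).
Proof. exact: sigma_algebraC. Qed.

Let rV_bigcup (F : (set 'rV[R]_n)^nat) :
  (forall i, g_sigma_preimage coors (F i)) ->
  g_sigma_preimage coors (\bigcup_i (F i)).
Proof. exact: sigma_algebra_bigcup. Qed.

HB.instance Definition _ := @isMeasurable.Build rV_display
  'rV[R]_n (g_sigma_preimage coors) rV_set0 rV_setC rV_bigcup.

Lemma measurable_coor (i : 'I_n) :
  measurable_fun [set: 'rV[R]_n] (fun x : 'rV[R]_n => x ord0 i).
Proof.
move=> _ Y mY; rewrite setTI; apply: sub_sigma_algebra => /=.
rewrite -bigcup_seq/=; exists i => /=; first by rewrite mem_index_enum.
by exists Y => //; rewrite setTI.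
Qed.

Lemma measurable_fun_coorP d (T : measurableType d) (f : T -> 'rV[R]_n) :
  (forall i, measurable_fun [set: T] (fun x => f x ord0 i)) ->
  measurable_fun [set: T] f.
Proof.
move=> mf _ Y; rewrite setTI.
pose G := [set A | measurable (f @^-1` A)].
suff : g_sigma_preimage coors `<=` G by apply.
apply: smallest_sub.
  split; rewrite /G /=.
  - by rewrite preimage_set0.
  - by move=> A mA; rewrite setTD preimage_setC; exact: measurableC.
  - by move=> F mF; rewrite preimage_bigcup; exact: bigcup_measurable.
move=> A; rewrite -bigcup_seq => -[i _] [B mB <-].
by rewrite /G /= setTI; have := mf i measurableT _ mB; rewrite setTI.
Qed.

Lemma measurable_rV_borel :
  @measurable _ 'rV[R]_n = <<s @open 'rV[R]_n >>.
Proof.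
apply/seteqP; split; last first.
  apply: smallest_sub; first exact: sigma_algebra_measurable.
  move=> U oU.
  pose q2r (q : 'rV[rat]_n) : 'rV[R]_n := map_mx ratr q.
  pose box (q : 'rV[rat]_n * nat) : set 'rV[R]_n :=
    \bigcap_(i : 'I_n) [set x | `|x ord0 i - ratr (q.1 ord0 i)| < q.2.+1%:R^-1].
  have mbox q : measurable (box q).
    apply: fin_bigcap_measurable => // i _.
    have mi : measurable_fun [set: 'rV[R]_n]
        (fun x : 'rV[R]_n => `|x ord0 i - ratr (q.1 ord0 i)|).
      apply: measurableT_comp => //; apply: measurable_funB => //.
      exact: measurable_coor.
    have := mi measurableT `]-oo, (q.2.+1%:R^-1)[%classic (measurable_itv _).
    rewrite setTI; set A := (X in measurable X); set B := (X in _ -> measurable X).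
    suff -> : A = B by [].
    by apply/seteqP; split => x /=; rewrite /A /B /= in_itv.
  pose F (q : 'rV[rat]_n * nat) := if `[< box q `<=` U >] then box q else set0.
  have -> : U = \bigcup_q F q.
    apply/seteqP; split; last first.
      by move=> x [q _]; rewrite /F; case: asboolP => // h /h.
    move=> x Ux.
    have : nbhs x U by exact: open_nbhs_nbhs.
    move=> /nbhs_ballP [e /= e0 xeU].
    have [k ke] : exists k : nat, k.+1%:R^-1 + k.+1%:R^-1 < e.
      have e20 : 0 < e / 2 by rewrite divr_gt0.
      have /= := near_infty_natSinv_lt (PosNum e20).
      move=> [k _ /(_ k (leqnn k)) /= ke2].
      by exists k; rewrite [ltRHS](splitr e) ltrD.
    have /choice [q qP] : forall i : 'I_n, exists q : rat,
        `|x ord0 i - ratr q| < k.+1%:R^-1.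
      move=> i.
      have [|q] := @rat_in_itvoo R (x ord0 i - k.+1%:R^-1) (x ord0 i + k.+1%:R^-1).
        by rewrite ltrBlDr -addrA ltrDl addr_gt0// invr_gt0.
      rewrite in_itv /= => /andP[h1 h2]; exists q.
      by rewrite distrC ltr_distl h1 h2.
    exists ((\row_i q i), k) => //; rewrite /F.
    have xb : box ((\row_i q i), k) x by move=> i _ /=; rewrite mxE.
    case: asboolP => // -[] y yb; apply: xeU; split => // i j.
    rewrite (ord1 i).
    rewrite /ball /= /ball_ /=.
    apply: le_lt_trans ke.
    apply: le_trans (ler_distD (ratr (q j)) _ _) _.
    have := xb j I; have := yb j I; rewrite /= mxE => hy hx.
    by rewrite lerD ?(ltW hx)// distrC ltW.
  apply: countable_bigcupT_measurable; first exact: countableP.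
  by move=> q; rewrite /F; case: ifP => // _.
apply: smallest_sub; first exact: smallest_sigma_algebra.
move=> A; rewrite -bigcup_seq => -[i _] [B mB <-].
rewrite setTI.
pose G := [set B : set R | <<s @open 'rV[R]_n >> (coors i @^-1` B)].
have sG : sigma_algebra setT G.
  have sO := smallest_sigma_algebra setT (@open 'rV[R]_n).
  split; rewrite /G /=.
  - by rewrite preimage_set0; apply: sigma_algebra0.
  - by move=> C mC; rewrite setTD preimage_setC; exact: sigma_algebraC.
  - by move=> C mC; rewrite preimage_bigcup; exact: sigma_algebra_bigcup.
suff : @measurable _ R `<=` G by apply.
have -> : @measurable _ R = (@RGenOpens.G R).-sigma.-measurable.
  exact: RGenOpens.measurableE.
apply: smallest_sub => // _ [a [b ->]].
apply: sub_sigma_algebra.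
move: (@coord_continuous R 1 n ord0 i) => /continuousP; apply.
exact: interval_open.
Qed.

End rV_measurable.

Section lebesgue_measure_rV.
Context {R : realType}.
Local Open Scope ereal_scope.

Definition rV_cons n (p : measurableTypeR R * 'rV[R]_n) : 'rV[R]_n.+1 :=
  row_mx (const_mx p.1 : 'rV[R]_1) p.2.

Definition rV_uncons n (x : 'rV[R]_n.+1) : measurableTypeR R * 'rV[R]_n :=
  (x ord0 ord0, \row_i x ord0 (lift ord0 i)).

Lemma rV_cons0 n (p : measurableTypeR R * 'rV[R]_n) : rV_cons p ord0 ord0 = p.1.
Proof. by rewrite mxE; case: splitP => // j _; rewrite mxE. Qed.

Lemma rV_consS n (p : measurableTypeR R * 'rV[R]_n) i :
  rV_cons p ord0 (lift ord0 i) = p.2 ord0 i.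
Proof.
rewrite mxE; case: splitP => [[[]]//|j /= /eqP].
by rewrite /bump /= eqSS => /eqP ij; congr (p.2 _ _); exact/val_inj.
Qed.

Lemma rV_consK n : cancel (@rV_cons n) (@rV_uncons n).
Proof.
move=> [a x]; rewrite /rV_uncons rV_cons0; congr pair.
by apply/rowP => i; rewrite mxE rV_consS.
Qed.

Lemma measurable_rV_cons n : measurable_fun [set: _] (@rV_cons n).
Proof.
apply: measurable_fun_coorP => i; have [j ->|->] := unliftP ord0 i.
  under eq_fun do rewrite rV_consS.
  by apply: (measurableT_comp (measurable_coor j)); exact: measurable_snd.
under eq_fun do rewrite rV_cons0.
exact: measurable_fst.
Qed.

Lemma measurable_rV_uncons n : measurable_fun [set: _] (@rV_uncons n).
Proof.
apply: measurable_fun_pair => /=; first exact: measurable_coor.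
apply: measurable_fun_coorP => i.
rewrite [X in measurable_fun _ X](_ : _ = fun x : 'rV[R]_n.+1 => x ord0 (lift ord0 i)).
  exact: measurable_coor.
by apply/funext => x; rewrite mxE.
Qed.

Section step.
Context (n : nat) (mu : {sigma_finite_measure set 'rV[R]_n -> \bar R}).

Definition lebesgue_rV_step : set 'rV[R]_n.+1 -> \bar R :=
  pushforward (@lebesgue_measure R \x mu) (@rV_cons n).

Let step0 : lebesgue_rV_step set0 = 0.
Proof. by rewrite /lebesgue_rV_step /pushforward preimage_set0 measure0. Qed.

Let mpre A : measurable A -> measurable (@rV_cons n @^-1` A).
Proof. by move=> mA; rewrite -[X in measurable X]setTI; exact: measurable_rV_cons. Qed.

Let step_ge0 A : 0 <= lebesgue_rV_step A.
Proof. exact: (measure_ge0 (@lebesgue_measure R \x mu)). Qed.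

Let step_sigma_additive : semi_sigma_additive lebesgue_rV_step.
Proof.
move=> F mF tF mUF; rewrite /lebesgue_rV_step /pushforward preimage_bigcup.
apply: (@measure_semi_sigma_additive _ _ _ (@lebesgue_measure R \x mu)).
- by move=> i; exact: mpre.
- apply/trivIsetP => /= i j _ _ ij; rewrite -preimage_setI.
  by move/trivIsetP : tF => /(_ _ _ _ _ ij) ->//; rewrite preimage_set0.
- by rewrite -preimage_bigcup; exact: mpre.
Qed.

HB.instance Definition _ := isMeasure.Build _ _ _
  lebesgue_rV_step step0 step_ge0 step_sigma_additive.

Let step_sigma_finite : sigma_finite setT lebesgue_rV_step.
Proof.
have /sigma_finiteP[F [TF ndF Foo]] := sigma_finiteT (@lebesgue_measure R).
have /sigma_finiteP[G [TG ndG Goo]] := sigma_finiteT mu.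
exists (fun i => @rV_uncons n @^-1` (F i `*` G i)).
  rewrite -preimage_bigcup -[LHS](preimage_setT (@rV_uncons n)); congr (_ @^-1` _).
  rewrite -setXTT TF TG predeqE => -[x y]; split.
    move=> [/= [k _ Fkx] [l _ Gly]]; exists (maxn k l) => //; split.
    - by move: x Fkx; exact/subsetPset/ndF/leq_maxl.
    - by move: y Gly; exact/subsetPset/ndG/leq_maxr.
  by move=> [k _ []/= ? ?]; split; exists k.
move=> k; have [mFk ?] := Foo k; have [mGk ?] := Goo k.
split.
  by rewrite -[X in measurable X]setTI; apply: measurable_rV_uncons => //;
    exact: measurableX.
rewrite /lebesgue_rV_step /pushforward -comp_preimage.
rewrite (_ : _ \o _ = id); last by apply/funext => x; exact: rV_consK.
by rewrite [X in X < _]product_measure1E// lte_mul_pinfty// ge0_fin_numE.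
Qed.

HB.instance Definition _ := Measure_isSigmaFinite.Build _ _ _
  lebesgue_rV_step step_sigma_finite.

End step.

Fixpoint lebesgue_rV n : {sigma_finite_measure set 'rV[R]_n -> \bar R} :=
  if n is m.+1 then lebesgue_rV_step (lebesgue_rV m)
  else dirac (0%R : 'rV[R]_0).

Lemma lebesgue_rV_box n (A : 'I_n -> set (measurableTypeR R)) :
  (forall i, measurable (A i)) ->
  lebesgue_rV n [set x | forall i, A i (x ord0 i)] =
  \prod_(i < n) @lebesgue_measure R (A i).
Proof.
elim: n A => [|n IHn] A mA.
  by rewrite big_ord0 /= diracE mem_set//= => -[].
rewrite big_ord_recl -IHn// -product_measure1E//; last first.
  rewrite [X in measurable X](_ : _ = \bigcap_(i : 'I_n)
      (fun x : 'rV[R]_n => x ord0 i) @^-1` A (lift ord0 i)).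
    apply: fin_bigcap_measurable => // i _; rewrite -[X in measurable X]setTI.
    exact: (@measurable_coor R n i measurableT _ (mA _)).
  by apply/seteqP; split => x h i => [_|]; exact: h.
congr ((_ \x _) _); apply/seteqP; split => -[a x] /=.
  move=> h; split => /= [|i]; first by have := h ord0; rewrite rV_cons0.
  by have := h (lift ord0 i); rewrite rV_consS.
by move=> [Aa Ax] i; have [j ->|->] := unliftP ord0 i;
  rewrite ?rV_consS ?rV_cons0//; exact: Ax.
Qed.

End lebesgue_measure_rV.

Section complex_integral.
Context {d : measure_display} {T : measurableType d} {R : realType}.
Implicit Types (mu : {measure set T -> \bar R}) (f : T -> R[i]).

Definition cmeasurable f :=
  measurable_fun [set: T] (fun x => complex.Re (f x)) /\
  measurable_fun [set: T] (fun x => complex.Im (f x)).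

Definition cintegrable mu f :=
  mu.-integrable [set: T] (fun x => (complex.Re (f x))%:E) /\
  mu.-integrable [set: T] (fun x => (complex.Im (f x))%:E).

Definition cintegral mu f : R[i] :=
  (\int[mu]_x complex.Re (f x)) +i* (\int[mu]_x complex.Im (f x)).

End complex_integral.

Notation cmod := ComplexField.Normc.normc.

Section covariance.
Context {d : measure_display} {T : measurableType d} {R : realType}.
Variable P : probability T R.

Definition ccovariance (X Y : T -> R[i]) : R[i] :=
  cintegral P (fun w => X w * (Y w)^*%C) - cintegral P X * (cintegral P Y)^*%C.

(* Cov[X, X] in [0, +oo], with value +oo when X is not square integrable. *)
Definition cvariance (X : T -> R[i]) : \bar R :=
  (\int[P]_w ((cmod (X w)) ^+ 2)%:E - ((cmod (cintegral P X)) ^+ 2)%:E)%E.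

End covariance.

Section landau_ereal.
Context {R : realType}.
Implicit Types (F : set_system R) (u : R -> \bar R) (g : R -> R).

Definition ebigO F u g :=
  exists C : R, \forall x \near F, (`|u x| <= (C * `|g x|)%:E)%E.

Definition elittleo F u g :=
  forall e : R, 0 < e -> \forall x \near F, (`|u x| <= (e * `|g x|)%:E)%E.

End landau_ereal.

Section euclidean.
Context {R : realType} {n : nat}.
Implicit Types (x y : 'rV[R]_n) (A : set 'rV[R]_n).

Definition dotp x y : R := \sum_(i < n) x ord0 i * y ord0 i.

(* The library norm `|x| on 'rV[R]_n is the sup norm. *)
Definition enorm x : R := Num.sqrt (dotp x x).

Definition eball (r : R) : set 'rV[R]_n := [set x | enorm x < r].

Definition bounded_rV A := exists r : R, A `<=` eball r.

Definition locally_finite (mu : {measure set 'rV[R]_n -> \bar R}) :=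
  forall A, measurable A -> bounded_rV A -> (mu A < +oo)%E.

Definition shift_set A x : set 'rV[R]_n := [set y + x | y in A].

Definition fourier (f : 'rV[R]_n -> R[i]) (k : 'rV[R]_n) : R[i] :=
  cintegral (lebesgue_rV n)
    (fun x => (cos (dotp k x) -i* sin (dotp k x)) * f x).

Definition test_function (f : 'rV[R]_n -> R[i]) :=
  [/\ cmeasurable f,
      exists M : R, forall x, cmod (f x) <= M &
      compact (closure [set x | f x != 0])].

End euclidean.

Section complex_measure.
Context {R : realType} {n : nat}.
Implicit Types (nu : set 'rV[R]_n -> R[i]) (A : set 'rV[R]_n).
Implicit Types (mu : {measure set 'rV[R]_n -> \bar R}).

(* nu = mu1 - mu2 + i (mu3 - mu4), as set functions on the bounded Borel sets;
   the values of nu on other sets are irrelevant. *)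
Definition cm_decomposition nu mu1 mu2 mu3 mu4 :=
  [/\ locally_finite mu1, locally_finite mu2, locally_finite mu3,
      locally_finite mu4 &
      forall A, measurable A -> bounded_rV A ->
        nu A = (fine (mu1 A) - fine (mu2 A)) +i* (fine (mu3 A) - fine (mu4 A))].

Definition complex_measure nu :=
  exists mu1 mu2 mu3 mu4, cm_decomposition nu mu1 mu2 mu3 mu4.

(* |nu|(A), as a supremum over finite families of disjoint bounded Borel subsets
   of A. *)
Definition total_variation nu A : \bar R :=
  ereal_sup [set v | exists m (B : 'I_m -> set 'rV[R]_n),
    [/\ forall i, [/\ measurable (B i), bounded_rV (B i) & B i `<=` A],
        trivIset setT B & v = (\sum_(i < m) cmod (nu (B i)))%:E]].

(* z is the integral of f with respect to nu. There is at most one such z: if f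
   is integrable for two decompositions of nu, both yield the same value. There
   is one iff |f| is |nu|-integrable (use the Jordan decompositions of the real
   and imaginary parts of nu). *)
Definition is_cm_integral nu (f : 'rV[R]_n -> R[i]) (z : R[i]) :=
  exists mu1 mu2 mu3 mu4,
    [/\ cm_decomposition nu mu1 mu2 mu3 mu4,
        cintegrable mu1 f /\ cintegrable mu2 f,
        cintegrable mu3 f /\ cintegrable mu4 f &
        z = cintegral mu1 f - cintegral mu2 f
            + 'i%C * (cintegral mu3 f - cintegral mu4 f)].

Definition cm_integral nu f : R[i] := xget 0 [set z | is_cm_integral nu f z].

End complex_measure.

Section random_measure.
Context {R : realType} {n : nat} {d : measure_display} {Omega : measurableType d}.
Variable P : probability Omega R.
Implicit Types (theta : 'rV[R]_n -> Omega -> Omega)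
  (Phi : Omega -> set 'rV[R]_n -> R[i]).

Definition measure_preserving_flow theta :=
  [/\ theta 0 = id,
      forall x y, theta (x + y) = theta x \o theta y,
      measurable_fun [set: Omega * 'rV[R]_n] (fun wx => theta wx.2 wx.1) &
      forall x A, measurable A -> P (theta x @^-1` A) = P A].

Definition random_complex_measure Phi :=
  (forall w, complex_measure (Phi w)) /\
  (forall A, measurable A -> bounded_rV A -> cmeasurable (fun w => Phi w A)).

Definition flow_invariant theta Phi :=
  forall x w A, measurable A -> bounded_rV A ->
    Phi (theta x w) A = Phi w (shift_set A x).

Definition locally_abs_square_integrable Phi :=
  (\int[P]_w (total_variation (Phi w) (eball 1) ^+ 2) < +oo)%E.

(* The Bartlett spectral measure of Phi is the unique such beta. *)
Definition is_bartlett_measure Phi (beta : {measure set 'rV[R]_n -> \bar R}) :=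
  locally_finite beta /\
  forall f g, test_function f -> test_function g ->
    cintegrable beta (fun k => fourier f k * (fourier g k)^*%C) /\
    ccovariance P (fun w => cm_integral (Phi w) f)
                  (fun w => cm_integral (Phi w) g)
    = ((2 * pi) ^- n)%:C
      * cintegral beta (fun k => fourier f k * (fourier g k)^*%C).

End random_measure.

Section uniformity.
Context {R : realType} {n : nat}.
Implicit Types (beta : {measure set 'rV[R]_n -> \bar R}).

(* Uniformity of a random complex measure with Bartlett spectral measure beta. *)
Definition p_uniform beta (p : R) :=
  ebigO 0^'+ (fun e => ((e ^- n)%:E * beta (eball e))%E) (fun e => e `^ p).

Definition beyond_p_uniform beta (p : R) :=
  elittleo 0^'+ (fun e => ((e ^- n)%:E * beta (eball e))%E) (fun e => e `^ p).

Definition fourier_smooth (f : 'rV[R]_n -> R[i]) (s : R) :=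
  (exists2 c : R, 0 < c & forall k,
     cmod (fourier f k) <= c * (1 + enorm k) `^ (- ((n%:R + s) / 2))) /\
  (s <= 0 ->
   ebigO +oo
     (fun r => \int[lebesgue_rV n]_(k in ~` eball 2)
        ereal_sup [set ((cmod (fourier f (r *: (k + u)))) ^+ 2)%:E
                  | u in eball 1])%E
     (fun r => r `^ (- (n%:R + s)))).

End uniformity.

(* Main.v *)
Require Import Defs.
From HB Require Import structures.
From mathcomp Require Import all_boot all_order all_algebra.
From mathcomp Require Import all_classical all_reals all_analysis.
From mathcomp Require Import measurable_realfun.
From mathcomp Require Import complex.
From mathcomp Require Import ring lra.

(* For a test function f the spectral formula gives
   (2 pi)^d Var[Phi(f_r)] = r^(2d) int |f^(r k)|^2 beta(dk).
   Up to constants this persists for every f in L^1 with f^ in L^2(beta):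
   by stationarity the intensity of |Phi| is a multiple of Lebesgue measure, so
   E|Phi(f) - Phi(g)| <= C |f - g|_1, and mollified truncations g of f
   approximate f in L^1 while g^ approximates f^ in L^2(beta).
   The integral of |f^(r k)|^2 is then split at |k| = delta.  Near 0, a dyadic
   decomposition turns beta(B_e) <= eta e^(d+p) for e <= delta, together with the
   decay of f^, into a bound of order eta r^-(d+p).  Away from 0, beta is bounded
   on balls of radius 1, so the sum is dominated by the Lebesgue integral of local
   suprema of |f^(r .)|^2, which is of the smaller order r^-(d+p+vartheta).
   Conversely, if f has nonzero integral, |f^| is bounded below on some ball
   B_e0, so the integral dominates beta(B_(e0/r)). *)

Set Implicit Arguments.
Unset Strict Implicit.
Unset Printing Implicit Defensive.

Import Order.TTheory GRing.Theory Num.Theory.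
Import numFieldNormedType.Exports.

Local Open Scope classical_set_scope.
Local Open Scope ring_scope.
Local Open Scope complex_scope.

(** * Complex-valued functions *)

(** The spectral formula concerns test functions only, whereas [Phi(f_r)] is at first not known to
    be square integrable: the approximating variables converge in L^1(P), so second moments pass to
    the limit by a Fatou argument. That [Phi(f)] is a random variable at all takes work:
    [cm_integral] picks an arbitrary decomposition for each [w] and is 0 where none serves, so it is
    rewritten through the minimal Jordan parts, which are measurable in [w] and equivariant under
    the flow. The approximation also needs the transform of [f_r] in L^2([beta]); for large [r] this
    follows from Fourier smoothness and the uniform bound on [beta] over unit balls, whatever the
    behaviour of [beta] near 0. Complex integrals are estimated through their real and imaginary
    parts, whence the factors 2; comparability up to constants is all that the Landau statements
    require. One upper bound serves both O and o: it is linear in the constant [eta] of the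
    hypothesis on [beta], and the tail constant, which depends on [delta], carries the extra factor
    r^-vartheta. *)

Section modulus.
Context {R : realType}.
Implicit Types (z u v : R[i]) (r : R).

Lemma ReD u v : complex.Re (u + v) = complex.Re u + complex.Re v.
Proof. by case: u v => [a b] [c e]. Qed.

Lemma ImD u v : complex.Im (u + v) = complex.Im u + complex.Im v.
Proof. by case: u v => [a b] [c e]. Qed.

Lemma ReB u v : complex.Re (u - v) = complex.Re u - complex.Re v.
Proof. by case: u v => [a b] [c e]. Qed.

Lemma ImB u v : complex.Im (u - v) = complex.Im u - complex.Im v.
Proof. by case: u v => [a b] [c e]. Qed.

Lemma Re_mulc u v : complex.Re (u * v) =
  complex.Re u * complex.Re v - complex.Im u * complex.Im v.
Proof. by case: u v => [a b] [c e]. Qed.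

Lemma Im_mulc u v : complex.Im (u * v) =
  complex.Re u * complex.Im v + complex.Im u * complex.Re v.
Proof. by case: u v => [a b] [c e]. Qed.

Lemma eqc u v : complex.Re u = complex.Re v -> complex.Im u = complex.Im v ->
  u = v.
Proof. by case: u v => [a b] [c e] /= -> ->. Qed.

Lemma cmod_sqr z : cmod z ^+ 2 = complex.Re z ^+ 2 + complex.Im z ^+ 2.
Proof.
by case: z => [a b] /=; rewrite sqr_sqrtr// addr_ge0// sqr_ge0.
Qed.

Lemma cmod_ge0 z : 0 <= cmod z.
Proof. by case: z => [a b] /=; exact: sqrtr_ge0. Qed.

Lemma Re_le_cmod z : `|complex.Re z| <= cmod z.
Proof.
by rewrite -ler_sqr ?nnegrE ?cmod_ge0// cmod_sqr real_normK ?num_real// lerDl sqr_ge0.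
Qed.

Lemma Im_le_cmod z : `|complex.Im z| <= cmod z.
Proof.
by rewrite -ler_sqr ?nnegrE ?cmod_ge0// cmod_sqr real_normK ?num_real// lerDr sqr_ge0.
Qed.

Lemma cmod_le_ReIm z : cmod z <= `|complex.Re z| + `|complex.Im z|.
Proof.
rewrite -ler_sqr ?nnegrE ?cmod_ge0 ?addr_ge0//.
rewrite cmod_sqr sqrrD !real_normK ?num_real//.
by rewrite -addrA lerD2l lerDr mulrn_wge0// mulr_ge0.
Qed.

Lemma cmodM u v : cmod (u * v) = cmod u * cmod v.
Proof. exact: ComplexField.Normc.normcM. Qed.

Lemma cmodD u v : cmod (u + v) <= cmod u + cmod v.
Proof. exact: le_normcD. Qed.

Lemma cmodN u : cmod (- u) = cmod u.
Proof. exact: normcN. Qed.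

Lemma cmodB u v : cmod (u - v) <= cmod u + cmod v.
Proof. by rewrite -(cmodN v) cmodD. Qed.

Lemma cmod_distC u v : cmod (u - v) = cmod (v - u).
Proof. by rewrite -cmodN opprB. Qed.

Lemma cmod0 : cmod (0 : R[i]) = 0.
Proof. exact: ComplexField.Normc.normc0. Qed.

Lemma cmod_eq0 z : (cmod z == 0) = (z == 0).
Proof.
apply/eqP/eqP => [|->]; [exact: ComplexField.Normc.eq0_normc|exact: cmod0].
Qed.

Lemma cmodR r : cmod (r%:C) = `|r|.
Proof. by rewrite /= expr0n /= addr0 sqrtr_sqr. Qed.

Lemma mulcJ z : z * z^*%C = (cmod z ^+ 2)%:C.
Proof. by apply: eqc; rewrite ?Re_mulc ?Im_mulc cmod_sqr; case: z => [a b] /=; ring. Qed.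

Lemma sqr_cmodD u v : cmod (u + v) ^+ 2 <= 2 * cmod u ^+ 2 + 2 * cmod v ^+ 2.
Proof.
rewrite !cmod_sqr ReD ImD.
have := sqr_ge0 (complex.Re u - complex.Re v).
have := sqr_ge0 (complex.Im u - complex.Im v).
nra.
Qed.

End modulus.

Section complex_measurable.
Context d (T : measurableType d) (R : realType).
Implicit Types (f g : T -> R[i]).

Lemma cmeasurable_cmod f : cmeasurable f ->
  measurable_fun [set: T] (fun x => cmod (f x)).
Proof.
move=> [mr mi].
rewrite (_ : (fun _ => _) = Num.sqrt \o
   (fun x => complex.Re (f x) ^+ 2 + complex.Im (f x) ^+ 2)); last first.
  by apply/funext => x /=; case: (f x).
apply: measurableT_comp => //.
  exact: (continuous_measurable_fun (@sqrt_continuous R)).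
by apply: measurable_funD; apply: measurable_funX.
Qed.

Lemma cmeasurable_cst (z : R[i]) : cmeasurable (fun _ : T => z).
Proof. by split; exact: measurable_cst. Qed.

Lemma cmeasurableD f g : cmeasurable f -> cmeasurable g ->
  cmeasurable (fun x => f x + g x).
Proof.
move=> [f1 f2] [g1 g2]; split.
  by under eq_fun do rewrite ReD; exact: measurable_funD.
by under eq_fun do rewrite ImD; exact: measurable_funD.
Qed.

Lemma cmeasurableB f g : cmeasurable f -> cmeasurable g ->
  cmeasurable (fun x => f x - g x).
Proof.
move=> [f1 f2] [g1 g2]; split.
  by under eq_fun do rewrite ReB; exact: measurable_funB.
by under eq_fun do rewrite ImB; exact: measurable_funB.
Qed.

Lemma cmeasurableM f g : cmeasurable f -> cmeasurable g ->
  cmeasurable (fun x => f x * g x).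
Proof.
move=> [f1 f2] [g1 g2]; split.
  by under eq_fun do rewrite Re_mulc; apply: measurable_funB; exact: measurable_funM.
by under eq_fun do rewrite Im_mulc; apply: measurable_funD; exact: measurable_funM.
Qed.

Lemma cmeasurable_comp d' (T' : measurableType d') (h : T' -> T) f :
  cmeasurable f -> measurable_fun setT h -> cmeasurable (fun x => f (h x)).
Proof. by move=> [f1 f2] mh; split; [exact: (measurableT_comp f1 mh)|exact: (measurableT_comp f2 mh)]. Qed.

Lemma cmeasurable_real (h : T -> R) : measurable_fun setT h ->
  cmeasurable (fun x => (h x)%:C).
Proof. by move=> mh; split => //=; exact: measurable_cst. Qed.

End complex_measurable.

Section complex_integrable.
Context d (T : measurableType d) (R : realType).
Variable mu : {measure set T -> \bar R}.
Implicit Types (f g : T -> R[i]).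

Lemma cintegrable_cmeasurable f : cintegrable mu f -> cmeasurable f.
Proof.
by move=> [/integrableP[f1 _] /integrableP[f2 _]]; split; exact/measurable_EFinP.
Qed.

Lemma cintegrableP f : cintegrable mu f <->
  cmeasurable f /\ (\int[mu]_x (cmod (f x))%:E < +oo)%E.
Proof.
split=> [fi|[mf fi]].
  have mf := cintegrable_cmeasurable fi; split => //.
  have [f1 f2] := fi.
  have := integrableD measurableT (integrable_abse f1) (integrable_abse f2).
  move=> /integrableP [mD]; apply: le_lt_trans; apply: ge0_le_integral => //.
  - by move=> x _; rewrite lee_fin cmod_ge0.
  - by apply/measurable_EFinP; exact: cmeasurable_cmod.
  - by apply: measurableT_comp.
  - by move=> x _; rewrite /= lee_fin ger0_norm ?addr_ge0// cmod_le_ReIm.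
have mc : measurable_fun setT (EFin \o (fun x => cmod (f x))).
  by apply/measurable_EFinP; exact: cmeasurable_cmod.
have ci : mu.-integrable setT (EFin \o (fun x => cmod (f x))).
  apply/integrableP; split => //; apply: le_lt_trans fi.
  by under eq_integral do rewrite /= ger0_norm ?cmod_ge0//.
split; apply: (le_integrable measurableT _ _ ci) => //=.
- by apply/measurable_EFinP; exact: mf.1.
- by move=> x _; rewrite lee_fin (ger0_norm (cmod_ge0 _)) Re_le_cmod.
- by apply/measurable_EFinP; exact: mf.2.
- by move=> x _; rewrite lee_fin (ger0_norm (cmod_ge0 _)) Im_le_cmod.
Qed.

Lemma cintegrable_cmod f : cintegrable mu f ->
  mu.-integrable setT (fun x => (cmod (f x))%:E).
Proof.
move=> /cintegrableP[mf fi]; apply/integrableP; split.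
  by apply/measurable_EFinP; exact: cmeasurable_cmod.
by under eq_integral do rewrite /= ger0_norm ?cmod_ge0//.
Qed.

Lemma le_cintegrable f (g : T -> R) : cmeasurable f ->
  (forall x, cmod (f x) <= g x) -> mu.-integrable setT (fun x => (g x)%:E) ->
  cintegrable mu f.
Proof.
move=> mf fg gi; apply/cintegrableP; split => //.
move/integrableP : gi => [mg]; apply: le_lt_trans; apply: ge0_le_integral => //.
- by move=> x _; rewrite lee_fin cmod_ge0.
- by apply/measurable_EFinP; exact: cmeasurable_cmod.
- by apply: measurableT_comp.
- by move=> x _ /=; rewrite lee_fin (le_trans (fg x))// ler_norm.
Qed.

Lemma cintegrableD f g : cintegrable mu f -> cintegrable mu g ->
  cintegrable mu (fun x => f x + g x).
Proof.
move=> [f1 f2] [g1 g2]; split.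
  rewrite (_ : (fun _ => _) = (fun x => (complex.Re (f x))%:E + (complex.Re (g x))%:E)%E).
    exact: (integrableD measurableT f1 g1).
  by apply/funext => x; rewrite ReD.
rewrite (_ : (fun _ => _) = (fun x => (complex.Im (f x))%:E + (complex.Im (g x))%:E)%E).
  exact: (integrableD measurableT f2 g2).
by apply/funext => x; rewrite ImD.
Qed.

Lemma cintegrableZl (z : R[i]) f : cintegrable mu f ->
  cintegrable mu (fun x => z * f x).
Proof.
move=> fi; apply: (@le_cintegrable _ (fun x => cmod z * cmod (f x))).
- apply: cmeasurableM; [exact: cmeasurable_cst|exact: cintegrable_cmeasurable].
- by move=> x; rewrite cmodM.
- by have := integrableZl measurableT (cmod z) (cintegrable_cmod fi).
Qed.

Lemma cintegrableB f g : cintegrable mu f -> cintegrable mu g ->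
  cintegrable mu (fun x => f x - g x).
Proof.
move=> fi gi; have := cintegrableD fi (cintegrableZl (-1) gi).
by under eq_fun do rewrite mulN1r.
Qed.

Lemma cintegralD f g : cintegrable mu f -> cintegrable mu g ->
  cintegral mu (fun x => f x + g x) = cintegral mu f + cintegral mu g.
Proof.
move=> [f1 f2] [g1 g2]; apply: eqc; rewrite ?ReD ?ImD /=.
  by under eq_Rintegral do rewrite ReD; rewrite RintegralD.
by under eq_Rintegral do rewrite ImD; rewrite RintegralD.
Qed.

Lemma cintegralZl (z : R[i]) f : cintegrable mu f ->
  cintegral mu (fun x => z * f x) = z * cintegral mu f.
Proof.
move=> [f1 f2]; apply: eqc; rewrite ?Re_mulc ?Im_mulc /=.
  under eq_Rintegral do rewrite Re_mulc.
  rewrite RintegralB//; [|exact: (integrableZl measurableT _ f1)|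
    exact: (integrableZl measurableT _ f2)].
  by rewrite !RintegralZl.
under eq_Rintegral do rewrite Im_mulc.
rewrite RintegralD//; [|exact: (integrableZl measurableT _ f2)|
  exact: (integrableZl measurableT _ f1)].
by rewrite !RintegralZl.
Qed.

Lemma cintegralB f g : cintegrable mu f -> cintegrable mu g ->
  cintegral mu (fun x => f x - g x) = cintegral mu f - cintegral mu g.
Proof.
move=> fi gi; have := cintegralD fi (cintegrableZl (-1) gi).
rewrite cintegralZl// mulN1r => <-; congr cintegral.
by apply/funext => x; rewrite mulN1r.
Qed.

(** The real and the imaginary part are each bounded by the integral of the modulus, which gives the
    factor 2 in place of the sharp 1. This factor propagates into the later constants. *)
Lemma cmod_cintegral_le f : cintegrable mu f ->
  ((cmod (cintegral mu f))%:E <= 2%:E * \int[mu]_x (cmod (f x))%:E)%E.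
Proof.
move=> fi; have [f1 f2] := fi.
have h (u : T -> R) : mu.-integrable setT (fun x => (u x)%:E) ->
    (forall x, `|u x| <= cmod (f x)) ->
    ((`|\int[mu]_x u x|)%:E <= \int[mu]_x (cmod (f x))%:E)%E.
  move=> ui uf; rewrite EFin_normr_Rintegral//.
  apply: (le_trans (le_abse_integral mu measurableT (measurable_int _ ui))).
  apply: ge0_le_integral => //.
  - by apply: measurableT_comp => //; exact: measurable_int ui.
  - exact: measurable_int (cintegrable_cmod fi).
  - by move=> x _; rewrite lee_fin.
rewrite (_ : 2%:E = 1 + 1)%E// ge0_muleDl// !mul1e.
have h1 := h _ f1 (fun x => Re_le_cmod (f x)).
have h2 := h _ f2 (fun x => Im_le_cmod (f x)).
apply: le_trans (leeD h1 h2).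
by rewrite -EFinD lee_fin; exact: cmod_le_ReIm.
Qed.

End complex_integrable.

Section complex_pushforward.
Context d1 d2 (T1 : measurableType d1) (T2 : measurableType d2) (R : realType).
Variables (mu : {measure set T1 -> \bar R}) (nu : {measure set T2 -> \bar R}).
Variables (phi : T1 -> T2) (mphi : measurable_fun setT phi).
Hypothesis nuE : forall A, measurable A -> nu A = mu (phi @^-1` A).

(** The image measure is given through [nuE] instead of a pushforward, so that [nu] may be [mu]
    itself (an invariant measure) or a scaled Lebesgue measure. *)
Lemma ge0_integral_image (f : T2 -> \bar R) : measurable_fun setT f ->
  (forall y, 0 <= f y)%E -> (\int[nu]_y f y = \int[mu]_x f (phi x))%E.
Proof.
move=> mf f0.
rewrite (eq_measure_integral (pushforward mu phi)); last first.
  by move=> A mA _; rewrite nuE.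
by rewrite ge0_integral_pushforward.
Qed.

Lemma cintegral_image (f : T2 -> R[i]) : cmeasurable f ->
  cintegrable mu (f \o phi) -> cintegrable nu f /\
  cintegral nu f = cintegral mu (f \o phi).
Proof.
move=> mf fi; split.
  apply/cintegrableP; split => //; rewrite ge0_integral_image.
  - by have /cintegrableP[] := fi.
  - by apply/measurable_EFinP; exact: cmeasurable_cmod.
  - by move=> y; rewrite lee_fin cmod_ge0.
have E (u : T2 -> R) : measurable_fun setT (EFin \o u) ->
    mu.-integrable setT (EFin \o (u \o phi)) ->
    \int[nu]_y u y = \int[mu]_x u (phi x).
  move=> mu' ui; rewrite /Rintegral; congr fine.
  rewrite (eq_measure_integral (pushforward mu phi)); last first.
    by move=> A mA _; rewrite nuE.
  by rewrite integral_pushforward.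
by rewrite /cintegral; congr (_ +i* _);
  apply: E => //; try exact: fi.1; try exact: fi.2;
  apply/measurable_EFinP; case: mf.
Qed.

End complex_pushforward.

Section complex_fubini.
Context d1 d2 (T1 : measurableType d1) (T2 : measurableType d2) (R : realType).
Variables (m1 : {sigma_finite_measure set T1 -> \bar R}).
Variables (m2 : {sigma_finite_measure set T2 -> \bar R}).

Lemma cfubini (f : T1 * T2 -> R[i]) : cmeasurable f ->
  (\int[m1]_x \int[m2]_y (cmod (f (x, y)))%:E < +oo)%E ->
  cintegral m1 (fun x => cintegral m2 (fun y => f (x, y))) =
  cintegral m2 (fun y => cintegral m1 (fun x => f (x, y))).
Proof.
move=> mf fi.
have [fr fI] : cintegrable (m1 \x m2)%E f.
  apply/cintegrableP; split => //; rewrite fubini_tonelli1//.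
    by apply/measurable_EFinP; exact: cmeasurable_cmod.
  by move=> z; rewrite lee_fin cmod_ge0.
have E (u : T1 * T2 -> R) : (m1 \x m2)%E.-integrable setT (EFin \o u) ->
   fine (\int[m1]_x (fine (\int[m2]_y (u (x, y))%:E))%:E) =
   fine (\int[m2]_y (fine (\int[m1]_x (u (x, y))%:E))%:E).
  move=> ui.
  congr fine.
  (* [fine] turns an infinite inner integral into 0. By Fubini this happens on a null set only,
     whence the two almost-everywhere equalities. *)
  transitivity (\int[m1]_x (\int[m2]_y (u (x, y))%:E))%E.
    apply: ae_eq_integral => //.
    - apply/measurable_EFinP; apply: measurableT_comp => //.
      exact: (measurable_fubini_F ui).
    - exact: (measurable_fubini_F ui).
    - have := ae_integrable1 ui; apply: filterS => x h _.
      by rewrite fineK//; apply: integrable_fin_num.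
  transitivity (\int[m2]_y (\int[m1]_x (u (x, y))%:E))%E.
    exact: (Fubini ui).
  apply: ae_eq_integral => //.
  - exact: (measurable_fubini_G ui).
  - apply/measurable_EFinP; apply: measurableT_comp => //.
    exact: (measurable_fubini_G ui).
  - have := ae_integrable2 ui; apply: filterS => x h _.
    by rewrite fineK//; apply: integrable_fin_num.
rewrite /cintegral /Rintegral /=; congr (_ +i* _).
  exact: (E (fun z => complex.Re (f z)) fr).
exact: (E (fun z => complex.Im (f z)) fI).
Qed.

End complex_fubini.

(** * Lebesgue measure and Euclidean balls *)

Definition image_measure d1 d2 (T1 : measurableType d1) (T2 : measurableType d2)
    (R : realType) (mu : {measure set T1 -> \bar R}) (phi : T1 -> T2)
    (mphi : measurable_fun setT phi) : {measure set T2 -> \bar R} :=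
  measure_function_pushforward__canonical__measure_function_Measure mu mphi.

Section lebesgue_affine.
Context {R : realType}.

(** Lebesgue measure is determined by its values on half-open intervals, where [r] times the measure
    of the preimage is computed directly. *)
Lemma lebesgue_measure_affine (r v : R) (A : set (measurableTypeR R)) : 0 < r ->
  measurable A ->
  (@lebesgue_measure R ((fun x => (r * x + v)%R) @^-1` A) =
   (r^-1)%:E * @lebesgue_measure R A)%E.
Proof.
move=> r0 mA.
have mphi : measurable_fun setT (fun x : measurableTypeR R => r * x + v : measurableTypeR R).
  by apply: measurable_funD => //; exact: measurable_funM.
have rnn : 0 <= r by exact: ltW.
pose mu : {measure set (measurableTypeR R) -> \bar R} :=
  mscale (NngNum rnn) (image_measure (@lebesgue_measure R) mphi).
have -> : @lebesgue_measure R A = mu A; last first.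
  by rewrite /mu /mscale /= muleA -EFinM mulVf ?gt_eqF// mul1e.
apply: lebesgue_measure_unique => // X /ocitvP[->|[[a b] /= ab ->]].
  by rewrite !measure0.
rewrite -[RHS]/(r%:E * @lebesgue_measure R ((fun x => r * x + v)%R @^-1` `]a, b]%classic))%E.
rewrite (_ : _ @^-1` _ = [set` `](a - v) / r, (b - v) / r]]); last first.
  apply/seteqP; split => x /=; rewrite !in_itv /= ltr_pdivrMr// ler_pdivlMr//;
    by rewrite ltrBlDr lerBrDr (mulrC x).
rewrite !lebesgue_measure_itv /= !lte_fin ab ltr_pM2r ?invr_gt0// ltrD2r ab.
by rewrite -!EFinB -EFinM; congr EFin; field; rewrite gt_eqF.
Qed.

Context {n : nat}.
Local Notation rV := 'rV[R]_n.

Definition coord_box (A : 'I_n -> set (measurableTypeR R)) : set rV :=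
  [set x | forall i, A i (x ord0 i)].

Definition cube (a : R) : set rV := coord_box (fun=> `]- a, a[%classic).

Let boxes := [set B | exists2 A, (forall i, measurable (A i)) & B = coord_box A].

Lemma measurable_coord_box A : (forall i, measurable (A i)) ->
  measurable (coord_box A).
Proof.
move=> mA.
rewrite [X in measurable X](_ : _ = \bigcap_(i : 'I_n)
      (fun x : rV => x ord0 i) @^-1` A i).
  apply: fin_bigcap_measurable => // i _; rewrite -[X in measurable X]setTI.
  exact: (@measurable_coor R n i measurableT _ (mA _)).
by apply/seteqP; split => x h i => [_|]; exact: h.
Qed.

Lemma measurable_rV_boxes : @measurable _ rV = <<s boxes >>.
Proof.
apply/seteqP; split; last first.
  apply: smallest_sub; first exact: sigma_algebra_measurable.
  by move=> B [A mA ->]; exact: measurable_coord_box.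
apply: smallest_sub; first exact: smallest_sigma_algebra.
move=> A; rewrite -bigcup_seq => -[i _] [B mB <-].
rewrite setTI; apply: sub_sigma_algebra.
exists (fun j => if j == i then B else setT).
  by move=> j; case: ifP.
apply/seteqP; split => x /= h.
  by move=> j; case: eqP => // ->.
by have := h i; rewrite eqxx.
Qed.

Lemma boxes_setI : setI_closed boxes.
Proof.
move=> _ _ [A mA ->] [B mB ->]; exists (fun i => A i `&` B i).
  by move=> i; exact: measurableI.
apply/seteqP; split => x /=; first by move=> [h1 h2] i; split.
by move=> h; split => i; have [] := h i.
Qed.

(** Boxes form a pi-system generating the sigma-algebra, and the integer cubes exhaust the space
    with finite mass. *)
Lemma measure_rV_unique (m1 m2 : {measure set rV -> \bar R}) :
  (forall A, (forall i, measurable (A i)) -> m1 (coord_box A) = m2 (coord_box A)) ->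
  (forall a : R, m1 (cube a) < +oo)%E ->
  forall B, measurable B -> m1 B = m2 B.
Proof.
move=> m12 mfin.
apply: (measure_unique boxes
  (fun k : nat => cube k%:R)) => //.
- exact: measurable_rV_boxes.
- exact: boxes_setI.
- by move=> i; exists (fun=> `]- i%:R, i%:R[%classic).
- rewrite -subTset => x _.
  have [k kx] : exists k : nat, forall i, `|x ord0 i| < k%:R.
    exists (\max_(i < n) (Num.truncn `|x ord0 i|).+1)%N => i.
    apply: (lt_le_trans (truncnS_gt _)).
    by rewrite ler_nat; exact: (leq_bigmax i).
  by exists k => // i /=; rewrite in_itv /= -ltr_norml.
- by move=> _ [A mA ->]; exact: m12.
Qed.

Lemma measurable_fun_affine (r : R) (v : rV) :
  measurable_fun setT (fun x : rV => r *: x + v).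
Proof.
apply: measurable_fun_coorP => i; under eq_fun do rewrite !mxE.
apply: measurable_funD => //; apply: measurable_funM => //; exact: measurable_coor.
Qed.

Lemma lebesgue_rV_cube (a : R) :
  (lebesgue_rV n (cube a) < +oo)%E.
Proof.
rewrite lebesgue_rV_box//.
suff : ((\prod_(i < n) @lebesgue_measure R `](- a)%R, a[%classic < +oo) /\
        (0 <= \prod_(i < n) @lebesgue_measure R `](- a)%R, a[%classic))%E by case.
apply: (big_ind (fun x : \bar R => (x < +oo)%E /\ (0 <= x)%E)) => [|x y|i _].
- by rewrite ltry lee_fin ler01.
- move=> [x1 x2] [y1 y2]; split; last exact: mule_ge0.
  by apply: lte_mul_pinfty => //; rewrite ge0_fin_numE.
- by rewrite measure_ge0 lebesgue_measure_itv /=; case: ifP => // _; rewrite ltry.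
Qed.

Lemma lebesgue_rV_affine (r : R) (v : rV) (A : set rV) : 0 < r -> measurable A ->
  (lebesgue_rV n ((fun x : rV => (r *: x + v)%R) @^-1` A) =
   (r ^- n)%:E * lebesgue_rV n A)%E.
Proof.
move=> r0 mA.
have rnn : 0 <= r ^+ n by rewrite exprn_ge0// ltW.
have mphi := measurable_fun_affine r v.
pose mu : {measure set rV -> \bar R} :=
  mscale (NngNum rnn) (image_measure (lebesgue_rV n) mphi).
have -> : lebesgue_rV n A = mu A; last first.
  by rewrite /mu /mscale /= muleA -EFinM mulVf ?expf_neq0 ?gt_eqF// mul1e.
apply: measure_rV_unique => // [B mB|a]; last exact: lebesgue_rV_cube.
rewrite -[RHS]/((r ^+ n)%:E * lebesgue_rV n ((fun x => r *: x + v)%R @^-1` coord_box B))%E.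
rewrite (_ : _ @^-1` _ = coord_box (fun i => (fun x => r * x + v ord0 i) @^-1` B i)); last first.
  by apply/seteqP; split => x /= h i; have := h i; rewrite /= !mxE.
have mphi1 i : measurable ((fun x : measurableTypeR R => r * x + v ord0 i) @^-1` B i).
  rewrite -[X in measurable X]setTI.
  have m : measurable_fun setT (fun x : measurableTypeR R => r * x + v ord0 i : measurableTypeR R).
    by apply: measurable_funD => //; exact: measurable_funM.
  exact: m.
rewrite (lebesgue_rV_box mphi1).
under [in RHS]eq_bigr do rewrite lebesgue_measure_affine//.
rewrite big_split /= prodEFin prodr_const card_ord muleA -EFinM.
by rewrite -exprMn mulfV ?gt_eqF// expr1n mul1e; exact: lebesgue_rV_box.
Qed.

Lemma ge0_integral_affine (r : R) (v : rV) (g : rV -> \bar R) : 0 < r ->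
  measurable_fun setT g -> (forall x, 0 <= g x)%E ->
  (\int[lebesgue_rV n]_x g (r *: x + v)%R =
   (r ^- n)%:E * \int[lebesgue_rV n]_x g x)%E.
Proof.
move=> r0 mg g0.
have rnn : 0 <= r ^- n by rewrite invr_ge0 exprn_ge0// ltW.
pose mu : {measure set rV -> \bar R} := mscale (NngNum rnn) (lebesgue_rV n).
rewrite -(@ge0_integral_image _ _ _ _ _ (lebesgue_rV n) mu _ (measurable_fun_affine r v))//.
  by rewrite ge0_integral_mscale.
by move=> A mA; exact/esym/(lebesgue_rV_affine v r0 mA).
Qed.

Lemma ge0_integral_translate (v : rV) (g : rV -> \bar R) :
  measurable_fun setT g -> (forall x, 0 <= g x)%E ->
  (\int[lebesgue_rV n]_x g (x + v)%R = \int[lebesgue_rV n]_x g x)%E.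
Proof.
move=> mg g0; have := @ge0_integral_affine 1 v g ltr01 mg g0.
under eq_integral do rewrite scale1r.
by rewrite expr1n invr1 mul1e.
Qed.

Lemma cintegral_translate (v : rV) (f : rV -> R[i]) :
  cintegrable (lebesgue_rV n) f ->
  cintegrable (lebesgue_rV n) (fun x => f (x + v)) /\
  cintegral (lebesgue_rV n) (fun x => f (x + v)) = cintegral (lebesgue_rV n) f.
Proof.
move=> fi.
have mphi : measurable_fun setT (fun x : rV => x + v).
  by have := measurable_fun_affine 1 v; under eq_fun do rewrite scale1r.
have mf := cintegrable_cmeasurable fi.
have fvi : cintegrable (lebesgue_rV n) (fun x => f (x + v)).
  apply/cintegrableP; split; first exact: (cmeasurable_comp mf).
  rewrite (@ge0_integral_translate v (fun x => (cmod (f x))%:E)).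
  - by have /cintegrableP[] := fi.
  - by apply/measurable_EFinP; exact: cmeasurable_cmod.
  - by move=> y; rewrite lee_fin cmod_ge0.
split => //.
have [] := @cintegral_image _ _ _ _ _ (lebesgue_rV n) (lebesgue_rV n) _ mphi _ f mf fvi => //.
move=> A mA; have := @lebesgue_rV_affine 1 v A ltr01 mA.
rewrite expr1n invr1 mul1e => /esym h; apply: (etrans h); congr (lebesgue_rV n _).
by apply/seteqP; split => x /=; rewrite scale1r.
Qed.

Lemma cintegral_scale (r : R) (f : rV -> R[i]) : 0 < r ->
  cintegrable (lebesgue_rV n) f ->
  cintegrable (lebesgue_rV n) (fun x => f (r *: x)) /\
  cintegral (lebesgue_rV n) (fun x => f (r *: x)) =
  (r ^- n)%:C * cintegral (lebesgue_rV n) f.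
Proof.
move=> r0 fi.
have rnn : 0 <= r ^- n by rewrite invr_ge0 exprn_ge0// ltW.
have mphi : measurable_fun setT (fun x : rV => r *: x).
  by have := measurable_fun_affine r 0; under eq_fun do rewrite addr0.
have mf := cintegrable_cmeasurable fi.
have fvi : cintegrable (lebesgue_rV n) (fun x => f (r *: x)).
  apply/cintegrableP; split; first exact: (cmeasurable_comp mf).
  under eq_integral do rewrite -[X in f X]addr0.
  rewrite (@ge0_integral_affine r 0 (fun x => (cmod (f x))%:E) r0).
  - by rewrite lte_mul_pinfty ?lee_fin//; have /cintegrableP[] := fi.
  - by apply/measurable_EFinP; exact: cmeasurable_cmod.
  - by move=> y; rewrite lee_fin cmod_ge0.
split => //.
pose mu : {measure set rV -> \bar R} := mscale (NngNum rnn) (lebesgue_rV n).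
have [|_ <-] := @cintegral_image _ _ _ _ _ (lebesgue_rV n) mu _ mphi _ f mf fvi => //.
  move=> A mA; have := @lebesgue_rV_affine r 0 A r0 mA.
  move=> /esym h; apply: (etrans h); congr (lebesgue_rV n _).
  by apply/seteqP; split => x /=; rewrite addr0.
have E (u : rV -> R) : (lebesgue_rV n).-integrable setT (EFin \o u) ->
    \int[mu]_x u x = r ^- n * \int[lebesgue_rV n]_x u x.
  move=> ui; rewrite /Rintegral integralE.
  have mpos := measurable_funepos (measurable_int _ ui).
  have mneg := measurable_funeneg (measurable_int _ ui).
  rewrite !ge0_integral_mscale//= -muleBr//.
    by rewrite -integralE fineM//; exact: integrable_fin_num.
  by apply/fin_num_adde_defr; apply: integrable_pos_fin_num.
by apply: eqc; rewrite ?Re_mulc ?Im_mulc /= mul0r ?subr0 ?addr0 E//; case: fi.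
Qed.

End lebesgue_affine.

Section euclidean_norm.
Context {R : realType} {n : nat}.
Local Notation rV := 'rV[R]_n.
Implicit Types (x y z u : rV) (r a : R).

Lemma dotpC x y : dotp x y = dotp y x.
Proof. by apply: eq_bigr => i _; rewrite mulrC. Qed.

Lemma dotpDl x y z : dotp (x + y) z = dotp x z + dotp y z.
Proof. by rewrite -big_split; apply: eq_bigr => i _; rewrite /= mxE mulrDl. Qed.

Lemma dotpZl a x z : dotp (a *: x) z = a * dotp x z.
Proof. by rewrite mulr_sumr; apply: eq_bigr => i _; rewrite /= mxE mulrA. Qed.

Lemma dotpNl x z : dotp (- x) z = - dotp x z.
Proof. by rewrite -scaleN1r dotpZl mulN1r. Qed.

Lemma dotpDr x y z : dotp z (x + y) = dotp z x + dotp z y.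
Proof. by rewrite dotpC dotpDl !(dotpC z). Qed.

Lemma dotpZr a x z : dotp z (a *: x) = a * dotp z x.
Proof. by rewrite dotpC dotpZl (dotpC z). Qed.

Lemma dotp_ge0 x : 0 <= dotp x x.
Proof. by apply: sumr_ge0 => i _; rewrite -expr2 sqr_ge0. Qed.

Lemma enorm_ge0 x : 0 <= enorm x. Proof. exact: sqrtr_ge0. Qed.

Lemma sqr_enorm x : enorm x ^+ 2 = dotp x x.
Proof. by rewrite sqr_sqrtr// dotp_ge0. Qed.

Lemma coord_le_enorm x i : `|x ord0 i| <= enorm x.
Proof.
rewrite -ler_sqr ?nnegrE ?enorm_ge0// sqr_enorm real_normK ?num_real//.
rewrite /dotp (bigD1 i)//= -expr2 lerDl sumr_ge0// => j _.
by rewrite -expr2 sqr_ge0.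
Qed.

Lemma enorm0 : enorm (0 : rV) = 0.
Proof.
by rewrite /enorm /dotp big1 ?sqrtr0// => i _; rewrite mxE mul0r.
Qed.

Lemma enorm_eq0 x : enorm x = 0 -> x = 0.
Proof.
move=> x0; apply/rowP => i; rewrite mxE; apply/eqP; rewrite -normr_le0 -x0.
exact: coord_le_enorm.
Qed.

(** Cauchy-Schwarz: the squared norm of <y,y> x - <x,y> y equals <y,y> (<x,x> <y,y> - <x,y>^2). *)
Lemma dotp_le x y : `|dotp x y| <= enorm x * enorm y.
Proof.
have [c0|cpos] := leP (enorm y) 0.
  have /enorm_eq0 -> : enorm y = 0 by apply/eqP; rewrite eq_le c0 enorm_ge0.
  by rewrite enorm0 mulr0 /dotp big1 ?normr0// => i _; rewrite mxE mulr0.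
rewrite -ler_sqr ?nnegrE ?mulr_ge0 ?enorm_ge0// real_normK ?num_real//.
rewrite exprMn !sqr_enorm.
have c0 : 0 < dotp y y by rewrite -sqr_enorm exprn_gt0.
have := dotp_ge0 (dotp y y *: x - dotp x y *: y).
rewrite !(dotpDl, dotpDr, dotpZl, dotpZr, dotpNl) !(dotpC _ (- _)) !dotpNl.
rewrite !(dotpZl, dotpZr) (dotpC y x).
set A := dotp x x; set B := dotp x y; set C := dotp y y => h.
have : 0 <= C * (A * C - B ^+ 2) by move: h; congr (0 <= _); ring.
by rewrite pmulr_rge0// subr_ge0.
Qed.

Lemma enormD x y : enorm (x + y) <= enorm x + enorm y.
Proof.
rewrite -ler_sqr ?nnegrE ?addr_ge0 ?enorm_ge0//.
rewrite sqr_enorm sqrrD !sqr_enorm dotpDl !dotpDr (dotpC y x).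
rewrite [leLHS](_ : _ = dotp x x + (dotp x y) *+ 2 + dotp y y); last ring.
by rewrite lerD2r lerD2l lerMn2r /= (le_trans (ler_norm _))// dotp_le.
Qed.

Lemma enormZ a x : enorm (a *: x) = `|a| * enorm x.
Proof.
by rewrite /enorm dotpZl dotpZr mulrA -expr2 sqrtrM ?sqr_ge0// sqrtr_sqr.
Qed.

Lemma enormN x : enorm (- x) = enorm x.
Proof. by rewrite -scaleN1r enormZ normrN1 mul1r. Qed.

Lemma enormB x y : enorm (x - y) = enorm (y - x).
Proof. by rewrite -enormN opprB. Qed.

Lemma enorm_le_sum x : enorm x <= \sum_(i < n) `|x ord0 i|.
Proof.
have s0 (I : seq 'I_n) : 0 <= \sum_(i <- I) `|x ord0 i| by rewrite sumr_ge0.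
rewrite -ler_sqr ?nnegrE ?enorm_ge0// sqr_enorm /dotp.
elim: (index_enum _) => [|i s ih]; first by rewrite !big_nil expr0n.
rewrite !big_cons sqrrD.
have h : x ord0 i * x ord0 i = `|x ord0 i| ^+ 2 by rewrite real_normK ?num_real.
rewrite -h -addrA lerD2l (le_trans ih)// lerDr mulrn_wge0// mulr_ge0//.
Qed.

(** The topology of ['rV[R]_n] is that of the sup norm; the two norms are compared in order to
    transfer openness and compactness. *)
Lemma enorm_le_sup x : enorm x <= n%:R * `|x|.
Proof.
apply: (le_trans (enorm_le_sum x)).
have {1}-> : n%:R * `|x| = \sum_(i < n) `|x|.
  by rewrite sumr_const card_ord mulr_natl.
apply: ler_sum => i _.
rewrite [leRHS]/Num.norm /= mx_normrE.
exact: (le_bigmax _ (fun ij : 'I_1 * 'I_n => `|x ij.1 ij.2|) (ord0, i)).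
Qed.

Lemma sup_le_enorm x : `|x| <= enorm x.
Proof.
rewrite [leLHS]/Num.norm /= mx_normrE.
apply: bigmax_le; first exact: enorm_ge0.
by move=> [i j] _ /=; rewrite (ord1 i) coord_le_enorm.
Qed.

Lemma measurable_dotp u : measurable_fun setT (fun x => dotp u x).
Proof.
rewrite /dotp; apply: measurable_sum => i.
exact: (measurable_funM (measurable_cst _) (measurable_coor i)).
Qed.

Lemma measurable_enorm : measurable_fun setT (fun x : rV => enorm x).
Proof.
apply: (@measurableT_comp _ _ _ _ _ _ (@Num.sqrt R)).
  exact: (continuous_measurable_fun (@sqrt_continuous R)).
rewrite /dotp; apply: measurable_sum => i.
by apply: (measurable_funM (measurable_coor i) (measurable_coor i)).
Qed.

Lemma measurable_enorm_lt r : measurable (eball r : set rV).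
Proof.
have := measurable_enorm measurableT (measurable_itv `]-oo, r[%R).
rewrite setTI; congr measurable; apply/seteqP; split => x /=; by rewrite in_itv.
Qed.

Lemma eball_sub r r' : r <= r' -> (eball r : set rV) `<=` eball r'.
Proof. by move=> rr x /= /lt_le_trans; apply. Qed.

Lemma bounded_eball r : bounded_rV (eball r : set rV). Proof. by exists r. Qed.

Lemma bounded_sub (A B : set rV) : A `<=` B -> bounded_rV B -> bounded_rV A.
Proof. by move=> AB [r Br]; exists r; exact: subset_trans Br. Qed.

Lemma bounded_setIl (A B : set rV) : bounded_rV A -> bounded_rV (A `&` B).
Proof. by apply: bounded_sub; exact: subIsetl. Qed.

Lemma bounded_translate (A : set rV) v : bounded_rV A ->
  bounded_rV ((fun x => x + v) @^-1` A).
Proof.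
move=> [r Ar]; exists (r + enorm v) => x /= /Ar /=; rewrite /eball/= => h.
rewrite -[x](addrK v) (le_lt_trans (enormD _ _))// enormN ltrD2r//.
Qed.

Lemma eball_bigcup : \bigcup_k eball k%:R = [set: rV].
Proof.
rewrite -subTset => x _; exists (Num.truncn (enorm x)).+1 => //=.
exact: truncnS_gt.
Qed.

Lemma eball_cube (a : R) : (cube a : set rV) `<=` eball (n%:R * a + 1).
Proof.
move=> x xa; rewrite /eball /=; apply: (le_lt_trans (enorm_le_sum x)).
apply: (@le_lt_trans _ _ (n%:R * a)); last by rewrite ltrDl.
rewrite (_ : n%:R * a = \sum_(i < n) a); last by rewrite sumr_const card_ord mulr_natl.
by apply: ler_sum => i _; have := xa i; rewrite /= in_itv /= -ltr_norml => /ltW.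
Qed.

Lemma cube_eball (a : R) : (eball a : set rV) `<=` cube a.
Proof.
move=> x xa i; rewrite /= in_itv /= -ltr_norml (le_lt_trans (coord_le_enorm x i))//.
Qed.

Lemma lebesgue_locally_finite : locally_finite (@lebesgue_rV R n).
Proof.
move=> A mA [r Ar]; apply: (le_lt_trans _ (@lebesgue_rV_cube R n r)).
apply: le_measure; rewrite ?inE//.
  by apply: measurable_coord_box => i; exact: measurable_itv.
by apply: (subset_trans Ar); exact: cube_eball.
Qed.

Lemma lebesgue_eball r : 0 < r ->
  lebesgue_rV n (eball r : set rV) = ((r ^+ n)%:E * lebesgue_rV n (eball 1%R : set rV))%E.
Proof.
move=> r0.
have ri : 0 < r^-1 by rewrite invr_gt0.
have := @lebesgue_rV_affine R n r^-1 0 (eball 1) ri (measurable_enorm_lt 1).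
rewrite exprVn invrK => h; rewrite -[RHS]h; congr (lebesgue_rV n _).
apply/seteqP; split => x /=; rewrite /eball /= addr0 enormZ gtr0_norm//.
  by rewrite mulrC ltr_pdivrMr// mul1r.
by rewrite mulrC ltr_pdivrMr// mul1r.
Qed.

Lemma lebesgue_eball_gt0 r : 0 < r -> (0 < lebesgue_rV n (eball r : set rV))%E.
Proof.
(* The cube of half-side [a] fits in the ball because n a < 2 (n + 1) a = r; the [n + 1] avoids a
   division by 0 in dimension 0. *)
move=> r0; pose a := r / (n%:R + 1) / 2.
have n1 : 0 < n%:R + 1 :> R by rewrite ltr_wpDl.
have a0 : 0 < a by rewrite !divr_gt0.
pose D : set rV := coord_box (fun=> `]- a, a[%classic).
have mD : measurable D by apply: measurable_coord_box => i; exact: measurable_itv.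
apply: (@lt_le_trans _ _ (lebesgue_rV n D)); last first.
  apply: le_measure; rewrite ?inE//; first exact: measurable_enorm_lt.
  move=> x xa; rewrite /eball /=; apply: (le_lt_trans (enorm_le_sum x)).
  apply: (@le_lt_trans _ _ (n%:R * a)).
    rewrite (_ : n%:R * a = \sum_(i < n) a); last by rewrite sumr_const card_ord mulr_natl.
    by apply: ler_sum => i _; have := xa i; rewrite /= in_itv /= -ltr_norml => /ltW.
  apply: (@lt_le_trans _ _ ((n%:R + 1) * (a * 2))).
    rewrite mulrDl mul1r ltr_pwDr ?mulr_gt0// ler_wpM2l// mulr_natr mulr2n lerDl ltW//.
  by rewrite /a divfK// mulrC divfK ?gt_eqF.
rewrite lebesgue_rV_box; last by move=> i; exact: measurable_itv.
apply: (big_ind (fun x : \bar R => (0 < x)%E)) => [||i _].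
- by rewrite lte_fin.
- by move=> x y; exact: mule_gt0.
- have aa : - a < a by lra.
  by rewrite lebesgue_measure_itv /= lte_fin aa -EFinD lte_fin opprK addr_gt0.
Qed.

Lemma lebesgue_eball_fin r : lebesgue_rV n (eball r : set rV) \is a fin_num.
Proof.
rewrite ge0_fin_numE//; apply: lebesgue_locally_finite.
  exact: measurable_enorm_lt.
exact: bounded_eball.
Qed.

Lemma open_eball r x : open ((fun y => y + x) @^-1` (eball r : set rV)).
Proof.
rewrite openE => y yr; rewrite /interior; apply/nbhs_ballP.
have n1 : 0 < n%:R + 1 :> R by rewrite ltr_wpDl.
have e0 : 0 < (r - enorm (y + x)) / (n%:R + 1).
  by rewrite divr_gt0// subr_gt0.
exists ((r - enorm (y + x)) / (n%:R + 1)) => //= z.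
rewrite -ball_normE /= => yz; rewrite /eball /=.
have -> : z + x = (z - y) + (y + x) by rewrite addrA subrK.
apply: (le_lt_trans (enormD _ _)); rewrite -ltrBrDr.
rewrite enormB; apply: (le_lt_trans (enorm_le_sup _)).
apply: (@le_lt_trans _ _ ((n%:R + 1) * `|y - z|)).
  by rewrite ler_wpM2r// lerDl.
by rewrite mulrC -ltr_pdivlMr.
Qed.

Lemma closed_ball_compact r : compact [set x : rV | `|x| <= r].
Proof.
apply: bounded_closed_compact.
  exists r; split; first exact: num_real.
  by move=> M rM x /= xr; rewrite (le_trans xr)// ltW.
have -> : [set x : rV | `|x| <= r] = (fun x : rV => `|x|) @^-1` [set t | t <= r].
  by [].
apply: preimage_closed; first by move=> x _; exact: norm_continuous.
exact: closed_le.
Qed.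

Lemma bounded_closure_compact (A : set rV) : bounded_rV A -> compact (closure A).
Proof.
move=> [r Ar].
apply: (subclosed_compact (@closed_closure _ _) (@closed_ball_compact r)).
have cl : closed [set x : rV | `|x| <= r].
  apply: compact_closed; [exact: norm_hausdorff|exact: closed_ball_compact].
apply: (subset_trans (closure_subset (B := [set x : rV | `|x| <= r]) _)).
  move=> x /Ar; rewrite /eball /= => xr.
  exact: (le_trans (sup_le_enorm x) (ltW xr)).
by rewrite -(closure_id _).1.
Qed.

(** By stationarity, a finite cover by translates of the unit ball reduces moments over bounded sets
    to the unit ball, the only set on which square integrability is assumed. *)
Lemma compact_eball_cover (A : set rV) : compact A ->
  exists s : seq rV, forall x, A x -> exists2 c, c \in s & eball 1 (x - c).
Proof.
rewrite compact_cover => cA.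
have [|x Ax|D _ AD] := cA rV setT (fun c => (fun y => y - c) @^-1` (eball 1 : set rV)).
- by move=> c _; exact: open_eball.
- by exists x => //; rewrite /eball /= subrr enorm0.
exists (finmap.enum_fset D) => x Ax.
by have [c /= cD xc] := AD x Ax; exists c.
Qed.

Lemma compact_bounded_rV (A : set rV) : compact A -> bounded_rV A.
Proof.
move=> /compact_eball_cover[s sA].
exists (\sum_(c <- s) (enorm c + 1) + 1) => x /sA[c cs xc].
rewrite /eball /= -[x](subrK c); apply: (le_lt_trans (enormD _ _)).
have : enorm c + 1 <= \sum_(c <- s) (enorm c + 1).
  rewrite (big_rem c)//= lerDl sumr_ge0// => i _.
  by rewrite addr_ge0 ?enorm_ge0.
move: xc; rewrite /eball /=; lra.
Qed.

End euclidean_norm.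

(** * Approximation by a countable algebra and continuity of translations *)

(* Terms for the elements of the countable Boolean algebra generated by a sequence
   of sets. *)
Inductive bform : Type := BLeaf of nat | BNot of bform | BOr of bform & bform.

(** Terms are encoded as trees in order to be enumerated by [nat]: a supremum over the algebra is
    then the supremum of a sequence, hence measurable. *)
Fixpoint bform_tree (b : bform) : GenTree.tree nat :=
  match b with
  | BLeaf k => GenTree.Leaf k
  | BNot b => GenTree.Node 0 [:: bform_tree b]
  | BOr b c => GenTree.Node 1 [:: bform_tree b; bform_tree c]
  end.

Fixpoint tree_bform (t : GenTree.tree nat) : bform :=
  match t with
  | GenTree.Leaf k => BLeaf k
  | GenTree.Node _ [:: t] => BNot (tree_bform t)
  | GenTree.Node _ [:: t; t'] => BOr (tree_bform t) (tree_bform t')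
  | _ => BLeaf 0
  end.

Lemma bform_treeK : cancel bform_tree tree_bform.
Proof. by elim => //= [b ->|b -> c ->]. Qed.

Definition nth_bform (k : nat) : bform :=
  if unpickle k is Some t then tree_bform t else BLeaf 0.

Lemma nth_bform_surj b : exists k, nth_bform k = b.
Proof.
by exists (pickle (bform_tree b)); rewrite /nth_bform pickleK bform_treeK.
Qed.

Section boolean_approximation.
Context d (T : measurableType d) (R : realType).
Variable G : nat -> set T.

Fixpoint bset (b : bform) : set T :=
  match b with
  | BLeaf k => G k
  | BNot b => ~` bset b
  | BOr b c => bset b `|` bset c
  end.

Definition symdiff (A B : set T) := (A `\` B) `|` (B `\` A).

Lemma symdiff_triangle A B C : symdiff A C `<=` symdiff A B `|` symdiff B C.
Proof.
move=> x [[Ax nC]|[Cx nA]]; have [Bx|nB] := pselect (B x).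
- by right; left.
- by left; left.
- by left; right.
- by right; right.
Qed.

Lemma symdiffC A B : symdiff (~` A) (~` B) = symdiff A B.
Proof.
rewrite /symdiff; apply/seteqP; split=> x /=.
  by move=> [[nA /contrapT Bx]|[nB /contrapT Ax]]; [right|left].
by move=> [[Ax nB]|[Bx nA]]; [right|left]; split => //; exact.
Qed.

Hypothesis mG : @measurable _ T = <<s range G >>.

Lemma measurable_bset b : measurable (bset b).
Proof.
elim: b => [k|b ih|b ihb c ihc] /=.
- by rewrite mG; apply: sub_sigma_algebra; exists k.
- exact: measurableC.
- exact: measurableU.
Qed.

Lemma measurable_symdiff A B : measurable A -> measurable B ->
  measurable (symdiff A B).
Proof. by move=> mA mB; apply: measurableU; exact: measurableD. Qed.

(** The sets approximable to every precision form a sigma-algebra containing the generators. A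
    countable union is first replaced by a finite one, which is close because the remainders
    decrease to the empty set and [mu] is finite. *)
Lemma bset_approx (mu : {measure set T -> \bar R}) (A : set T) (e : R) :
  (mu setT < +oo)%E -> measurable A -> 0 < e ->
  exists b, (mu (symdiff A (bset b)) < e%:E)%E.
Proof.
move=> mufin mA e0.
have le_mu X Y : measurable X -> measurable Y -> X `<=` Y -> (mu X <= mu Y)%E.
  by move=> mX mY XY; apply: le_measure; rewrite ?inE.
have muf X : measurable X -> (mu X < +oo)%E.
  by move=> mX; apply: (le_lt_trans _ mufin); exact: le_mu.
pose C := [set A | measurable A /\
  forall e : R, 0 < e -> exists b, (mu (symdiff A (bset b)) < e%:E)%E].
have C0 : C set0.
  (* The empty set needs a term: the complement of [G 0] joined with its own complement. *)
  split => // e' e'0; exists (BNot (BOr (BLeaf 0) (BNot (BLeaf 0)))).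
  rewrite /= /symdiff set0D setD0 set0U setUv setCT measure0//.
have CC X : C X -> C (~` X).
  move=> [mX CX]; split; first exact: measurableC.
  by move=> e' /CX[b hb]; exists (BNot b); rewrite /= symdiffC.
have CU X Y : C X -> C Y -> C (X `|` Y).
  move=> [mX CX] [mY CY]; split; first exact: measurableU.
  move=> e' e'0; have e20 : 0 < e' / 2 by rewrite divr_gt0.
  have [b hb] := CX _ e20; have [c hc] := CY _ e20; exists (BOr b c).
  have mb := measurable_bset b; have mc := measurable_bset c.
  apply: (@le_lt_trans _ _ (mu (symdiff X (bset b)) + mu (symdiff Y (bset c)))%E).
    apply: le_trans (measureU2 _ _ _); try exact: measurable_symdiff.
    apply: le_mu.
    - by apply: measurable_symdiff => //=; exact: measurableU.
    - by apply: measurableU; exact: measurable_symdiff.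
    - rewrite /symdiff /= => x [[[Xx|Yx] /not_orP[nb nc]]|[[bx|cx] /not_orP[nX nY]]].
      + by left; left.
      + by right; left.
      + by left; right.
      + by right; right.
  by rewrite [in ltRHS](splitr e') EFinD lteD.
suff sC : sigma_algebra setT C.
  have : <<s range G >> `<=` C.
    apply: smallest_sub => // _ [k _ <-]; split; first exact: (measurable_bset (BLeaf k)).
    move=> e' e'0; exists (BLeaf k).
    by rewrite /symdiff /= setDv setU0 measure0.
  by rewrite -mG => /(_ _ mA) [_]; apply.
split => //.
  by move=> X CX; rewrite setTD; exact: CC.
move=> F CF.
have mF k : measurable (F k) by have [] := CF k.
have mU : measurable (\bigcup_k F k) by exact: bigcup_measurable.
split => // e' e'0; have e20 : 0 < e' / 2 by rewrite divr_gt0.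
pose U k := \big[setU/set0]_(i < k.+1) F i.
have CUk k : C (U k).
  rewrite /U; elim: k.+1 => [|m ih]; first by rewrite big_ord0.
  by rewrite big_ord_recr /=; exact: CU.
have mUk k : measurable (U k) by have [] := CUk k.
pose D k := (\bigcup_k F k) `\` U k.
have mD k : measurable (D k) by exact: measurableD.
have D0 : \bigcap_k D k = set0.
  rewrite -subset0 => x Dx; have [] := Dx 0%N I.
  rewrite -bigcup_bigsetU_bigcup => -[k _ Ukx] _.
  by have [_] := Dx k I; apply.
have : mu (D k) @[k --> \oo] --> 0%E.
  rewrite -(measure0 mu) -D0; apply: nonincreasing_cvg_mu => //.
  - exact: muf.
  - by rewrite D0.
  - move=> i j ij; apply/subsetPset; apply: setDS.
    by apply: subset_bigsetU.
move=> /fine_cvgP[_ /cvgrPdist_lt /(_ _ e20)[k _ /(_ k (leqnn k))]] /=.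
rewrite sub0r normrN ger0_norm ?fine_ge0// => hk.
have [b hb] := (CUk k).2 _ e20; exists b.
apply: (@le_lt_trans _ _ (mu (D k) + mu (symdiff (U k) (bset b)))%E).
  apply: le_trans (measureU2 _ _ _) => //; last first.
    by apply: measurable_symdiff => //; exact: measurable_bset.
  apply: le_mu.
  - by apply: measurable_symdiff => //; exact: measurable_bset.
  - by apply: measurableU => //; apply: measurable_symdiff => //; exact: measurable_bset.
  - apply: (subset_trans (@symdiff_triangle _ (U k) _)); apply: setSU.
    move=> x [//|[Ux]] /=; case.
    by rewrite -bigcup_bigsetU_bigcup; exists k.
rewrite [in ltRHS](splitr e') EFinD lteD//.
by rewrite -[X in (X < _)%E]fineK ?lte_fin// ge0_fin_numE// muf.
Qed.

End boolean_approximation.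

Section half_spaces.
Context {R : realType} {n : nat}.
Local Notation rV := 'rV[R]_n.

(** Rational half-spaces are countably many generators whose bounding hyperplanes are null sets.
    Numbers that code no pair give the empty set, which does not affect the generated
    sigma-algebra. *)
Definition half_space (k : nat) : set rV :=
  if unpickle k is Some (i, q) then [set x | x ord0 i < ratr (q : rat)]
  else set0.

Lemma half_spaceE (i : 'I_n) (q : rat) :
  half_space (pickle (i, q)) = [set x | x ord0 i < ratr q].
Proof. by rewrite /half_space pickleK. Qed.

Lemma measurable_half_space : @measurable _ rV = <<s range half_space >>.
Proof.
apply/seteqP; split; last first.
  apply: smallest_sub; first exact: sigma_algebra_measurable.
  move=> _ [k _ <-]; rewrite /half_space; case: (unpickle _) => [[i q]|//].
  have := @measurable_coor R n i measurableT _ (measurable_itv `]-oo, (ratr q)[%R).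
  rewrite setTI; congr measurable; apply/seteqP; split => x /=; by rewrite in_itv.
apply: smallest_sub; first exact: smallest_sigma_algebra.
move=> A; rewrite -bigcup_seq => -[i _] [B mB <-].
rewrite setTI.
pose H := [set B : set R | <<s range half_space >> ((fun x : rV => x ord0 i) @^-1` B)].
have sH : sigma_algebra setT H.
  have sO := smallest_sigma_algebra setT (range half_space).
  split; rewrite /H /=.
  - by rewrite preimage_set0; apply: sigma_algebra0.
  - by move=> C mC; rewrite setTD preimage_setC; exact: sigma_algebraC.
  - by move=> C mC; rewrite preimage_bigcup; exact: sigma_algebra_bigcup.
suff : @measurable _ R `<=` H by apply.
have -> : @measurable _ R = (@RGenInftyO.G R).-sigma.-measurable.
  exact: RGenInftyO.measurableE.
apply: smallest_sub => // _ [a ->]; rewrite /H /=.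
(* An open half-line with real endpoint [a] is the union of those with rational endpoints at most
   [a], written as a union over codes. *)
rewrite (_ : _ @^-1` _ = \bigcup_k (if unpickle k is Some q then
    if ratr q <= a then half_space (pickle (i, q)) else set0 else set0)).
  apply: sigma_algebra_bigcup => k; case: (unpickle k) => [q|]; last exact: sigma_algebra0.
  case: ifP => _; last exact: sigma_algebra0.
  by apply: sub_sigma_algebra; eexists.
apply/seteqP; split => x /=; rewrite in_itv /=.
  move=> /rat_in_itvoo[q]; rewrite in_itv /= => /andP[xq qa].
  exists (pickle q); first by [].
  by rewrite pickleK (ltW qa) half_spaceE; exact: xq.
move=> [k _]; case: (unpickle k) => // q; case: ifP => // qa.
by rewrite half_spaceE /= => /lt_le_trans; apply.
Qed.

(** The cube is half-open because the lower bound on a coordinate is the complement of a strict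
    half-space. It serves to keep approximating sets bounded. *)
Lemma bset_box (k : nat) : exists b, bset half_space b =
  [set x | forall i, - k%:R <= x ord0 i < k%:R].
Proof.
suff [b hb] : exists b, bset half_space b =
    [set x | forall i, i \in enum 'I_n -> - k%:R <= x ord0 i < k%:R].
  exists b; rewrite hb; apply/seteqP; split => x /= h i; last by move=> _; exact: h.
  by apply: h; rewrite mem_enum.
elim: (enum _) => [|i s [b hb]].
  exists (BOr (BLeaf 0) (BNot (BLeaf 0))); rewrite /= setUv.
  by apply/seteqP; split.
have [q E] : exists q : rat, ratr q = k%:R :> R by exists k%:R; exact: ratr_nat.
have [q' EN] : exists q : rat, ratr q = - k%:R :> R.
  by exists (- q); rewrite -E; exact: (rmorphN (@ratr R)).
pose lf (q : rat) := BLeaf (pickle (i, q)).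
exists (BNot (BOr (BOr (lf q') (BNot (lf q))) (BNot b))).
have hs r : bset half_space (lf r) = [set x | x ord0 i < ratr r] := half_spaceE i r.
rewrite -[LHS]/(~` ((bset half_space (lf q') `|` ~` bset half_space (lf q))
   `|` ~` bset half_space b)).
rewrite hb !hs E EN !setCU !setCK; apply/seteqP; split => x /=.
  move=> [[/negP h1 h2] h3] j; rewrite inE => /orP[/eqP ->|]; last exact: h3.
  by rewrite leNgt h1.
move=> h; have := h i; rewrite mem_head => /(_ isT)/andP[h1 h2]; split.
  by split; first by apply/negP; rewrite -leNgt.
by move=> j js; apply: h; rewrite inE js orbT.
Qed.

Definition half_space_face (k : nat) : set rV :=
  if unpickle k is Some (i, q) then [set x | x ord0 i = ratr (q : rat)]
  else set0.

Definition half_space_boundary : set rV := \bigcup_k half_space_face k.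

Lemma half_space_boundary_null :
  measurable half_space_boundary /\ lebesgue_rV n half_space_boundary = 0%E.
Proof.
have H k : measurable (half_space_face k) /\ lebesgue_rV n (half_space_face k) = 0%E.
  rewrite /half_space_face; case: (unpickle k) => [[i q]|]; last by rewrite measure0.
  pose A := [set x : rV | x ord0 i = ratr q].
  rewrite -[X in measurable X]/A -[X in lebesgue_rV n X]/A.
  have -> : A = coord_box (fun j => if j == i then [set ratr q : R] else setT).
    rewrite /A; apply/seteqP; split => x /= h; last by have := h i; rewrite eqxx.
    by move=> j; case: eqP => // ->.
  have mA j : @measurable _ (measurableTypeR R) (if j == i then [set ratr q] else setT).
    by case: ifP => // _; exact: measurable_set1.
  split; first exact: measurable_coord_box.
  rewrite lebesgue_rV_box// (bigD1 i)//= eqxx lebesgue_measure_set1 mul0e//.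
have mB : measurable half_space_boundary.
  by apply: bigcup_measurable => k _; exact: (H k).1.
split => //; apply/eqP; rewrite eq_le measure_ge0 andbT.
have h : half_space_boundary `<=` half_space_boundary by [].
apply: (le_trans (measure_sigma_subadditive (lebesgue_rV n) (fun k => (H k).1) mB h)).
by rewrite eseries0// => k _ _; have [] := H k.
Qed.

(** Off the rational hyperplanes [x ord0 i] differs from [ratr q], so a small shift does not cross
    the boundary; the Boolean operations preserve eventual constancy. *)
Lemma bset_near_const b (y : nat -> rV) (x : rV) :
  (forall i, y k ord0 i @[k --> \oo] --> 0) -> ~ half_space_boundary x ->
  \forall k \near \oo, (bset half_space b (x - y k) <-> bset half_space b x).
Proof.
move=> y0 nx; elim: b => [m|b ih|b ihb c ihc] /=.
- rewrite /half_space; case um: (unpickle m) => [[i q]|]; last exact: nearW.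
  have xq : x ord0 i != ratr q.
    by apply/eqP => xq; apply: nx; exists m => //; rewrite /half_space_face um.
  have h0 : 0 < `|x ord0 i - ratr q| by rewrite normr_gt0 subr_eq0.
  have /cvgrPdist_lt/(_ _ h0) := y0 i.
  apply: filterS => k /=; rewrite sub0r normrN !mxE => hk {um}.
  have [xl|xr] := ltP (x ord0 i) (ratr q).
    rewrite [X in _ < X]ltr0_norm ?subr_lt0// in hk.
    by move: hk; rewrite ltr_norml => /andP[? ?]; split => h /=; lra.
  rewrite [X in _ < X]ger0_norm ?subr_ge0// in hk.
  by move: hk; rewrite ltr_norml => /andP[? ?]; split => h /=; lra.
- by apply: filterS ih => k h; split; apply: contra_not => /h.
- by apply: filterS2 ihb ihc => k h1 h2; split => -[/h1|/h2]; [left|right|left|right].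
Qed.

End half_spaces.

(** * Continuity of translations in L^1 *)

Section translation_continuity.
Context {R : realType} {n : nat}.
Local Notation rV := 'rV[R]_n.
Local Notation la := (@lebesgue_rV R n).
Implicit Types (u v : rV -> R).
Local Open Scope ereal_scope.

Definition L1dist u v : \bar R := \int[la]_x (`|u x - v x|%R)%:E.

Definition translation_cont u :=
  forall e : R, (0 < e)%R -> exists2 delta : R, (0 < delta)%R &
    forall y, (enorm y < delta)%R -> L1dist (fun x : rV => u (x - y)%R) u <= e%:E.

Lemma measurable_translate d (T : measurableType d) (u : rV -> T) (y : rV) :
  measurable_fun setT u -> measurable_fun setT (fun x : rV => u (x - y)%R).
Proof.
move=> mu; apply: measurableT_comp => //.
by have := measurable_fun_affine 1 (- y)%R; under eq_fun do rewrite scale1r.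
Qed.

Let mdist u v : measurable_fun setT u -> measurable_fun setT v ->
  measurable_fun setT (fun x => (`|u x - v x|%R)%:E).
Proof.
move=> mu mv; apply/measurable_EFinP; apply: measurableT_comp => //.
exact: measurable_funB.
Qed.

Lemma L1dist_triangle u v w : measurable_fun setT u -> measurable_fun setT v ->
  measurable_fun setT w -> L1dist u w <= L1dist u v + L1dist v w.
Proof.
move=> mu mv mw; rewrite /L1dist -ge0_integralD//; try exact: mdist;
  try by move=> x _; rewrite lee_fin.
apply: ge0_le_integral => //; try exact: mdist.
- by apply: emeasurable_funD; exact: mdist.
- by move=> x _; rewrite -EFinD lee_fin; exact: ler_distD.
Qed.

Lemma L1distC u v : L1dist u v = L1dist v u.
Proof. by apply: eq_integral => x _; rewrite distrC. Qed.

Lemma L1dist_translate u v y : measurable_fun setT u -> measurable_fun setT v ->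
  L1dist (fun x : rV => u (x - y)%R) (fun x : rV => v (x - y)%R) = L1dist u v.
Proof.
move=> mu mv.
exact: (@ge0_integral_translate R n (- y)%R (fun x => (`|u x - v x|%R)%:E) (mdist mu mv)).
Qed.

(** Three-epsilon argument: the shifted copies of [u] and [v] are as close as [u] and [v] by
    invariance of Lebesgue measure. *)
Lemma translation_cont_lim u : measurable_fun setT u ->
  (forall e : R, (0 < e)%R -> exists v, [/\ measurable_fun setT v,
     translation_cont v & L1dist u v <= e%:E]) -> translation_cont u.
Proof.
move=> mu h e e0; have e3 : (0 < e / 3)%R by rewrite divr_gt0.
have [v [mv vc uv]] := h _ e3; have [delta d0 hd] := vc _ e3.
exists delta => // y /hd hy.
have m1 := measurable_translate y mu; have m2 := measurable_translate y mv.
apply: (le_trans (L1dist_triangle m1 m2 mu)).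
rewrite L1dist_translate//.
apply: (@le_trans _ _ ((e / 3)%:E + ((e / 3)%:E + (e / 3)%:E))).
  apply: leeD => //; apply: (le_trans (L1dist_triangle m2 mv mu)).
  by apply: leeD => //; rewrite L1distC.
by rewrite -!EFinD lee_fin; lra.
Qed.

Lemma translation_contD u v : measurable_fun setT u -> measurable_fun setT v ->
  translation_cont u -> translation_cont v ->
  translation_cont (fun x => u x + v x)%R.
Proof.
move=> mu mv hu hv e e0; have e2 : (0 < e / 2)%R by rewrite divr_gt0.
have [d1 d10 h1] := hu _ e2; have [d2 d20 h2] := hv _ e2.
exists (Num.min d1 d2); first by rewrite lt_min d10.
move=> y; rewrite lt_min => /andP[/h1 yu /h2 yv].
have m1 := measurable_translate y mu; have m2 := measurable_translate y mv.
rewrite [in leRHS](splitr e) EFinD.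
apply: le_trans (leeD yu yv).
rewrite /L1dist -ge0_integralD//; try exact: mdist;
  try by move=> x _; rewrite lee_fin.
apply: ge0_le_integral => //.
- by apply: mdist; exact: measurable_funD.
- by apply: emeasurable_funD; exact: mdist.
- move=> x _; rewrite -EFinD lee_fin.
  have -> : (u (x - y) + v (x - y) - (u x + v x) =
            (u (x - y) - u x) + (v (x - y) - v x))%R by ring.
  exact: ler_normD.
Qed.

Lemma translation_contZ u (a : R) : measurable_fun setT u ->
  translation_cont u -> translation_cont (fun x => a * u x)%R.
Proof.
move=> mu hu e e0.
have a1 : (0 < `|a| + 1)%R by rewrite ltr_wpDl.
have [delta d0 h] := hu (e / (`|a| + 1))%R (divr_gt0 e0 a1).
exists delta => // y /h {}h.
have m1 := measurable_translate y mu.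
have -> : L1dist (fun x => a * u (x - y))%R (fun x => a * u x)%R =
    `|a|%:E * L1dist (fun x : rV => u (x - y)%R) u.
  rewrite /L1dist -ge0_integralZl//; last exact: mdist.
  by apply: eq_integral => x _; rewrite -EFinM -normrM mulrBr.
apply: (@le_trans _ _ ((`|a|)%:E * (e / (`|a| + 1))%:E)).
  by apply: lee_pmul => //; exact: integral_ge0.
by rewrite -EFinM lee_fin mulrA ler_pdivrMr// mulrC ler_wpM2l ?(ltW e0)// lerDl.
Qed.

(** Otherwise shifts [y k] tending to 0 keep the distance above [e]. Yet the differences of the
    indicators tend to 0 off a null set and are dominated by the indicator of the ball of radius
    [r + 1], since every [y k] has norm less than 1. *)
Lemma translation_cont_bset b (r : R) : bset (@half_space R n) b `<=` eball r ->
  translation_cont (\1_(bset (@half_space R n) b)).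
Proof.
move=> br e e0; set B := bset half_space b.
have mB : measurable B by exact: measurable_bset measurable_half_space _.
apply: contrapT => nh.
have /choice[y yP] : forall k : nat, exists y : rV, (enorm y < k.+1%:R^-1)%R /\
    e%:E < L1dist (fun x : rV => \1_B (x - y)%R) (\1_B).
  move=> k; apply: contrapT => nk; apply: nh.
  exists k.+1%:R^-1%R; first by rewrite invr_gt0.
  by move=> y yk; rewrite leNgt; apply/negP => ey; apply: nk; exists y.
have m1 : measurable_fun setT (\1_B : rV -> R) by exact: measurable_indic.
pose f k x := (`|\1_B (x - y k)%R - \1_B x|%R)%:E : \bar R.
have mf k : measurable_fun setT (f k).
  by apply: mdist => //; exact: (measurable_translate (y k) m1).
pose g x := ((\1_(eball (r + 1) : set rV) x)%:E : \bar R).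
have ynorm k : (enorm (y k) < 1)%R.
  by apply: (lt_le_trans (yP k).1); rewrite invf_le1 ?ler1n ?ltr0n.
have ylim i : (y k ord0 i)%R @[k --> \oo] --> (0:R)%R.
  apply/cvgrPdist_lt => eps eps0.
  have := near_infty_natSinv_lt (PosNum eps0).
  apply: filterS => k /= hk; rewrite sub0r normrN.
  exact: (le_lt_trans (coord_le_enorm _ _) (lt_trans (yP k).1 hk)).
have gi : la.-integrable setT g.
  apply/integrableP; split.
    by apply/measurable_EFinP; apply: measurable_indic; exact: measurable_enorm_lt.
  under eq_integral do rewrite /g gee0_abs ?lee_fin//.
  rewrite integral_indic ?setIT//; last exact: measurable_enorm_lt.
  exact: lebesgue_locally_finite (measurable_enorm_lt _) (bounded_eball _).
have [] := @dominated_convergence _ _ _ la setT measurableT f (cst 0) g mf.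
- exact: measurable_cst.
- have [mN N0] := @half_space_boundary_null R n.
  exists half_space_boundary; split => // x /= h.
  apply: contrapT => /(bset_near_const b ylim) nx; apply: h => _.
  apply: cvg_near_cst; apply: filterS nx => k hk.
  rewrite /f !indicE (_ : (_ \in B) = (x \in B)) ?subrr ?normr0//.
  by apply/idP/idP; rewrite !inE => /hk.
- by [].
- apply: nearW => x k _; rewrite /f gee0_abs ?lee_fin// /g !indicE.
  case: (boolP (x \in eball (r + 1))) => [_|xr].
    case: (_ \in B); case: (_ \in B); rewrite ?subrr ?subr0 ?sub0r ?normrN ?normr1 ?normr0//.
  have -> : (x \in B) = false.
    apply/negbTE; apply: contra xr; rewrite !inE => /br.
    by rewrite /eball /=; lra.
  have -> : (x - y k \in B)%R = false.
    apply/negbTE; apply: contra xr; rewrite !inE => /br.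
    rewrite /eball /= => h; rewrite -[x](subrK (y k)).
    by apply: (le_lt_trans (enormD _ _)); have := ynorm k; lra.
  by rewrite subrr normr0.
move=> _ _; rewrite [X in _ --> X]integral0_eq//.
move=> /fine_cvgP[fin /cvgrPdist_lt /(_ _ e0) lim0].
have [k [/= h1 h2]] := @filter_ex _ _ _ _ (filterI fin lim0).
have [_] := yP k; rewrite -[X in _ < X]/(\int[la]_x f k x) -(fineK h1) lte_fin.
rewrite ltNge => /negP; apply; apply: (le_trans (ler_norm _)).
by move: h2; rewrite sub0r normrN => /ltW.
Qed.

Lemma translation_cont_indic (A : set rV) (r : R) : measurable A -> A `<=` eball r ->
  translation_cont (\1_A).
Proof.
move=> mA Ar; apply: translation_cont_lim; first exact: measurable_indic.
move=> e e0; pose m := (Num.truncn r).+1.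
have [c cE] := @bset_box R n m.
set D := bset half_space c in cE.
have mD : measurable D by exact: measurable_bset measurable_half_space _.
have AD : A `<=` D.
  move=> x /Ar; rewrite /eball /= => xr; rewrite cE => i /=.
  have : (`|x ord0 i| < m%:R)%R.
    by apply: (le_lt_trans (coord_le_enorm x i)); rewrite (lt_trans xr)// truncnS_gt.
  by rewrite ltr_norml => /andP[/ltW -> ->].
have Db : bounded_rV D.
  exists (n%:R * (m.+1)%:R + 1)%R; apply: subset_trans (@eball_cube R n _) => x.
  rewrite cE => h i /=; have /andP[h1 h2] := h i; rewrite in_itv /=.
  rewrite (lt_trans h2) ?ltr_nat// andbT (lt_le_trans _ h1)//.
  by rewrite ltrN2 ltr_nat.
(* [bset_approx] needs a finite measure, so Lebesgue measure is restricted to the cube [D]; the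
   approximating set is cut with [D] as well, to be bounded. *)
pose mu := mrestr la mD.
have mufin : (mu setT < +oo)%E.
  by rewrite /mu /mrestr setTI; exact: lebesgue_locally_finite.
have [b hb] := bset_approx measurable_half_space mufin mA e0.
pose b' := BNot (BOr (BNot b) (BNot c)).
have b'E : bset half_space b' = bset (@half_space R n) b `&` D.
  by rewrite /b' /= setCU !setCK.
have mb : measurable (bset (@half_space R n) b).
  exact: measurable_bset measurable_half_space _.
have mb' : measurable (bset (@half_space R n) b').
  exact: measurable_bset measurable_half_space _.
exists (\1_(bset half_space b')); split.
- exact: measurable_indic.
- have [r' Dr'] := Db; apply: (@translation_cont_bset _ r').
  by rewrite b'E; apply: subset_trans Dr'; exact: subIsetr.
- apply: le_trans (ltW hb); rewrite /mu /mrestr /L1dist.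
  rewrite [leLHS](_ : _ = \int[la]_x (\1_(symdiff A (bset half_space b) `&` D) x)%:E).
    by rewrite integral_indic ?setIT//; apply: measurableI => //; exact: measurable_symdiff.
  apply: eq_integral => x _; rewrite b'E !indicE /symdiff; congr EFin.
  have [xA|xA] := boolP (x \in A); have [xb|xb] := boolP (x \in bset half_space b);
    have [xD|xD] := boolP (x \in D); rewrite !(in_setI, in_setU, in_setD) ?xA ?xb ?xD ?(negbTE xA) ?(negbTE xb) ?(negbTE xD) /=;
    rewrite ?subrr ?subr0 ?sub0r ?normrN ?normr1 ?normr0//.
  all: by case/negP: xD; apply/mem_set/AD/set_mem.
Qed.

Import HBSimple.

Lemma translation_cont_integrable u : la.-integrable setT (EFin \o u) ->
  translation_cont u.
Proof.
move=> ui; have mu : measurable_fun setT u.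
  by apply/measurable_EFinP; exact: measurable_int ui.
apply: translation_cont_lim => // e e0.
have [g [gi _ gu]] := approximation_sfun_integrable measurableT ui.
have e2 : (0 < e / 2)%R by rewrite divr_gt0.
have small (a_ : nat -> \bar R) : a_ k @[k --> \oo] --> 0 ->
    (forall k, 0 <= a_ k) -> exists k, a_ k <= (e / 2)%:E.
  move=> /fine_cvgP[fin /cvgrPdist_lt /(_ _ e2) lim0] a0.
  have [k [/= h1 h2]] := @filter_ex _ _ _ _ (filterI fin lim0).
  exists k; rewrite -(fineK h1) lee_fin (le_trans (ler_norm _))//.
  by move: h2; rewrite sub0r normrN => /ltW.
have [k hk] : exists k, \int[la]_x `|(u x)%:E - (g k x)%:E| <= (e / 2)%:E.
  by apply: small => // k; exact: integral_ge0.
pose E_ (m : nat) : set rV := eball m%:R.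
(* Level sets of the simple function, in particular that of the value 0, may be unbounded, hence the
   cut with a ball. *)
pose v m x := (g k x * \1_(E_ m) x)%R.
have mg : measurable_fun setT (g k : rV -> R) by exact: measurable_funPT.
have mv m : measurable_fun setT (v m).
  by apply: measurable_funM => //; apply: measurable_indic; exact: measurable_enorm_lt.
have [m hm] : exists m, L1dist (g k) (v m) <= (e / 2)%:E.
  apply: small; last by move=> m; exact: integral_ge0.
  have [] := @dominated_convergence _ _ _ la setT measurableT
     (fun m x => (`|g k x - v m x|%R)%:E) (cst 0) (fun x => (`|g k x|%R)%:E) _ _ _ (integrable_norm (gi k)).
  - by move=> m; exact: mdist.
  - exact: measurable_cst.
  - apply: nearW => x _; apply: cvg_near_cst.
    have [m0 _ hm0] : (\bigcup_k eball k%:R : set rV) x by rewrite eball_bigcup.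
    exists m0 => // m /= m0m.
    have xm : (E_ m) x by apply: (eball_sub _ hm0); rewrite ler_nat.
    by rewrite /v indicE mem_set// mulr1 subrr normr0.
  - apply: nearW => x m _; rewrite gee0_abs ?lee_fin// /v indicE.
    by case: (x \in _); rewrite ?mulr1 ?mulr0 ?subrr ?normr0 ?subr0.
  by move=> _ _; rewrite [X in _ --> X]integral0_eq.
exists (v m); split => //; last first.
  apply: (le_trans (L1dist_triangle mu mg (mv m))).
  by rewrite [in leRHS](splitr e) EFinD leeD.
have -> : v m = (fun x => \sum_(y <- finmap.enum_fset (fset_set (range (g k))))
    (y * \1_(g k @^-1` [set y] `&` E_ m) x))%R.
  apply/funext => x; rewrite /v fimfunE fsbig_finite//= mulr_suml.
  by apply: eq_bigr => y _; rewrite indicI /= mulrA.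
have mA y : measurable (g k @^-1` [set y] `&` E_ m).
  apply: measurableI; last exact: measurable_enorm_lt.
  by rewrite -[X in measurable X]setTI; exact: mg.
elim: (finmap.enum_fset _) => [|y s ih].
  under eq_fun do rewrite big_nil.
  move=> e' e'0; exists 1%R => // y _; rewrite /L1dist.
  by under eq_integral do rewrite subrr normr0; rewrite integral0 lee_fin ltW.
under eq_fun do rewrite big_cons.
have m1 : measurable_fun setT (\1_(g k @^-1` [set y] `&` E_ m) : rV -> R).
  exact: measurable_indic.
apply: (@translation_contD (fun x => y * \1_(g k @^-1` [set y] `&` E_ m) x)%R
  (fun x => \sum_(y <- s) (y * \1_(g k @^-1` [set y] `&` E_ m) x))%R) => //.
- exact: measurable_funM.
- by apply: measurable_sum => z; apply: measurable_funM => //; exact: measurable_indic.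
- apply: translation_contZ => //; apply: (@translation_cont_indic _ m%:R) => //.
Qed.

Lemma ctranslation_cont (f : rV -> R[i]) : cintegrable la f ->
  forall e : R, (0 < e)%R -> exists2 delta : R, (0 < delta)%R &
    forall y : rV, (enorm y < delta)%R ->
      \int[la]_x (cmod (f (x - y)%R - f x))%:E <= e%:E.
Proof.
move=> fi e e0; have [fr fI] := fi; have [m1 m2] := cintegrable_cmeasurable fi.
have e2 : (0 < e / 2)%R by rewrite divr_gt0.
have [d1 d10 h1] := translation_cont_integrable fr e2.
have [d2 d20 h2] := translation_cont_integrable fI e2.
exists (Num.min d1 d2); first by rewrite lt_min d10.
move=> y; rewrite lt_min => /andP[/h1 yu /h2 yv].
rewrite [in leRHS](splitr e) EFinD.
apply: le_trans (leeD yu yv).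
have k1 := measurable_translate y m1; have k2 := measurable_translate y m2.
rewrite /L1dist -ge0_integralD//; try exact: mdist;
  try by move=> x _; rewrite lee_fin.
apply: ge0_le_integral => //.
- by move=> x _; rewrite lee_fin cmod_ge0.
- apply/measurable_EFinP; apply: cmeasurable_cmod; apply: cmeasurableB; by split.
- by apply: emeasurable_funD; exact: mdist.
- by move=> x _; rewrite -EFinD lee_fin -ReB -ImB cmod_le_ReIm.
Qed.

End translation_continuity.

(** * Jordan decomposition of local complex measures *)

Section finite_jordan.
Context d (T : measurableType d) (R : realType).

(** [H] is the positive set of a Hahn decomposition of the charge [m1 - m2], and [k] is the positive
    part of that charge. *)
Lemma finite_jordan (m1 m2 : {finite_measure set T -> \bar R}) :
  exists (k : {measure set T -> \bar R}) (H : set T), [/\ measurable H,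
    (forall A, measurable A -> (k A = m1 (A `&` H) - m2 (A `&` H))%E) &
    (forall A, measurable A -> (m1 (A `\` H) <= m2 (A `\` H))%E)].
Proof.
pose nu : {charge set T -> \bar R} :=
  cadd (charge_of_finite_measure m1) (copp (charge_of_finite_measure m2)).
have nuE A : nu A = (m1 A - m2 A)%E by [].
have [P [N PN]] := Hahn_decomposition nu.
have [[mP posP] [mN negN] PNT PN0] := PN.
exists (jordan_pos PN), P; split => // A mA.
  by transitivity (crestr0 nu mP A) => //; rewrite /crestr0 mem_set.
have mAP : measurable (A `\` P) by exact: measurableD.
have AN : A `\` P `<=` N.
  by move=> x [_ nP]; have : [set: T] x by []; rewrite -PNT => -[].
have := negN _ mAP AN; rewrite nuE.
by rewrite sube_le0.
Qed.

End finite_jordan.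

Section local_signed.
Context {R : realType} {n : nat}.
Local Notation rV := 'rV[R]_n.
Implicit Types (A B : set rV) (nu : set rV -> R) (mu k : {measure set rV -> \bar R}).

Definition local_decomposition nu mu1 mu2 :=
  [/\ locally_finite mu1, locally_finite mu2 & forall A, measurable A ->
    bounded_rV A -> nu A = fine (mu1 A) - fine (mu2 A)].

(** A difference of locally finite measures makes sense on bounded sets, where no difference of
    infinities occurs; the Hahn decomposition is therefore carried out on each shell separately. *)
Definition annulus (j : nat) : set rV := eball j.+1%:R `\` eball j%:R.

Lemma measurable_annulus j : measurable (annulus j).
Proof. by apply: measurableD; exact: measurable_enorm_lt. Qed.

Lemma bounded_fin_num mu A : locally_finite mu -> measurable A -> bounded_rV A ->
  mu A \is a fin_num.
Proof. by move=> lf mA bA; rewrite ge0_fin_numE// lf. Qed.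

Lemma fine_measureU mu A B : locally_finite mu -> measurable A -> measurable B ->
  bounded_rV A -> bounded_rV B -> A `&` B = set0 ->
  fine (mu (A `|` B)) = fine (mu A) + fine (mu B).
Proof.
move=> lf mA mB bA bB AB; rewrite measureU// fineD//; exact: bounded_fin_num.
Qed.

Lemma local_signedU nu mu1 mu2 A B : local_decomposition nu mu1 mu2 ->
  measurable A -> measurable B -> bounded_rV A -> bounded_rV B -> A `&` B = set0 ->
  nu (A `|` B) = nu A + nu B.
Proof.
move=> [l1 l2 nuE] mA mB bA bB AB.
have bAB : bounded_rV (A `|` B).
  have [[r Ar] [r' Br]] := (bA, bB); exists (Num.max r r').
  by move=> x [/Ar|/Br]; apply: eball_sub; rewrite le_max lexx ?orbT.
by rewrite !nuE ?fine_measureU//; [ring|exact: measurableU].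
Qed.

Lemma local_signedD nu mu1 mu2 A B : local_decomposition nu mu1 mu2 ->
  measurable A -> measurable B -> bounded_rV A ->
  nu A = nu (A `&` B) + nu (A `\` B).
Proof.
move=> h mA mB bA.
rewrite -(local_signedU h).
- by rewrite setUIDK.
- exact: measurableI.
- exact: measurableD.
- exact: bounded_setIl.
- by apply: bounded_sub bA; exact: subDsetl.
- by rewrite -subset0 => x [[_ Bx] [_]]; apply.
Qed.

Lemma local_signed0 nu mu1 mu2 : local_decomposition nu mu1 mu2 -> nu set0 = 0.
Proof.
move=> [_ _ nuE]; rewrite nuE ?measure0 ?subrr//.
by exists 0.
Qed.

Lemma local_signed_annuli nu mu1 mu2 A J : local_decomposition nu mu1 mu2 ->
  measurable A -> A `<=` eball J%:R ->
  nu A = \sum_(0 <= j < J) nu (A `&` annulus j).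
Proof.
move=> h mA AJ.
suff : forall j, nu (A `&` eball j%:R) = \sum_(0 <= i < j) nu (A `&` annulus i).
  by move=> <-; rewrite setIidl.
have bA : bounded_rV A by exists J%:R.
elim=> [|j ih].
  (* The ball of radius 0 is empty, its inequality being strict, so shell 0 is the whole open unit
     ball. *)
  rewrite big_geq// (_ : _ `&` _ = set0) ?(local_signed0 h)//.
  by rewrite -subset0 => x [_]; rewrite /eball /= ltNge enorm_ge0.
rewrite big_nat_recr//= -ih.
rewrite (@local_signedD _ _ _ (A `&` eball j.+1%:R) (eball j%:R) h)//.
- rewrite -!setIA (_ : eball j.+1%:R `&` eball j%:R = eball j%:R) -?setIDA//.
  by rewrite setIidr//; apply: eball_sub; rewrite ler_nat.
- by apply: measurableI => //; exact: measurable_enorm_lt.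
- exact: measurable_enorm_lt.
- exact: bounded_setIl.
Qed.

(* The first conjunct says that the supremum in the second one is attained, at a
   Hahn set. *)
Definition is_posvar nu k := forall A, measurable A -> bounded_rV A ->
  (exists H, [/\ measurable H, H `<=` A & k A = (nu H)%:E]) /\
  (forall B, measurable B -> B `<=` A -> ((nu B)%:E <= k A)%E).

(** The Hahn sets of the shells are glued to one set [H], and the positive parts are summed. For
    bounded [A], [k A] is then the value of [nu] on the part of [A] inside [H]; it is maximal
    because [nu] is nonpositive on bounded sets outside [H]. *)
Lemma posvar_exists nu mu1 mu2 : local_decomposition nu mu1 mu2 ->
  exists k, is_posvar nu k.
Proof.
move=> h; have [l1 l2 nuE] := h.
have mQ := measurable_annulus.
have bQ j : bounded_rV (annulus j) by exists j.+1%:R; exact: subDsetl.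
have f1 j : (mu1 (annulus j) < +oo)%E by exact: l1.
have f2 j : (mu2 (annulus j) < +oo)%E by exact: l2.
have /choice[k_ /choice[H_ kH]] j := finite_jordan (mfrestr (mQ j) (f1 j)) (mfrestr (mQ j) (f2 j)).
have kE j A : measurable A -> k_ j A = (nu (A `&` H_ j `&` annulus j))%:E.
  move=> mA; have [mH -> // _] := kH j.
  have mI : measurable (A `&` H_ j `&` annulus j).
    by apply: measurableI => //; exact: measurableI.
  have bI : bounded_rV (A `&` H_ j `&` annulus j).
    by apply: bounded_sub (bQ j); exact: subIsetr.
  rewrite /mfrestr /mrestr nuE// EFinB !fineK//; exact: bounded_fin_num.
have kN j A : measurable A -> nu ((A `\` H_ j) `&` annulus j) <= 0.
  move=> mA; have [mH _ /(_ _ mA)] := kH j.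
  have mI : measurable ((A `\` H_ j) `&` annulus j).
    by apply: measurableI => //; exact: measurableD.
  have bI : bounded_rV ((A `\` H_ j) `&` annulus j).
    by apply: bounded_sub (bQ j); exact: subIsetr.
  rewrite /mfrestr /mrestr nuE// subr_le0 => hle.
  by rewrite fine_le// bounded_fin_num.
pose H := \bigcup_j (H_ j `&` annulus j).
have mH : measurable H.
  by apply: bigcup_measurable => j _; apply: measurableI => //; have [] := kH j.
have tQ i j x : annulus i x -> annulus j x -> i = j.
  move=> [i1 i2] [j1 j2]; apply/eqP; rewrite eqn_leq; apply/andP; split;
    rewrite leqNgt; apply/negP => ij.
    by apply: i2; apply: eball_sub j1; rewrite ler_nat.
  by apply: j2; apply: eball_sub i1; rewrite ler_nat.
have HQ j : H `&` annulus j = H_ j `&` annulus j.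
  apply/seteqP; split => [x [[i _ [Hi Qi]] Qj]|x [Hj Qj]].
    by rewrite (tQ _ _ _ Qj Qi); split => //; rewrite -(tQ _ _ _ Qi Qj).
  by split => //; exists j.
pose k : {measure set rV -> \bar R} := mseries k_ 0.
have key A : measurable A -> bounded_rV A -> k A = (nu (A `&` H))%:E.
  move=> mA [r Ar]; pose J := (Num.truncn r).+1.
  have AJ : A `<=` eball J%:R.
    by apply: (subset_trans Ar); apply: eball_sub; rewrite ltW// truncnS_gt.
  have mAH : measurable (A `&` H) by exact: measurableI.
  rewrite (@local_signed_annuli _ _ _ _ J h mAH); last first.
    by apply: subset_trans AJ; exact: subIsetl.
  (* [A] lies in the ball of radius [J], so the shells from [J] on miss it and the series is a
     finite sum. *)
  rewrite /k /= /mseries (@nneseries_split _ _ 0 J)// add0n.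
  rewrite [X in (_ + X)%E]eseries0 ?adde0.
    rewrite -sumEFin; apply: eq_bigr => j _; rewrite kE//.
    by rewrite -!setIA HQ.
  move=> j Jj _; rewrite kE// (_ : _ `&` _ = set0) ?(local_signed0 h)//.
  rewrite -subset0 => x [[/AJ xA _] [_]]; apply.
  by apply: eball_sub xA; rewrite ler_nat.
have kneg A : measurable A -> bounded_rV A -> nu (A `\` H) <= 0.
  move=> mA [r Ar]; pose J := (Num.truncn r).+1.
  have AJ : A `<=` eball J%:R.
    by apply: (subset_trans Ar); apply: eball_sub; rewrite ltW// truncnS_gt.
  have mAH : measurable (A `\` H) by exact: measurableD.
  rewrite (@local_signed_annuli _ _ _ _ J h mAH); last first.
    by apply: subset_trans AJ; exact: subDsetl.
  apply: sumr_le0 => j _; rewrite (_ : _ `&` _ = (A `\` H_ j) `&` annulus j) ?kN//.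
  apply/seteqP; split=> x [[Ax nH] Qx]; split => //; split => // Hx; apply: nH.
    by exists j.
  by have : (H `&` annulus j) x by []; rewrite HQ => -[].
exists k => A mA bA; split.
  by exists (A `&` H); split; [exact: measurableI|exact: subIsetl|exact: key].
move=> B mB BA; have bB : bounded_rV B by exact: bounded_sub bA.
apply: (@le_trans _ _ (k B)); last by apply: le_measure; rewrite ?inE.
rewrite key// lee_fin (local_signedD h mB mH bB) -lerBrDl subrr.
exact: kneg.
Qed.

Lemma posvar_locally_finite nu k : is_posvar nu k -> locally_finite k.
Proof. by move=> h A mA bA; have [[H [_ _ ->]] _] := h _ mA bA; rewrite ltry. Qed.

(** Both measures are continuous from below along the balls, so the inequality extends from bounded
    sets to all measurable ones. *)
Lemma le_bounded_measure mu k : (forall A, measurable A -> bounded_rV A ->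
    (k A <= mu A)%E) -> forall A, measurable A -> (k A <= mu A)%E.
Proof.
move=> h A mA.
pose B j := A `&` eball j%:R.
have mB j : measurable (B j) by apply: measurableI => //; exact: measurable_enorm_lt.
have BA : \bigcup_j B j = A by rewrite /B -setI_bigcupr eball_bigcup setIT.
have ndB : nondecreasing_seq B.
  move=> i j ij; apply/subsetPset; apply: setIS; apply: eball_sub.
  by rewrite ler_nat.
have : mu (B j) @[j --> \oo] --> mu A.
  by rewrite -BA; apply: nondecreasing_cvg_mu => //; rewrite BA.
have : k (B j) @[j --> \oo] --> k A.
  by rewrite -BA; apply: nondecreasing_cvg_mu => //; rewrite BA.
move=> ck cmu; rewrite -(cvg_lim _ ck)// -(cvg_lim _ cmu)//.
apply: lee_lim; [exact: cvgP ck|exact: cvgP cmu|].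
apply: nearW => j; apply: h => //; apply: bounded_sub (bounded_eball j%:R).
exact: subIsetr.
Qed.

Lemma eq_bounded_measure mu k : (forall A, measurable A -> bounded_rV A ->
    k A = mu A) -> forall A, measurable A -> k A = mu A.
Proof.
move=> h A mA; apply/eqP; rewrite eq_le !le_bounded_measure// => B mB bB;
  by rewrite h.
Qed.

(** Minimality of the Jordan part: [k A] is attained as [nu H], which is at most [mu1 H].
    Consequently a function integrable for some decomposition is integrable for the Jordan parts. *)
Lemma posvar_le nu k mu1 mu2 : is_posvar nu k -> local_decomposition nu mu1 mu2 ->
  forall A, measurable A -> (k A <= mu1 A)%E.
Proof.
move=> kP [l1 l2 nuE]; apply: le_bounded_measure => A mA bA.
have [[H [mH HA ->]] _] := kP _ mA bA.
have bH : bounded_rV H by exact: bounded_sub bA.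
rewrite nuE// EFinB !fineK ?bounded_fin_num//.
apply: (@le_trans _ _ (mu1 H)); last by apply: le_measure; rewrite ?inE.
by rewrite leeBlDr ?bounded_fin_num// leeDl.
Qed.

Lemma local_decompositionN nu mu1 mu2 : local_decomposition nu mu1 mu2 ->
  local_decomposition (fun A => - nu A) mu2 mu1.
Proof.
by move=> [l1 l2 nuE]; split => // A mA bA; rewrite nuE// opprB.
Qed.

(** Split [A] at a maximizer [H] of [nu] and bound the remainder from below by [- k' A]; then split
    at a maximizer [H'] of [- nu] and bound the remainder from above by [k A]. *)
Lemma posvar_decomposition nu k k' mu1 mu2 : is_posvar nu k ->
  is_posvar (fun A => - nu A) k' -> local_decomposition nu mu1 mu2 ->
  local_decomposition nu k k'.
Proof.
move=> kP k'P h; have lk := posvar_locally_finite kP.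
have lk' := posvar_locally_finite k'P; split => // A mA bA.
have [[H [mH HA kH]] ksup] := kP _ mA bA.
have [[H' [mH' HA' kH']] ksup'] := k'P _ mA bA.
rewrite kH kH' /= opprK.
have e1 := local_signedD h mA mH bA; rewrite setIidr// in e1.
have e2 := local_signedD h mA mH' bA; rewrite setIidr// in e2.
have := ksup (A `\` H') (measurableD mA mH') (@subDsetl _ _ _).
have := ksup' (A `\` H) (measurableD mA mH) (@subDsetl _ _ _).
by rewrite kH kH' !lee_fin => h1 h2; apply/eqP; rewrite eq_le; apply/andP; lra.
Qed.

Lemma local_decomposition_integral nu mu1 mu2 k1 k2 (u : rV -> R) :
  local_decomposition nu mu1 mu2 -> local_decomposition nu k1 k2 ->
  mu1.-integrable setT (EFin \o u) -> mu2.-integrable setT (EFin \o u) ->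
  k1.-integrable setT (EFin \o u) -> k2.-integrable setT (EFin \o u) ->
  \int[mu1]_x u x - \int[mu2]_x u x = \int[k1]_x u x - \int[k2]_x u x.
Proof.
move=> [l1 l2 h] [l1' l2' h'] i1 i2 j1 j2.
(* Adding across the two decompositions gives an identity of measures that makes sense on sets of
   infinite measure too, where the differences do not. *)
have E A : measurable A -> measure_add mu1 k2 A = measure_add k1 mu2 A.
  apply: eq_bounded_measure => {}A mA bA.
  transitivity (mu1 A + k2 A)%E; first exact: measure_addE.
  transitivity (k1 A + mu2 A)%E; last exact/esym/measure_addE.
  have := h _ mA bA; rewrite h'// => e.
  rewrite -[mu1 A]fineK ?bounded_fin_num// -[mu2 A]fineK ?bounded_fin_num//.
  rewrite -[k1 A]fineK ?bounded_fin_num// -[k2 A]fineK ?bounded_fin_num//.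
  by rewrite -!EFinD; congr EFin; move: e => /eqP; rewrite subr_eq => /eqP ->; ring.
have : (\int[measure_add mu1 k2]_x (u x)%:E = \int[measure_add k1 mu2]_x (u x)%:E)%E.
  by apply: eq_measure_integral => A mA _; exact: E.
rewrite !integral_measure_add// => /(congr1 fine).
have fin (m : {measure set rV -> \bar R}) : m.-integrable setT (EFin \o u) ->
    (\int[m]_x (u x)%:E)%E \is a fin_num by exact: integrable_fin_num.
rewrite (fineD (fin _ i1) (fin _ j2)) (fineD (fin _ j1) (fin _ i2)) => e.
by rewrite /Rintegral; lra.
Qed.

(** The negative variation of a signed measure is the positive variation of its negative, so the
    four Jordan parts are the positive variations of the four [cpart j]. Indices above 3 repeat the
    last one. *)
Definition cpart (j : nat) (z : R[i]) : R :=
  match j with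
  | 0 => complex.Re z
  | 1 => - complex.Re z
  | 2 => complex.Im z
  | _ => - complex.Im z
  end.

Variables (Psi : set rV -> R[i]) (k : nat -> {measure set rV -> \bar R}).
Hypothesis cPsi : complex_measure Psi.
Hypothesis kP : forall j, is_posvar (fun A => cpart j (Psi A)) (k j).

Definition jordan_integral (f : rV -> R[i]) : R[i] :=
  cintegral (k 0) f - cintegral (k 1) f +
  'i%C * (cintegral (k 2) f - cintegral (k 3) f).

Let decRe mu1 mu2 mu3 mu4 : cm_decomposition Psi mu1 mu2 mu3 mu4 ->
  local_decomposition (fun A => complex.Re (Psi A)) mu1 mu2.
Proof. by move=> [? ? ? ? PsiE]; split => // A mA bA; rewrite PsiE. Qed.

Let decIm mu1 mu2 mu3 mu4 : cm_decomposition Psi mu1 mu2 mu3 mu4 ->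
  local_decomposition (fun A => complex.Im (Psi A)) mu3 mu4.
Proof. by move=> [? ? ? ? PsiE]; split => // A mA bA; rewrite PsiE. Qed.

Lemma jordan_decomposition : cm_decomposition Psi (k 0) (k 1) (k 2) (k 3).
Proof.
have [mu1 [mu2 [mu3 [mu4 dec]]]] := cPsi.
have [l0 l1 E1] := posvar_decomposition (kP 0) (kP 1) (decRe dec).
have [l2 l3 E2] := posvar_decomposition (kP 2) (kP 3) (decIm dec).
split => // A mA bA; apply: eqc; first exact: E1.
exact: E2.
Qed.

(** [xget] may return the value for any decomposition that makes [f] integrable; all of them agree
    by [local_decomposition_integral], applied to real and imaginary parts. *)
Lemma cm_integral_jordan f : (forall j, (j < 4)%N -> cintegrable (k j) f) ->
  cm_integral Psi f = jordan_integral f.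
Proof.
move=> fi; rewrite /cm_integral.
have ex : is_cm_integral Psi f (jordan_integral f).
  exists (k 0), (k 1), (k 2), (k 3); split => //; first exact: jordan_decomposition.
  - by split; exact: fi.
  - by split; exact: fi.
case: xgetP => [z _ [mu1 [mu2 [mu3 [mu4 [dec [[r1 i1] [r2 i2]] [[r3 i3] [r4 i4]] ->]]]]]|]; last first.
  by move=> /(_ _ ex).
have [kr0 ki0] := fi 0%N isT; have [kr1 ki1] := fi 1%N isT.
have [kr2 ki2] := fi 2%N isT; have [kr3 ki3] := fi 3%N isT.
have dj := jordan_decomposition.
have e1 := local_decomposition_integral (decRe dec) (decRe dj) r1 r2 kr0 kr1.
have e2 := local_decomposition_integral (decRe dec) (decRe dj) i1 i2 ki0 ki1.
have e3 := local_decomposition_integral (decIm dec) (decIm dj) r3 r4 kr2 kr3.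
have e4 := local_decomposition_integral (decIm dec) (decIm dj) i3 i4 ki2 ki3.
rewrite /jordan_integral; congr (_ + _).
  by apply: eqc; rewrite !(ReB, ImB).
by congr (_ * _); apply: eqc; rewrite !(ReB, ImB).
Qed.

(** If some decomposition made [f] integrable, minimality would make it integrable for the Jordan
    parts. So [xget] returns its default 0, and [cm_integral] has an explicit value in every
    case. *)
Lemma cm_integral_not_integrable f :
  ~ (forall j, (j < 4)%N -> cintegrable (k j) f) -> cm_integral Psi f = 0.
Proof.
move=> nfi; rewrite /cm_integral.
case: xgetP => [z _ [mu1 [mu2 [mu3 [mu4 [dec [i1 i2] [i3 i4] _]]]]]|//].
exfalso; apply: nfi => j j4.
have le_int (m m' : {measure set rV -> \bar R}) :
    (forall A, measurable A -> (m A <= m' A)%E) -> cintegrable m' f -> cintegrable m f.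
  move=> mm /cintegrableP[mf fi]; apply/cintegrableP; split => //.
  apply: le_lt_trans fi; apply: ge0_le_measure_integral => //.
  - by move=> x; rewrite lee_fin cmod_ge0.
  - by apply/measurable_EFinP; exact: cmeasurable_cmod.
case: j j4 => [|[|[|[|//]]]] _.
- exact: (le_int _ _ (posvar_le (kP 0) (decRe dec))).
- exact: (le_int _ _ (posvar_le (kP 1) (local_decompositionN (decRe dec)))).
- exact: (le_int _ _ (posvar_le (kP 2) (decIm dec))).
- exact: (le_int _ _ (posvar_le (kP 3) (local_decompositionN (decIm dec)))).
Qed.

End local_signed.

Lemma jordan_exists (R : realType) n (Psi : set 'rV[R]_n -> R[i]) : complex_measure Psi ->
  exists k : nat -> {measure set 'rV[R]_n -> \bar R},
    forall j, is_posvar (fun A => cpart j (Psi A)) (k j).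
Proof.
move=> [mu1 [mu2 [mu3 [mu4 [l1 l2 l3 l4 PsiE]]]]].
have d1 : local_decomposition (fun A => complex.Re (Psi A)) mu1 mu2.
  by split => // A mA bA; rewrite PsiE.
have d2 : local_decomposition (fun A => complex.Im (Psi A)) mu3 mu4.
  by split => // A mA bA; rewrite PsiE.
have [k0 P0] := posvar_exists d1.
have [k1 P1] := posvar_exists (local_decompositionN d1).
have [k2 P2] := posvar_exists d2.
have [k3 P3] := posvar_exists (local_decompositionN d2).
exists (fun j => match j with 0 => k0 | 1 => k1 | 2 => k2 | _ => k3 end).
by move=> [|[|[|j]]].
Qed.

(** * Stationary random measures *)

Section mixture.
Context d1 d2 (X : measurableType d1) (Y : measurableType d2) (R : realType).
Variables (mu : {measure set X -> \bar R}) (K : X -> {measure set Y -> \bar R}).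
Hypothesis mK : forall A, measurable A -> measurable_fun setT (K ^~ A).
Local Open Scope ereal_scope.

(* The measurability proof is a (phantom) argument so that the measure structure
   can be attached to [mixture mK]; nonmeasurable sets get the junk value 0. *)
Definition mixture (_ : forall A, measurable A -> measurable_fun setT (K ^~ A))
    (A : set Y) : \bar R :=
  if A \in measurable then \int[mu]_x K x A else 0.

Let mixture0 : mixture mK set0 = 0.
Proof.
rewrite /mixture mem_set//; apply: integral0_eq => x _; exact: measure0.
Qed.

Let mixture_ge0 A : 0 <= mixture mK A.
Proof. by rewrite /mixture; case: ifP => // _; exact: integral_ge0. Qed.

Let mixture_sigma_additive : semi_sigma_additive (mixture mK).
Proof.
move=> F mF tF mUF.
rewrite /mixture mem_set// [X in _ --> X](_ : _ =
    \int[mu]_x (\sum_(0 <= k <oo) K x (F k))); last first.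
  apply: eq_integral => x _.
  by apply/esym/cvg_lim => //; exact: measure_sigma_additive.
rewrite [X in X @ _](_ : _ =
    (fun n => \int[mu]_x (\sum_(0 <= i < n) K x (F i)))); last first.
  apply/funext => n; rewrite ge0_integral_sum//.
    by apply: eq_bigr => i _; rewrite mem_set.
  by move=> i; exact: mK.
apply: cvg_monotone_convergence => //.
- by move=> n; apply: emeasurable_sum => m; exact: mK.
- by move=> n x _; rewrite sume_ge0.
- by move=> x _ m n mn; exact: ereal_nondecreasing_series.
Qed.

HB.instance Definition _ := isMeasure.Build _ _ R (mixture mK)
  mixture0 mixture_ge0 mixture_sigma_additive.

Lemma mixtureE A : measurable A -> mixture mK A = \int[mu]_x K x A.
Proof. by move=> mA; rewrite /mixture mem_set. Qed.

Import HBNNSimple.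

Let sintegral_mixture (h : {nnsfun Y >-> R}) :
  sintegral (mixture mK) h = \int[mu]_x sintegral (K x) h.
Proof.
have mh r : measurable (h @^-1` [set r]) by [].
under eq_integral do rewrite sintegralE.
rewrite ge0_integral_fsum//; last 2 first.
  by move=> r; apply: measurable_funeM; exact: mK.
  by move=> n x _; exact: nnsfun_mulemu_ge0.
rewrite sintegralE /=; apply: eq_fsbigr => // r _; rewrite mixtureE//.
have [r0|r0] := leP 0%R r.
  by rewrite ge0_integralZl//; exact: mK.
rewrite preimage_nnfun0// !integral0_eq ?mule0// => x _; rewrite measure0 ?mule0//.
Qed.

Lemma ge0_integral_mixture (f : Y -> \bar R) : measurable_fun setT f ->
  (forall y, 0 <= f y) -> \int[mixture mK]_y f y = \int[mu]_x \int[K x]_y f y.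
Proof.
move=> mh h0.
pose g := nnsfun_approx measurableT mh.
pose gE := fun n => EFin \o g n.
have mgE n : measurable_fun [set: Y] (gE n) by exact/measurable_EFinP.
have gE_ge0 n x : 0 <= gE n x by rewrite lee_fin.
have nd_gE x : {homo gE ^~ x : n m / (n <= m)%O >-> n <= m}.
  by move=> *; exact/lefP/nd_nnsfun_approx.
transitivity (limn (fun n => \int[mixture mK]_x gE n x)).
  rewrite -monotone_convergence//; apply: eq_integral => t _.
  by apply/esym/cvg_lim => //; exact: cvg_nnsfun_approx.
transitivity (limn (fun n => \int[mu]_x \int[K x]_y gE n y)).
  apply: congr_lim; apply/funext => n.
  rewrite integralT_nnsfun sintegral_mixture; apply: eq_integral => x _.
  by rewrite integralT_nnsfun.
rewrite -[LHS]monotone_convergence//; last 3 first.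
  by move=> n; exact: measurable_fun_integral_kernel.
  by move=> n x _; exact: integral_ge0.
  by move=> x _ m n mn; apply: ge0_le_integral => // t _; exact: nd_gE.
apply: eq_integral => x _; rewrite -monotone_convergence//.
by apply: eq_integral => t _; apply/cvg_lim => //; exact: cvg_nnsfun_approx.
Qed.

End mixture.

Section locally_finite_sigma_finite.
Context (R : realType) (n : nat).
Variables (m : {measure set 'rV[R]_n -> \bar R}) (lf : locally_finite m).

(** A copy of [m] carrying the proof [lf], so that the sigma-finite structure required by Tonelli
    can be attached to it. *)
Definition sfmeasure (_ : locally_finite m) : set 'rV[R]_n -> \bar R := m.

HB.instance Definition _ := Measure.on (sfmeasure lf).

Let sfmeasure_sigma_finite : sigma_finite setT (sfmeasure lf).
Proof.
exists (fun k => eball k%:R); first by rewrite eball_bigcup.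
move=> k; split; first exact: measurable_enorm_lt.
by apply: lf; [exact: measurable_enorm_lt|exact: bounded_eball].
Qed.

HB.instance Definition _ := Measure_isSigmaFinite.Build _ _ _
  (sfmeasure lf) sfmeasure_sigma_finite.

Lemma locally_finite_sigma_finite :
  exists m' : {sigma_finite_measure set 'rV[R]_n -> \bar R}, forall A, m' A = m A.
Proof. by exists (sfmeasure lf). Qed.

End locally_finite_sigma_finite.

Section random_part.
Context {R : realType} {n : nat} {d : measure_display} {Omega : measurableType d}.
Local Notation rV := 'rV[R]_n.
Local Notation la := (@lebesgue_rV R n).
Variables (P : probability Omega R) (theta : rV -> Omega -> Omega).
Hypothesis flow : measure_preserving_flow P theta.
Variables (nu : Omega -> set rV -> R) (K : Omega -> {measure set rV -> \bar R}).
Hypothesis nu_dec : forall w, exists mu1 mu2, local_decomposition (nu w) mu1 mu2.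
Hypothesis KP : forall w, is_posvar (nu w) (K w).
Hypothesis mnu : forall A, measurable A -> bounded_rV A ->
  measurable_fun setT (fun w => nu w A).
Hypothesis nu_inv : forall x w A, measurable A -> bounded_rV A ->
  nu (theta x w) A = nu w (shift_set A x).

Lemma shift_setE (A : set rV) x : shift_set A x = (fun y : rV => y - x) @^-1` A.
Proof.
apply/seteqP; split => y /=; first by move=> [z Az <-]; rewrite addrK.
by move=> Ay; exists (y - x) => //; rewrite subrK.
Qed.

Lemma measurable_shift (A : set rV) x : measurable A ->
  measurable ((fun y : rV => y - x) @^-1` A).
Proof.
move=> mA; rewrite -[X in measurable X]setTI.
have : measurable_fun setT (fun y : rV => y - x).
  by have := measurable_fun_affine 1 (- x); under eq_fun do rewrite scale1r.
exact.
Qed.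

Lemma measurable_theta x : measurable_fun setT (theta x).
Proof.
have [_ _ mt _] := flow.
have h : measurable_fun setT (fun w : Omega => (w, x)).
  by apply: measurable_fun_pair => //; exact: measurable_cst.
exact: (measurableT_comp mt h).
Qed.

Let K_lf w : locally_finite (K w) := posvar_locally_finite (KP w).

(* [K w A] is the supremum of [nu w] over countably many subsets of [A], since
   these approximate a Hahn set. *)
Let measurable_K_bounded A : measurable A -> bounded_rV A ->
  measurable_fun setT (fun w => K w A).
Proof.
move=> mA bA.
pose b m : set rV := bset half_space (nth_bform m).
have mb m : measurable (b m) by exact: measurable_bset measurable_half_space _.
rewrite (_ : (fun w => K w A) =
    (fun w => esups (fun m => (nu w (A `&` b m))%:E) 0%N)); last first.
  apply/funext => w; rewrite /esups /=; apply/eqP; rewrite eq_le; apply/andP; split.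
    have [[H [mH HA ->]] _] := KP w mA bA.
    apply/lee_addgt0Pr => e e0.
    have [mu1 [mu2 dec]] := nu_dec w; have [l1 l2 nuE] := dec.
    (* Closeness is measured in [mu1 + mu2], which dominates the variation of [nu]: passing from [H]
       to the trace of the algebra set on [A] lowers [nu] by at most the mass of the symmetric
       difference inside [A]. *)
    pose m := measure_add mu1 mu2.
    have mfin : (mrestr m mA setT < +oo)%E.
      rewrite /mrestr setTI; apply: (@le_lt_trans _ _ (mu1 A + mu2 A)%E).
        by rewrite /m [leLHS]measure_addE.
      by apply: lte_add_pinfty; [exact: l1|exact: l2].
    have [c hc] := bset_approx measurable_half_space mfin mH e0.
    have [j jc] := nth_bform_surj c.
    apply: (@le_trans _ _ ((nu w (A `&` b j))%:E + e%:E)%E); last first.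
      by apply: leeD => //; apply: ereal_sup_ubound; exists j.
    have bj : b j = bset half_space c by rewrite /b jc.
    rewrite -bj in hc.
    have bH : bounded_rV H by exact: bounded_sub bA.
    have mAb : measurable (A `&` b j) by exact: measurableI.
    have e1 := local_signedD dec mH (mb j) bH.
    have e2 := local_signedD dec mAb mH (bounded_setIl (b j) bA).
    rewrite (_ : A `&` b j `&` H = H `&` b j) in e2; last first.
      by rewrite -setIA (setIC (b j)) setIA (setIidr HA).
    set H1 := H `\` b j in e1; set H2 := A `&` b j `\` H in e2.
    have mH1 : measurable H1 by exact: measurableD.
    have mH2 : measurable H2 by exact: measurableD.
    have bH1 : bounded_rV H1 by apply: bounded_sub bH; exact: subDsetl.
    have bH2 : bounded_rV H2 by apply: bounded_sub bA => x [[]].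
    rewrite e1 e2 -EFinD lee_fin -addrA lerD2l -lerBlDl.
    rewrite (nuE H1)// (nuE H2)//.
    have : fine (mu1 H1) + fine (mu2 H2) < e.
      rewrite -lte_fin EFinD !fineK ?bounded_fin_num//.
      apply: le_lt_trans hc; rewrite /mrestr /m [leRHS]measure_addE.
      have mS : measurable (symdiff H (b j) `&` A).
        by apply: measurableI => //; exact: measurable_symdiff.
      apply: leeD; apply: le_measure; rewrite ?inE//.
        by move=> x [Hx nb]; split; [left|exact: HA].
      by move=> x [[Ax bx] nH]; split => //; right.
    have := fine_ge0 (measure_ge0 mu2 H1); have := fine_ge0 (measure_ge0 mu1 H2).
    lra.
  apply: ge_ereal_sup => _ [j _ <-].
  have [_ sup] := KP w mA bA; apply: sup; first exact: measurableI.
  exact: subIsetl.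
apply: measurable_fun_esups => m; apply/measurable_EFinP; apply: mnu.
  exact: measurableI.
exact: bounded_setIl.
Qed.

Lemma measurable_K A : measurable A -> measurable_fun setT (fun w => K w A).
Proof.
move=> mA.
pose B j := A `&` eball j%:R.
have mB j : measurable (B j) by apply: measurableI => //; exact: measurable_enorm_lt.
have BA : \bigcup_j B j = A by rewrite /B -setI_bigcupr eball_bigcup setIT.
have ndB : nondecreasing_seq B.
  move=> i j ij; apply/subsetPset; apply: setIS; apply: eball_sub.
  by rewrite ler_nat.
apply: (emeasurable_fun_cvg (fun j w => K w (B j))).
  move=> j; apply: measurable_K_bounded => //.
  by apply: bounded_sub (bounded_eball j%:R); exact: subIsetr.
by move=> w _; rewrite -BA; apply: nondecreasing_cvg_mu => //; rewrite BA.
Qed.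

(** Both sides are suprema determined by [nu]; translating a maximizer for one side gives a
    competitor for the other. *)
Lemma K_shift x w A : measurable A -> bounded_rV A ->
  K (theta x w) A = K w ((fun y : rV => y - x) @^-1` A).
Proof.
move=> mA bA.
have mA' := measurable_shift x mA.
have bA' : bounded_rV ((fun y : rV => y - x) @^-1` A) by exact: bounded_translate.
have [[H [mH HA e1]] s1] := KP (theta x w) mA bA.
have [[H' [mH' HA' e2]] s2] := KP w mA' bA'.
apply/eqP; rewrite eq_le; apply/andP; split.
  rewrite e1 nu_inv//; last exact: bounded_sub bA.
  by rewrite shift_setE; apply: s2; [exact: measurable_shift|move=> y /HA].
rewrite e2.
have -> : H' = shift_set ((fun y : rV => y - (- x)) @^-1` H') x.
  by rewrite shift_setE; apply/seteqP; split => y /=; rewrite opprK subrK.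
have mH'' := measurable_shift (- x) mH'.
have HA'' : (fun y : rV => y - (- x)) @^-1` H' `<=` A.
  by move=> y /= /HA' /=; rewrite opprK addrK.
rewrite -nu_inv//; first exact: s1.
exact: bounded_sub bA.
Qed.

Lemma expectation_theta x (g : Omega -> \bar R) : measurable_fun setT g ->
  (forall w, 0 <= g w)%E -> (\int[P]_w g (theta x w) = \int[P]_w g w)%E.
Proof.
move=> mg g0; have [_ _ _ pres] := flow.
rewrite -(@ge0_integral_image _ _ _ _ _ P P _ (measurable_theta x))//.
by move=> A mA; exact/esym/pres.
Qed.

Definition second_moment A := (\int[P]_w ((fine (K w A)) ^+ 2)%:E)%E.

Let mK2 A : measurable A ->
  measurable_fun setT (fun w => ((fine (K w A)) ^+ 2)%:E).
Proof.
move=> mA; apply/measurable_EFinP; apply: measurable_funX.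
by apply: measurableT_comp => //; exact: measurable_K.
Qed.

Lemma second_moment_shift x A : measurable A -> bounded_rV A ->
  second_moment ((fun y : rV => y - x) @^-1` A) = second_moment A.
Proof.
move=> mA bA; rewrite /second_moment.
rewrite -[RHS](@expectation_theta x (fun w => ((fine (K w A)) ^+ 2)%:E)).
- by apply: eq_integral => w _; rewrite K_shift.
- exact: mK2.
- by move=> w; rewrite lee_fin sqr_ge0.
Qed.

Lemma second_moment_le A B : measurable A -> measurable B -> bounded_rV B ->
  A `<=` B -> (second_moment A <= second_moment B)%E.
Proof.
move=> mA mB bB AB; apply: ge0_le_integral => //; try exact: mK2.
- move=> w _; rewrite lee_fin ler_sqr ?nnegrE ?fine_ge0// fine_le//.
  + by apply: bounded_fin_num => //; exact: bounded_sub bB.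
  + exact: bounded_fin_num.
  + by apply: le_measure; rewrite ?inE.
Qed.

Lemma second_moment_setU A B : measurable A -> measurable B -> bounded_rV A ->
  bounded_rV B -> (second_moment A < +oo)%E -> (second_moment B < +oo)%E ->
  (second_moment (A `|` B) < +oo)%E.
Proof.
move=> mA mB bA bB Af Bf.
have mAB : measurable (A `|` B) by exact: measurableU.
have bAB : bounded_rV (A `|` B).
  have [[r Ar] [r' Br]] := (bA, bB); exists (Num.max r r').
  by move=> x [/Ar|/Br]; apply: eball_sub; rewrite le_max lexx ?orbT.
apply: (@le_lt_trans _ _ (2%:E * second_moment A + 2%:E * second_moment B)%E).
  rewrite /second_moment -!ge0_integralZl//; try (exact: mK2);
    try by move=> w _; rewrite lee_fin sqr_ge0.
  rewrite -ge0_integralD//; try (by move=> w _; rewrite mule_ge0// lee_fin sqr_ge0);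
    try (by apply: measurable_funeM; exact: mK2).
  apply: ge0_le_integral => //; try exact: mK2.
  - by apply: emeasurable_funD; apply: measurable_funeM; exact: mK2.
  - move=> w _; rewrite -!EFinM -EFinD lee_fin.
    have : fine (K w (A `|` B)) <= fine (K w A) + fine (K w B).
      rewrite -fineD ?bounded_fin_num// fine_le ?fin_numD ?bounded_fin_num//.
      exact: measureU2.
    have := fine_ge0 (measure_ge0 (K w) (A `|` B)).
    have := fine_ge0 (measure_ge0 (K w) A); have := fine_ge0 (measure_ge0 (K w) B).
    have := sqr_ge0 (fine (K w A) - fine (K w B)).
    move: (fine _) (fine _) (fine _) => a b c; nra.
by apply: lte_add_pinfty; apply: lte_mul_pinfty.
Qed.

Hypothesis ball_moment : (second_moment (eball 1) < +oo)%E.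

Lemma second_moment_bounded A : measurable A -> bounded_rV A ->
  (second_moment A < +oo)%E.
Proof.
move=> mA bA.
have [s sA] := compact_eball_cover (bounded_closure_compact bA).
pose C c : set rV := (fun y : rV => y - c) @^-1` eball 1.
have mC c : measurable (C c) by apply: measurable_shift; exact: measurable_enorm_lt.
have bC c : bounded_rV (C c) by apply: bounded_translate; exact: bounded_eball.
pose U (s : seq rV) := \big[setU/set0]_(c <- s) C c.
have AU : A `<=` U s.
  move=> x Ax; have [c cs xc] := sA x (subset_closure Ax).
  by rewrite /U -bigcup_seq; exists c.
suff [mU bU fU] : [/\ measurable (U s), bounded_rV (U s) & (second_moment (U s) < +oo)%E].
  exact: (le_lt_trans (second_moment_le mA mU bU AU)).
rewrite /U {AU sA}; elim: s => [|c s [mU bU fU]].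
  rewrite big_nil; split => //; first by exists 0.
  rewrite /second_moment; under eq_integral do rewrite measure0 /= expr0n /=.
  by rewrite integral0.
rewrite big_cons; split.
- exact: measurableU.
- have [[r Ar] [r' Br]] := (bC c, bU); exists (Num.max r r').
  by move=> x [/Ar|/Br]; apply: eball_sub; rewrite le_max lexx ?orbT.
- apply: second_moment_setU => //.
  by rewrite second_moment_shift//; [exact: measurable_enorm_lt|exact: bounded_eball].
Qed.

(** The mean measure of [K] inherits translation invariance from the flow and is locally finite,
    hence it is a multiple of Lebesgue measure, the factor being read off on the unit ball. *)
Lemma campbell : exists2 C : R, 0 <= C & forall g : rV -> \bar R,
  measurable_fun setT g -> (forall x, 0 <= g x)%E ->
  (\int[P]_w \int[K w]_x g x = C%:E * \int[la]_x g x)%E.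
Proof.
pose La : {measure set rV -> \bar R} := mixture P measurable_K.
have LaE A : measurable A -> La A = (\int[P]_w K w A)%E by move=> mA; exact: mixtureE.
have Lalf : locally_finite La.
  move=> A mA bA; rewrite LaE//.
  (* The bound a <= 1 + a^2 derives the first moment from the second. *)
  apply: (@le_lt_trans _ _ (\int[P]_w (1 + ((fine (K w A)) ^+ 2)%:E))%E).
    apply: ge0_le_integral => //.
    - exact: measurable_K.
    - by apply: emeasurable_funD => //; exact: mK2.
    - move=> w _; rewrite -[leLHS]fineK ?bounded_fin_num//.
      rewrite -EFinD lee_fin; move: (fine _) => a.
      by have := sqr_ge0 (a - 1); nra.
  rewrite ge0_integralD//; last exact: mK2.
  rewrite integral_cst// mul1e; apply: lte_add_pinfty.
    by rewrite [ltLHS]probability_setT ltry.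
  exact: second_moment_bounded.
have Lash x A : measurable A -> La ((fun y : rV => y - x) @^-1` A) = La A.
  pose L' : {measure set rV -> \bar R} := image_measure La
     (@measurable_translate _ _ _ _ (idfun : rV -> rV) x (@measurable_id _ _ _)).
  move=> mA; rewrite -[LHS]/(L' A).
  move: A mA; apply: eq_bounded_measure => A mA bA.
  rewrite -[LHS]/(La ((fun y : rV => y - x) @^-1` A)) !LaE//; last exact: measurable_shift.
  rewrite -[RHS](@expectation_theta x (fun w => K w A)) => //; last exact: measurable_K.
  by apply: eq_integral => w _; rewrite K_shift.
pose Q : set rV := eball 1.
have mQ : measurable Q by exact: measurable_enorm_lt.
have bQ : bounded_rV Q by exact: bounded_eball.
have [La' La'E] := locally_finite_sigma_finite Lalf.
(* Integrate 1_A(x + y) 1_Q(y) against La x la in both orders, with the shear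
   (x, y) |-> (x, x + y) in between. *)
have key A : measurable A -> (La A * la Q = La Q * la A)%E.
  move=> mA.
  have mD : measurable_fun setT (fun z : rV * rV => z.2 - z.1).
    apply: measurable_fun_coorP => i; under eq_fun do rewrite !mxE.
    apply: measurable_funB; apply: (measurableT_comp (measurable_coor i));
      [exact: measurable_snd|exact: measurable_fst].
  have mS : measurable_fun setT (fun z : rV * rV => z.1 + z.2).
    apply: measurable_fun_coorP => i; under eq_fun do rewrite !mxE.
    apply: measurable_funD; apply: (measurableT_comp (measurable_coor i));
      [exact: measurable_fst|exact: measurable_snd].
  have mi (B : set rV) : measurable B -> measurable_fun setT (\1_B : rV -> R).
    by move=> mB; exact: measurable_indic.
  pose F (z : rV * rV) : \bar R := (\1_A (z.1 + z.2) * \1_Q z.2)%:E.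
  pose G (z : rV * rV) : \bar R := (\1_A z.2 * \1_Q (z.2 - z.1))%:E.
  have mF : measurable_fun setT F.
    apply/measurable_EFinP; apply: measurable_funM.
      exact: (measurableT_comp (mi _ mA)).
    exact: (measurableT_comp (mi _ mQ)).
  have mG : measurable_fun setT G.
    apply/measurable_EFinP; apply: measurable_funM.
      exact: (measurableT_comp (mi _ mA)).
    exact: (measurableT_comp (mi _ mQ)).
  have F0 z : (0 <= F z)%E by rewrite lee_fin mulr_ge0.
  have G0 z : (0 <= G z)%E by rewrite lee_fin mulr_ge0.
  have FG x : (\int[la]_y F (x, y) = \int[la]_y G (x, y))%E.
    rewrite -(@ge0_integral_translate R n x (fun y => G (x, y)))//; last first.
      by apply: (measurableT_comp mG); exact: measurable_fun_pair.
    by apply: eq_integral => y _; rewrite /F /G /= addrK [y + x]addrC.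
  have intLa B : measurable B -> (\int[La']_x (\1_B x)%:E = La B)%E.
    by move=> mB; rewrite integral_indic// setIT; exact: La'E.
  have := @fubini_tonelli _ _ _ _ _ La' la F mF F0.
  under eq_integral do rewrite FG.
  rewrite (@fubini_tonelli _ _ _ _ _ La' la G mG G0).
  have -> : (\int[la]_y \int[La']_x G (x, y) = La Q * la A)%E.
    transitivity (\int[la]_y (La Q * (\1_A y)%:E))%E.
      apply: eq_integral => y _.
      (* The ball is symmetric, so [y - x] may be exchanged with [x - y], and the inner integral
         becomes the mass of a translate of [Q]. *)
      transitivity (\int[La']_x ((\1_A y)%:E * (\1_((fun x : rV => (x - y)%R) @^-1` Q) x)%:E))%E.
        apply: eq_integral => x _; rewrite /G /= -EFinM; congr (_ * _)%:E.
        rewrite !indicE; congr (_%:R); congr nat_of_bool.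
        by apply/idP/idP; rewrite !inE /Q /eball /= enormB.
      have mQy := measurable_shift y mQ.
      rewrite ge0_integralZl//; last by apply/measurable_EFinP; exact: mi.
      by rewrite intLa// Lash// muleC.
    rewrite ge0_integralZl//; last by apply/measurable_EFinP; exact: mi.
    by rewrite integral_indic// setIT.
  move=> ->.
  transitivity (\int[la]_y (La A * (\1_Q y)%:E))%E.
    rewrite ge0_integralZl//; last by apply/measurable_EFinP; exact: mi.
    by rewrite integral_indic// setIT.
  apply: eq_integral => y _.
  transitivity (\int[La']_x ((\1_Q y)%:E * (\1_((fun x : rV => (x - (- y))%R) @^-1` A) x)%:E))%E; last first.
    by apply: eq_integral => x _; rewrite /F /= -EFinM mulrC !indicE opprK.
  have mAy := measurable_shift (- y) mA.
  rewrite ge0_integralZl//; last by apply/measurable_EFinP; exact: mi.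
  by rewrite intLa// Lash// muleC.
have laQ0 : (0 < la Q)%E by exact: lebesgue_eball_gt0.
have laQf : la Q \is a fin_num by exact: lebesgue_eball_fin.
have LaQf : La Q \is a fin_num by exact: bounded_fin_num.
have q0 : 0 < fine (la Q) by rewrite fine_gt0// laQ0 ltey_eq laQf.
have C0 : 0 <= fine (La Q) / fine (la Q) by rewrite divr_ge0 ?fine_ge0.
exists (fine (La Q) / fine (la Q)) => // g mg g0.
rewrite -(ge0_integral_mixture P measurable_K mg g0).
pose m : {measure set rV -> \bar R} := mscale (NngNum C0) la.
rewrite (@eq_measure_integral _ _ _ _ m); last first.
  move=> A mA _; rewrite -[LHS]/(La A).
  rewrite -[RHS]/((fine (La Q) / fine (la Q))%:E * la A)%E.
  transitivity (((fine (la Q))^-1)%:E * (La A * la Q))%E.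
    rewrite muleCA -[X in (_ * (_ * X))%E](fineK laQf) -EFinM mulVf ?gt_eqF//.
    by rewrite mule1.
  by rewrite key// -[X in (_ * (X * _))%E](fineK LaQf) muleA -EFinM mulrC.
by rewrite /m ge0_integral_mscale.
Qed.

End random_part.

(** The integral of a nonnegative function is a supremum over the simple functions below it, so no
    measurability enters. The total variation and the local suprema of the transform are compared
    with other functions in this way. *)
Lemma ge0_integral_mono d (T : measurableType d) (R : realType)
    (mu : {measure set T -> \bar R}) (f g : T -> \bar R) :
  (forall x, 0 <= f x)%E -> (forall x, f x <= g x)%E ->
  (\int[mu]_x f x <= \int[mu]_x g x)%E.
Proof.
move=> f0 fg; have g0 x : (0 <= g x)%E by exact: le_trans (fg x).
rewrite !ge0_integralTE//; apply: ge_ereal_sup => _ [h /= hf <-].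
by apply: ereal_sup_ubound; exists h => // x; exact: le_trans (fg x).
Qed.

(** * Measurability and moments of random complex integrals *)

Section random_complex_integral.
Context {R : realType} {n : nat} {d : measure_display} {Omega : measurableType d}.
Local Notation rV := 'rV[R]_n.
Local Notation la := (@lebesgue_rV R n).
Variables (P : probability Omega R) (theta : rV -> Omega -> Omega).
Hypothesis flow : measure_preserving_flow P theta.
Variable Phi : Omega -> set rV -> R[i].
Hypothesis rPhi : random_complex_measure Phi.
Hypothesis iPhi : flow_invariant theta Phi.
Hypothesis sPhi : locally_abs_square_integrable P Phi.
Variable K : Omega -> nat -> {measure set rV -> \bar R}.
Hypothesis KP : forall w j, is_posvar (fun A => cpart j (Phi w A)) (K w j).

Let part_dec j w : exists mu1 mu2,
  local_decomposition (fun A => cpart j (Phi w A)) mu1 mu2.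
Proof.
have [mu1 [mu2 [mu3 [mu4 [l1 l2 l3 l4 PhiE]]]]] := rPhi.1 w.
case: j => [|[|[|j]]] /=; [exists mu1, mu2|exists mu2, mu1|exists mu3, mu4|exists mu4, mu3];
  by split => // A mA bA; rewrite PhiE//= ?opprB.
Qed.

Let mpart j A : measurable A -> bounded_rV A ->
  measurable_fun setT (fun w => cpart j (Phi w A)).
Proof.
move=> mA bA; have [m1 m2] := rPhi.2 A mA bA.
by case: j => [|[|[|j]]] //=; exact: measurable_funN.
Qed.

Let part_inv j x w A : measurable A -> bounded_rV A ->
  cpart j (Phi (theta x w) A) = cpart j (Phi w (shift_set A x)).
Proof. by move=> mA bA; rewrite iPhi. Qed.

Let cpart_le j (z : R[i]) : cpart j z <= cmod z.
Proof.
have := Re_le_cmod z; have := Im_le_cmod z; rewrite !ler_norml => /andP[? ?] /andP[? ?].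
by case: j => [|[|[|j]]] /=; lra.
Qed.

Let ball_moment j : (second_moment P (K ^~ j) (eball 1%R) < +oo)%E.
Proof.
apply: le_lt_trans sPhi; apply: ge0_integral_mono.
  by move=> w; rewrite lee_fin sqr_ge0.
move=> w; have mB := @measurable_enorm_lt R n 1.
have bB := @bounded_eball R n 1.
have h : (K w j (eball 1%R) <= Defs.total_variation (Phi w) (eball 1%R))%E.
  have [[H [mH HB ->]] _] := KP w j mB bB.
  apply: (@le_trans _ _ (cmod (Phi w H))%:E); first by rewrite lee_fin.
  (* The maximizer [H] alone is an admissible family for the total variation. *)
  apply: ereal_sup_ubound; exists 1%N, (fun=> H); split.
  - by move=> _; split => //; exact: bounded_sub bB.
  - by move=> i k _ _ _; rewrite (ord1 i) (ord1 k).
  - by rewrite big_ord1.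
have f0 : K w j (eball 1) \is a fin_num.
  by apply: bounded_fin_num => //; exact: posvar_locally_finite (KP w j).
rewrite EFin_expe fineK// expe2 [leRHS]expe2.
exact: lee_pmul.
Qed.

Definition jordan_total w : {measure set rV -> \bar R} :=
  measure_add (measure_add (K w 0) (K w 1)) (measure_add (K w 2) (K w 3)).

Lemma jordan_totalE w A : (jordan_total w A =
  K w 0 A + K w 1 A + (K w 2 A + K w 3 A))%E.
Proof.
rewrite [LHS]measure_addE; congr (_ + _)%E; exact: measure_addE.
Qed.

Lemma ge0_integral_jordan_total w (g : rV -> \bar R) : measurable_fun setT g ->
  (forall x, 0 <= g x)%E -> (\int[jordan_total w]_x g x =
   \int[K w 0]_x g x + \int[K w 1]_x g x +
   (\int[K w 2]_x g x + \int[K w 3]_x g x))%E.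
Proof. by move=> mg g0; rewrite !ge0_integral_measure_add. Qed.

Let K_lf w j : locally_finite (K w j) := posvar_locally_finite (KP w j).

Lemma jordan_total_locally_finite w : locally_finite (jordan_total w).
Proof.
move=> A mA bA; rewrite jordan_totalE.
have h j : (K w j A < +oo)%E by exact: K_lf.
by apply: lte_add_pinfty; apply: lte_add_pinfty; exact: h.
Qed.

Let measurable_Kj j A : measurable A -> measurable_fun setT (fun w => K w j A).
Proof.
exact: (measurable_K (part_dec j) (fun w => KP w j) (@mpart j)).
Qed.

Let measurable_int_Kj j (g : rV -> \bar R) : measurable_fun setT g ->
  (forall x, 0 <= g x)%E -> measurable_fun setT (fun w => \int[K w j]_x g x)%E.
Proof.
move=> mg g0; apply: (@measurable_fun_integral_kernel _ _ _ _ _ (K ^~ j)) => //.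
exact: measurable_Kj.
Qed.

Lemma measurable_integral_jordan_total (g : rV -> \bar R) : measurable_fun setT g ->
  (forall x, 0 <= g x)%E ->
  measurable_fun setT (fun w => \int[jordan_total w]_x g x)%E.
Proof.
move=> mg g0; under eq_fun do rewrite ge0_integral_jordan_total//.
by apply: emeasurable_funD; apply: emeasurable_funD; exact: measurable_int_Kj.
Qed.

Lemma jordan_total_campbell : exists2 C : R, 0 <= C & forall g : rV -> \bar R,
  measurable_fun setT g -> (forall x, 0 <= g x)%E ->
  (\int[P]_w \int[jordan_total w]_x g x = C%:E * \int[la]_x g x)%E.
Proof.
have camp j : exists2 C : R, 0 <= C & forall g : rV -> \bar R,
    measurable_fun setT g -> (forall x, 0 <= g x)%E ->
    (\int[P]_w \int[K w j]_x g x = C%:E * \int[la]_x g x)%E.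
  exact: (campbell flow (part_dec j) (fun w => KP w j) (@mpart j) (@part_inv j) (ball_moment j)).
have [C0 C00 h0] := camp 0%N; have [C1 C10 h1] := camp 1%N.
have [C2 C20 h2] := camp 2%N; have [C3 C30 h3] := camp 3%N.
exists (C0 + C1 + (C2 + C3)); first by rewrite !addr_ge0.
move=> g mg g0.
under eq_integral do rewrite ge0_integral_jordan_total//.
have i0 j w : (0 <= \int[K w j]_x g x)%E by exact: integral_ge0.
have mi j := measurable_int_Kj j mg g0.
rewrite ge0_integralD//; first last.
- exact: (emeasurable_funD (mi 2%N) (mi 3%N)).
- by move=> w _; rewrite adde_ge0.
- exact: (emeasurable_funD (mi 0%N) (mi 1%N)).
- by move=> w _; rewrite adde_ge0.
rewrite (ge0_integralD P measurableT (fun w _ => i0 0%N w) (mi 0%N)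
  (fun w _ => i0 1%N w) (mi 1%N)).
rewrite (ge0_integralD P measurableT (fun w _ => i0 2%N w) (mi 2%N)
  (fun w _ => i0 3%N w) (mi 3%N)).
by rewrite h0// h1// h2// h3// !EFinD !ge0_muleDl ?lee_fin ?addr_ge0.
Qed.

Lemma jordan_total_moment A : measurable A -> bounded_rV A ->
  (\int[P]_w ((fine (jordan_total w A)) ^+ 2)%:E < +oo)%E.
Proof.
move=> mA bA.
have mom j : (\int[P]_w ((fine (K w j A)) ^+ 2)%:E < +oo)%E.
  exact: (second_moment_bounded flow (part_dec j) (fun w => KP w j) (@mpart j) (@part_inv j) (ball_moment j) mA bA).
have mf j : measurable_fun setT (fun w => ((fine (K w j A)) ^+ 2)%:E).
  apply/measurable_EFinP; apply: measurable_funX.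
  by apply: measurableT_comp => //; exact: measurable_Kj.
have ge j w : (0 <= ((fine (K w j A)) ^+ 2)%:E)%E by rewrite lee_fin sqr_ge0.
apply: (@le_lt_trans _ _ (\int[P]_w (4%:E * (((fine (K w 0%N A)) ^+ 2)%:E +
   ((fine (K w 1%N A)) ^+ 2)%:E + (((fine (K w 2%N A)) ^+ 2)%:E +
   ((fine (K w 3%N A)) ^+ 2)%:E))))%E).
  apply: ge0_integral_mono => w; first by rewrite lee_fin sqr_ge0.
  have fn j : K w j A \is a fin_num by exact: bounded_fin_num.
  rewrite jordan_totalE !fineD ?fin_numD ?fn// -!EFinD -EFinM lee_fin.
  move: (fine _) (fine _) (fine _) (fine _) => a b c e.
  have := sqr_ge0 (a - b); have := sqr_ge0 (a - c); have := sqr_ge0 (a - e).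
  have := sqr_ge0 (b - c); have := sqr_ge0 (b - e); have := sqr_ge0 (c - e).
  nra.
rewrite ge0_integralZl//; last 2 first.
- by apply: emeasurable_funD; apply: emeasurable_funD.
- by move=> w _; rewrite !adde_ge0.
apply: lte_mul_pinfty => //.
rewrite !ge0_integralD//; try (by move=> w _; rewrite ?adde_ge0);
  try (by apply: emeasurable_funD).
by apply: lte_add_pinfty; apply: lte_add_pinfty.
Qed.

Lemma jordan_total_cintegrable w (f : rV -> R[i]) :
  cintegrable (jordan_total w) f <-> (forall j, (j < 4)%N -> cintegrable (K w j) f).
Proof.
split=> [/cintegrableP[mf fi]|fi].
  have mc : measurable_fun setT (fun x => (cmod (f x))%:E).
    by apply/measurable_EFinP; exact: cmeasurable_cmod.
  have c0 x : (0 <= (cmod (f x))%:E)%E by rewrite lee_fin cmod_ge0.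
  rewrite ge0_integral_jordan_total// in fi.
  have i0 j : (0 <= \int[K w j]_x (cmod (f x))%:E)%E by exact: integral_ge0.
  move=> j j4; apply/cintegrableP; split => //; apply: le_lt_trans fi.
  have L (a b c e : \bar R) : (0 <= a -> 0 <= b -> 0 <= c -> 0 <= e ->
      [/\ a <= a + b + (c + e), b <= a + b + (c + e), c <= a + b + (c + e) &
          e <= a + b + (c + e)])%E.
    move=> a0 b0 c'0 e0; have ab := adde_ge0 a0 b0; have ce := adde_ge0 c'0 e0.
    split; [apply: (le_trans _ (leeDl _ ce)); exact: leeDl
      |apply: (le_trans _ (leeDl _ ce)); exact: leeDr
      |apply: (le_trans _ (leeDr _ ab)); exact: leeDl
      |apply: (le_trans _ (leeDr _ ab)); exact: leeDr].
  have [] := L _ _ _ _ (i0 0%N) (i0 1%N) (i0 2%N) (i0 3%N).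
  by case: j j4 => [|[|[|[|//]]]] _.
have mf := cintegrable_cmeasurable (fi 0%N isT).
apply/cintegrableP; split => //; rewrite ge0_integral_jordan_total.
- have h j : (j < 4)%N -> (\int[K w j]_x (cmod (f x))%:E < +oo)%E.
    by move=> /fi /cintegrableP[].
  by apply: lte_add_pinfty; apply: lte_add_pinfty; exact: h.
- by apply/measurable_EFinP; exact: cmeasurable_cmod.
- by move=> x; rewrite lee_fin cmod_ge0.
Qed.

Let cPhi w : complex_measure (Phi w) := rPhi.1 w.

Lemma cm_integral_totalB w (f g : rV -> R[i]) : cintegrable (jordan_total w) f ->
  cintegrable (jordan_total w) g ->
  cm_integral (Phi w) (fun x => f x - g x) =
  cm_integral (Phi w) f - cm_integral (Phi w) g.
Proof.
move=> fi gi; have fgi := cintegrableB fi gi.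
move/jordan_total_cintegrable : fi => fi; move/jordan_total_cintegrable : gi => gi.
move/jordan_total_cintegrable : fgi => fgi.
rewrite !(cm_integral_jordan (cPhi w) (KP w))// /jordan_integral.
rewrite !cintegralB; try exact: fi; try exact: gi.
by ring.
Qed.

Lemma cm_integral_total_le w (f : rV -> R[i]) : cintegrable (jordan_total w) f ->
  ((cmod (cm_integral (Phi w) f))%:E <= 2%:E * \int[jordan_total w]_x (cmod (f x))%:E)%E.
Proof.
move=> fi; have mf := cintegrable_cmeasurable fi.
move/jordan_total_cintegrable : fi => fi.
have mc : measurable_fun setT (fun x => (cmod (f x))%:E).
  by apply/measurable_EFinP; exact: cmeasurable_cmod.
have c0 x : (0 <= (cmod (f x))%:E)%E by rewrite lee_fin cmod_ge0.
rewrite (cm_integral_jordan (cPhi w) (KP w))// /jordan_integral.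
rewrite ge0_integral_jordan_total//.
have i0 j : (0 <= \int[K w j]_x (cmod (f x))%:E)%E by exact: integral_ge0.
have h j : (j < 4)%N -> ((cmod (cintegral (K w j) f))%:E <= 2%:E * \int[K w j]_x (cmod (f x))%:E)%E.
  by move=> j4; apply: cmod_cintegral_le; exact: fi.
apply: (@le_trans _ _ ((cmod (cintegral (K w 0) f))%:E + (cmod (cintegral (K w 1) f))%:E +
  ((cmod (cintegral (K w 2) f))%:E + (cmod (cintegral (K w 3) f))%:E))%E); last first.
  move: (i0 0%N) (i0 1%N) (i0 2%N) (i0 3%N) (h 0%N isT) (h 1%N isT) (h 2%N isT) (h 3%N isT).
  set a := integral (K w 0%N) _ _; set b := integral (K w 1%N) _ _.
  set c := integral (K w 2%N) _ _; set e := integral (K w 3%N) _ _.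
  move: a b c e => a b c e a0 b0 c'0 e0 ha hb hc he.
  rewrite ge0_muleDr ?adde_ge0// ge0_muleDr// ge0_muleDr//.
  exact: (leeD (leeD ha hb) (leeD hc he)).
rewrite -!EFinD lee_fin; apply: (le_trans (cmodD _ _)); apply: lerD.
  exact: cmodB.
rewrite cmodM (_ : cmod 'i%C = 1) ?mul1r; first exact: cmodB.
by rewrite /= expr0n expr1n add0r sqrtr1.
Qed.

(** On the event [good], where |f| has finite integral for the sum of the Jordan parts, the value is
    a combination of kernel integrals; elsewhere it is the default 0. The event is measurable
    because the integral of |f| is. *)
Lemma cmeasurable_cm_integral (f : rV -> R[i]) : cmeasurable f ->
  cmeasurable (fun w => cm_integral (Phi w) f).
Proof.
move=> mf.
have mc : measurable_fun setT (fun x => (cmod (f x))%:E).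
  by apply/measurable_EFinP; exact: cmeasurable_cmod.
have c0 x : (0 <= (cmod (f x))%:E)%E by rewrite lee_fin cmod_ge0.
have mR j (u : rV -> R) : measurable_fun setT u ->
    measurable_fun setT (fun w => \int[K w j]_x u x).
  move=> mu; apply: measurableT_comp => //.
  rewrite (_ : (fun w => _) = (fun w => \int[K w j]_x ((EFin \o u)^\+ x) -
     \int[K w j]_x ((EFin \o u)^\- x))%E); last first.
    by apply/funext => w; rewrite integralE.
  have mE : measurable_fun setT (EFin \o u) by exact/measurable_EFinP.
  apply: emeasurable_funB; apply: measurable_int_Kj => //.
  - exact: measurable_funepos.
  - exact: measurable_funeneg.
have mJ : cmeasurable (fun w => jordan_integral (K w) f).
  have mi j : cmeasurable (fun w => cintegral (K w j) f).
    by have [m1 m2] := mf; split => /=; exact: mR.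
  rewrite /jordan_integral; apply: cmeasurableD; first exact: cmeasurableB.
  apply: cmeasurableM; first exact: cmeasurable_cst.
  exact: cmeasurableB.
pose good w : bool := (\int[jordan_total w]_x (cmod (f x))%:E < +oo)%E.
have mgood : measurable_fun setT good.
  apply: measurable_fun_lte => //.
  exact: measurable_integral_jordan_total.
have -> : (fun w => cm_integral (Phi w) f) =
    (fun w => if good w then jordan_integral (K w) f else 0).
  apply/funext => w; case: ifPn => gw.
    apply: cm_integral_jordan => //; apply/jordan_total_cintegrable.
    exact/cintegrableP.
  apply: (cm_integral_not_integrable (KP w)) => /jordan_total_cintegrable /cintegrableP[_].
  by rewrite -[X in is_true X]/(good w) (negbTE gw).
have [m1 m2] := mJ; split.
  rewrite (_ : (fun w => _) = (fun w => if good w then complex.Re (jordan_integral (K w) f) else 0)).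
    exact: measurable_fun_ifT.
  by apply/funext => w; case: ifP.
rewrite (_ : (fun w => _) = (fun w => if good w then complex.Im (jordan_integral (K w) f) else 0)).
  exact: measurable_fun_ifT.
by apply/funext => w; case: ifP.
Qed.

End random_complex_integral.

(* [M w] is the sum of the four Jordan parts of [Phi w], a measure comparable to
   its total variation. *)
Lemma random_integral_dominated (R : realType) n d (Omega : measurableType d)
    (P : probability Omega R) (theta : 'rV[R]_n -> Omega -> Omega)
    (Phi : Omega -> set 'rV[R]_n -> R[i]) :
  measure_preserving_flow P theta -> random_complex_measure Phi ->
  flow_invariant theta Phi -> locally_abs_square_integrable P Phi ->
  exists (M : Omega -> {measure set 'rV[R]_n -> \bar R}) (C : R), [/\ 0 <= C,
    forall w, locally_finite (M w),
    forall A, measurable A -> bounded_rV A ->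
      (\int[P]_w ((fine (M w A)) ^+ 2)%:E < +oo)%E,
    forall g : 'rV[R]_n -> \bar R, measurable_fun setT g -> (forall x, 0 <= g x)%E ->
      measurable_fun setT (fun w => \int[M w]_x g x)%E /\
      (\int[P]_w \int[M w]_x g x = C%:E * \int[lebesgue_rV n]_x g x)%E &
    [/\ forall f, cmeasurable f -> cmeasurable (fun w => cm_integral (Phi w) f),
      forall w f g, cintegrable (M w) f -> cintegrable (M w) g ->
        cm_integral (Phi w) (fun x => f x - g x) =
        cm_integral (Phi w) f - cm_integral (Phi w) g &
      forall w f, cintegrable (M w) f ->
        ((cmod (cm_integral (Phi w) f))%:E <= 2%:E * \int[M w]_x (cmod (f x))%:E)%E]].
Proof.
move=> flow rPhi iPhi sPhi.
have /choice[K KP] w := jordan_exists (rPhi.1 w).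
have [C C0 camp] := jordan_total_campbell flow rPhi iPhi sPhi KP.
exists (jordan_total K), C; split => //.
- exact: jordan_total_locally_finite.
- exact: (jordan_total_moment flow rPhi iPhi sPhi KP).
- move=> g mg g0; split; last exact: camp.
  exact: (measurable_integral_jordan_total rPhi KP).
- split.
  + exact: cmeasurable_cm_integral.
  + exact: cm_integral_totalB.
  + exact: cm_integral_total_le.
Qed.

Lemma cmeasurable_cintegral d1 d2 (T1 : measurableType d1) (T2 : measurableType d2)
    (R : realType) (m2 : {sigma_finite_measure set T2 -> \bar R})
    (F : T1 * T2 -> R[i]) : cmeasurable F ->
  cmeasurable (fun x => cintegral m2 (fun y => F (x, y))).
Proof.
have E (u : T1 * T2 -> R) : measurable_fun setT u ->
    measurable_fun setT (fun x => \int[m2]_y u (x, y)).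
  move=> mu; apply: measurableT_comp => //.
  have mE : measurable_fun setT (EFin \o u) by exact/measurable_EFinP.
  rewrite (_ : (fun x => _) = (fun x => \int[m2]_y ((EFin \o u)^\+ (x, y)) -
     \int[m2]_y ((EFin \o u)^\- (x, y)))%E); last first.
    apply/funext => x; rewrite integralE; congr (_ - _)%E;
      by apply: eq_integral => y _; rewrite ?funeposE ?funenegE.
  apply: emeasurable_funB.
  - by apply: measurable_fun_fubini_tonelli_F => //; exact: measurable_funepos.
  - by apply: measurable_fun_fubini_tonelli_F => //; exact: measurable_funeneg.
by move=> [m1 m2']; split; [exact: (E _ m1)|exact: (E _ m2')].
Qed.

(** * Fourier transforms *)

Section fourier_transform.
Context {R : realType} {n : nat}.
Local Notation rV := 'rV[R]_n.
Local Notation la := (@lebesgue_rV R n).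
Implicit Types (f g : rV -> R[i]) (k x y : rV).

(** The kernel e^(-i<k,x>), in the syntactic form used in [fourier], so that [fourierE] holds by
    conversion. *)
Definition echar k x : R[i] := cos (dotp k x) -i* sin (dotp k x).

Lemma fourierE f k : fourier f k = cintegral la (fun x => echar k x * f x).
Proof. by []. Qed.

Lemma cmod_echar k x : cmod (echar k x) = 1.
Proof.
apply/eqP; rewrite -(@eqrXn2 _ 2)// ?cmod_ge0// expr1n cmod_sqr /= sqrrN.
by rewrite cos2Dsin2.
Qed.

Lemma echarD k x y : echar k (x + y) = echar k x * echar k y.
Proof.
by rewrite /echar dotpDr; apply: eqc; rewrite /= ?cosD ?sinD; ring.
Qed.

Lemma echarDl k k' x : echar (k + k') x = echar k x * echar k' x.
Proof.
by rewrite /echar dotpDl; apply: eqc; rewrite /= ?cosD ?sinD; ring.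
Qed.

Lemma echar0 x : echar 0 x = 1.
Proof.
have -> : 0 = (0 : R) *: (0 : rV) by rewrite scaler0.
by rewrite /echar dotpZl mul0r cos0 sin0 oppr0.
Qed.

Lemma echarZ (r : R) k x : echar (r *: k) x = echar k (r *: x).
Proof. by rewrite /echar dotpZl dotpZr. Qed.

Lemma cmeasurable_echar_dotp d (T : measurableType d) (u : T -> R) :
  measurable_fun setT u -> cmeasurable (fun t => cos (u t) -i* sin (u t)).
Proof.
move=> mu; split => /=.
  apply: measurableT_comp => //.
  exact: (continuous_measurable_fun (@continuous_cos R)).
apply: measurable_funN; apply: measurableT_comp => //.
exact: (continuous_measurable_fun (@continuous_sin R)).
Qed.

Lemma cmeasurable_echar k : cmeasurable (echar k).
Proof. by apply: cmeasurable_echar_dotp; exact: measurable_dotp. Qed.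

Lemma cmeasurable_echar2 : cmeasurable (fun kx : rV * rV => echar kx.1 kx.2).
Proof.
apply: cmeasurable_echar_dotp; rewrite /dotp; apply: measurable_sum => i.
apply: measurable_funM; apply: (measurableT_comp (measurable_coor i));
  [exact: measurable_fst|exact: measurable_snd].
Qed.

Lemma cintegrable_echarM k f : cintegrable la f ->
  cintegrable la (fun x => echar k x * f x).
Proof.
move=> fi; apply: (le_cintegrable _ _ (cintegrable_cmod fi)).
- apply: cmeasurableM; [exact: cmeasurable_echar|exact: cintegrable_cmeasurable fi].
- by move=> x; rewrite cmodM cmod_echar mul1r.
Qed.

Lemma fourierB f g k : cintegrable la f -> cintegrable la g ->
  fourier (fun x => f x - g x) k = fourier f k - fourier g k.
Proof.
move=> fi gi; rewrite !fourierE -cintegralB; try exact: cintegrable_echarM.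
by congr cintegral; apply/funext => x; rewrite mulrBr.
Qed.

Lemma fourierZ (c : R[i]) f k : cintegrable la f ->
  fourier (fun x => c * f x) k = c * fourier f k.
Proof.
move=> fi; rewrite !fourierE -cintegralZl; last exact: cintegrable_echarM.
by congr cintegral; apply/funext => x; rewrite mulrCA.
Qed.

Lemma fourier0 f : fourier f 0 = cintegral la f.
Proof.
by rewrite fourierE; congr cintegral; apply/funext => x; rewrite echar0 mul1r.
Qed.

Lemma fourier_le f k : cintegrable la f ->
  ((cmod (fourier f k))%:E <= 2%:E * \int[la]_x (cmod (f x))%:E)%E.
Proof.
move=> fi; apply: (le_trans (cmod_cintegral_le (cintegrable_echarM k fi))).
by under eq_integral do rewrite cmodM cmod_echar mul1r.
Qed.

Lemma cmeasurable_fourier f : cmeasurable f -> cmeasurable (fourier f).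
Proof.
move=> mf; apply: (@cmeasurable_cintegral _ _ _ _ _ la
  (fun kx : rV * rV => echar kx.1 kx.2 * f kx.2)).
apply: cmeasurableM; first exact: cmeasurable_echar2.
exact: (cmeasurable_comp mf measurable_snd).
Qed.

Lemma cintegrable_dilation f (r : R) : 0 < r -> cintegrable la f ->
  cintegrable la (fun x => f (r^-1 *: x)).
Proof.
by move=> r0 fi; have ri : 0 < r^-1; rewrite ?invr_gt0//; case: (cintegral_scale ri fi).
Qed.

Lemma fourier_dilation f (r : R) k : 0 < r -> cintegrable la f ->
  fourier (fun x => f (r^-1 *: x)) k = (r ^+ n)%:C * fourier f (r *: k).
Proof.
move=> r0 fi; have ri : 0 < r^-1 by rewrite invr_gt0.
rewrite !fourierE.
have [_] := cintegral_scale ri (cintegrable_echarM (r *: k) fi).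
rewrite exprVn invrK => <-; congr cintegral; apply/funext => x.
by rewrite echarZ scalerA mulfV ?gt_eqF// scale1r.
Qed.

Lemma fourier_modulation f k k' :
  fourier (fun x => echar (- k) x * f x) k' = fourier f (k' - k).
Proof.
rewrite !fourierE; congr cintegral; apply/funext => x.
by rewrite mulrA -echarDl.
Qed.

(** Dominated convergence along a sequence of frequencies that would violate continuity, with
    majorant 2 |f|. It is applied at frequency 0, to [f] and to the mollifying kernel. *)
Lemma fourier_cont f k : cintegrable la f -> forall e : R, 0 < e ->
  exists2 delta : R, 0 < delta & forall k', enorm (k' - k) < delta ->
    cmod (fourier f k' - fourier f k) <= e.
Proof.
move=> fi e e0; apply: contrapT => nh.
have /choice[y yP] : forall m : nat, exists y : rV, enorm (y - k) < m.+1%:R^-1 /\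
    e < cmod (fourier f y - fourier f k).
  move=> m; apply: contrapT => nk; apply: nh.
  exists m.+1%:R^-1; first by rewrite invr_gt0.
  by move=> y yk; rewrite leNgt; apply/negP => ey; apply: nk; exists y.
have mf := cintegrable_cmeasurable fi.
pose h m x := (cmod ((echar (y m) x - echar k x) * f x))%:E : \bar R.
have ylim x : dotp (y m) x @[m --> \oo] --> dotp k x.
  apply/cvgrPdist_lt => eps eps0.
  have x1 : 0 < enorm x + 1 by rewrite ltr_wpDl// enorm_ge0.
  have ex0 : 0 < eps / (enorm x + 1) by rewrite divr_gt0.
  have := near_infty_natSinv_lt (PosNum ex0).
  apply: filterS => m /= hm; rewrite distrC -dotpNl -dotpDl.
  apply: (le_lt_trans (dotp_le _ _)).
  apply: (@le_lt_trans _ _ (m.+1%:R^-1 * (enorm x + 1))).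
    by apply: ler_pM; rewrite ?enorm_ge0 ?lerDl// ltW// (yP m).1.
  by rewrite -ltr_pdivlMr.
have hlim x : h m x @[m --> \oo] --> 0%E.
  apply/fine_cvgP; split; first exact: nearW.
  have c1 : cos (dotp (y m) x) @[m --> \oo] --> cos (dotp k x).
    exact: (cvg_comp _ _ (ylim x) (@continuous_cos R _)).
  have c2 : sin (dotp (y m) x) @[m --> \oo] --> sin (dotp k x).
    exact: (cvg_comp _ _ (ylim x) (@continuous_sin R _)).
  apply/cvgrPdist_lt => eps eps0.
  have F1 : 0 < cmod (f x) + 1 by rewrite ltr_wpDl// cmod_ge0.
  have e20 : 0 < eps / (cmod (f x) + 1) / 2 by rewrite !divr_gt0.
  move/cvgrPdist_lt : c1 => /(_ _ e20) c1; move/cvgrPdist_lt : c2 => /(_ _ e20) c2.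
  apply: filterS2 c1 c2 => m h1 h2 /=; rewrite sub0r normrN ger0_norm ?cmod_ge0//.
  rewrite cmodM.
  have : cmod (echar (y m) x - echar k x) < eps / (cmod (f x) + 1).
    apply: (le_lt_trans (cmod_le_ReIm _)); rewrite ReB ImB /= opprK addrC.
    by rewrite [ltRHS]splitr; apply: ltrD; [rewrite addrC|rewrite distrC].
  move=> h3; apply: (@le_lt_trans _ _ (cmod (echar (y m) x - echar k x) * (cmod (f x) + 1))).
    by rewrite ler_wpM2l ?cmod_ge0// lerDl.
  by rewrite -ltr_pdivlMr.
have mh m : measurable_fun setT (h m).
  apply/measurable_EFinP; apply: cmeasurable_cmod; apply: cmeasurableM => //.
  by apply: cmeasurableB; exact: cmeasurable_echar.
have gi : la.-integrable setT (fun x => (2 * cmod (f x))%:E).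
  have := integrableZl measurableT 2 (cintegrable_cmod fi).
  exact.
have [] := @dominated_convergence _ _ _ la setT measurableT h (cst 0%E) _ mh _ _ gi.
- exact: measurable_cst.
- by apply: nearW => x _; exact: hlim.
- apply: nearW => x m _; rewrite gee0_abs ?lee_fin ?cmod_ge0//.
  rewrite cmodM ler_wpM2r ?cmod_ge0// (le_trans (cmodB _ _))//.
  by rewrite !cmod_echar.
move=> _ _; rewrite [X in _ --> X]integral0_eq//.
have e20 : 0 < e / 2 by rewrite divr_gt0.
move=> /fine_cvgP[fin /cvgrPdist_lt /(_ _ e20) lim0].
have [m [/= h1 h2]] := @filter_ex _ _ _ _ (filterI fin lim0).
have [_] := yP m; rewrite ltNge => /negP; apply.
have Fi k' := cintegrable_echarM k' fi.
rewrite !fourierE -cintegralB// -lee_fin.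
apply: (le_trans (cmod_cintegral_le (cintegrableB (Fi _) (Fi _)))).
have -> : (\int[la]_x (cmod (echar (y m) x * f x - echar k x * f x))%:E = \int[la]_x h m x)%E.
  by apply: eq_integral => x _; rewrite -mulrBl.
rewrite -(fineK h1) -EFinM lee_fin.
have := ler_norm (fine (\int[la]_x h m x)).
by move: h2; rewrite sub0r normrN => h2 h3; lra.
Qed.

Section convolution.
Variables (eta : rV -> R) (f : rV -> R[i]) (delta A r B : R).
Hypothesis meta : measurable_fun setT eta.
Hypothesis eta0 : forall x, 0 <= eta x <= A.
Hypothesis eta_supp : forall x, ~ eball delta x -> eta x = 0.
Hypothesis mf : cmeasurable f.
Hypothesis fB : forall x, cmod (f x) <= B.
Hypothesis f_supp : forall x, ~ eball r x -> f x = 0.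

Definition convol x : R[i] := cintegral la (fun y => (eta y)%:C * f (x - y)).

Let A0 : 0 <= A.
Proof. by have /andP[a b] := eta0 0; exact: le_trans b. Qed.

Let B0 : 0 <= B.
Proof. exact: le_trans (cmod_ge0 _) (fB 0). Qed.

Lemma bounded_support_cintegrable (g : rV -> R[i]) (a b : R) : 0 <= b ->
  cmeasurable g -> (forall x, cmod (g x) <= b) ->
  (forall x, ~ eball a x -> g x = 0) -> cintegrable la g.
Proof.
move=> b0 mg gb gs.
apply: (@le_cintegrable _ _ _ _ _ (fun x => b * \1_(eball a : set rV) x)) => //.
  move=> x; rewrite indicE; case: (boolP (x \in _)) => xa.
    by rewrite mulr1.
  by rewrite gs ?cmod0 ?mulr0// => h; case/negP: xa; rewrite inE.
apply/integrableP; split.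
  apply/measurable_EFinP; apply: measurable_funM => //.
  by apply: measurable_indic; exact: measurable_enorm_lt.
have mE := @measurable_enorm_lt R n a.
under eq_integral do rewrite gee0_abs ?lee_fin ?mulr_ge0// EFinM.
rewrite ge0_integralZl//; last first.
  by apply/measurable_EFinP; exact: measurable_indic.
rewrite integral_indic// setIT; apply: lte_mul_pinfty => //.
by apply: lebesgue_locally_finite => //; exact: bounded_eball.
Qed.

Let ceta x : R[i] := (eta x)%:C.

Let mceta : cmeasurable ceta. Proof. exact: cmeasurable_real. Qed.

Let ceta_int : cintegrable la ceta.
Proof.
apply: (@bounded_support_cintegrable _ delta A) => //.
- by move=> x; have /andP[? ?] := eta0 x; rewrite cmodR ger0_norm.
- by move=> x /eta_supp; rewrite /ceta => ->.
Qed.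

Let f_int : cintegrable la f.
Proof. exact: (@bounded_support_cintegrable _ r B). Qed.

Let msub : measurable_fun setT (fun z : rV * rV => z.1 - z.2).
Proof.
apply: measurable_fun_coorP => i; under eq_fun do rewrite !mxE.
apply: measurable_funB; apply: (measurableT_comp (measurable_coor i));
  [exact: measurable_fst|exact: measurable_snd].
Qed.

Let mconv2 : cmeasurable (fun z : rV * rV => ceta z.2 * f (z.1 - z.2)).
Proof.
apply: cmeasurableM; first exact: (cmeasurable_comp mceta measurable_snd).
exact: (cmeasurable_comp mf msub).
Qed.

Let conv_int x : cintegrable la (fun y => ceta y * f (x - y)).
Proof.
apply: (@bounded_support_cintegrable _ delta (A * B)); first exact: mulr_ge0.
- apply: cmeasurableM => //; apply: (cmeasurable_comp mf).
  have := measurable_fun_affine (-1) x.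
  by under eq_fun do rewrite scaleN1r addrC.
- move=> y; have /andP[? ?] := eta0 y.
  by rewrite cmodM cmodR ger0_norm// ler_pM// cmod_ge0.
- by move=> y /eta_supp; rewrite /ceta => ->; rewrite mul0r.
Qed.

Lemma cmeasurable_conv : cmeasurable convol.
Proof. exact: (cmeasurable_cintegral la mconv2). Qed.

Lemma conv_supp x : ~ eball (r + delta) x -> convol x = 0.
Proof.
move=> xs; rewrite /convol.
rewrite (_ : (fun y => _) = (fun=> 0)).
  by apply: eqc; rewrite /= /Rintegral integral0.
apply/funext => y; have [yd|/eta_supp ->] := pselect (eball delta y); last by rewrite mul0r.
rewrite f_supp ?mulr0// => xy; apply: xs; rewrite /eball /= -[x](subrK y).
by rewrite (le_lt_trans (enormD _ _))// ltrD.
Qed.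

Lemma conv_bounded : exists M, forall x, cmod (convol x) <= M.
Proof.
pose I := (\int[la]_x (cmod (ceta x))%:E)%E.
have If : I \is a fin_num.
  have /cintegrableP[_ h] := ceta_int; rewrite ge0_fin_numE//.
  by apply: integral_ge0 => x _; rewrite lee_fin cmod_ge0.
exists (2 * (B * fine I)) => x; rewrite -lee_fin.
apply: (le_trans (cmod_cintegral_le (conv_int x))).
rewrite EFinM; apply: lee_pmul => //.
  by apply: integral_ge0 => y _; rewrite lee_fin cmod_ge0.
rewrite EFinM fineK// -ge0_integralZl//; last 2 first.
- by apply/measurable_EFinP; exact: cmeasurable_cmod.
- by move=> y _; rewrite lee_fin cmod_ge0.
apply: ge0_le_integral => //.
- by move=> y _; rewrite lee_fin cmod_ge0.
- exact: measurable_int (cintegrable_cmod (conv_int x)).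
- by apply: measurable_funeM; apply/measurable_EFinP; exact: cmeasurable_cmod.
- by move=> y _; rewrite -EFinM lee_fin cmodM mulrC ler_wpM2r ?cmod_ge0.
Qed.

Lemma conv_test_function : test_function convol.
Proof.
split; [exact: cmeasurable_conv|exact: conv_bounded|].
apply: bounded_closure_compact; exists (r + delta) => x /=.
by move=> /eqP cx; apply: contrapT => /conv_supp.
Qed.

Lemma fourier_conv k : fourier convol k = fourier ceta k * fourier f k.
Proof.
have mF : cmeasurable (fun z : rV * rV => echar k z.1 * (ceta z.2 * f (z.1 - z.2))).
  apply: cmeasurableM => //.
  exact: (cmeasurable_comp (cmeasurable_echar k) measurable_fst).
rewrite fourierE.
transitivity (cintegral la (fun x => cintegral la
    (fun y => echar k x * (ceta y * f (x - y))))).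
  by congr cintegral; apply/funext => x; rewrite cintegralZl.
rewrite (cfubini mF).
  transitivity (cintegral la (fun y => fourier f k * (echar k y * ceta y))).
    congr cintegral; apply/funext => y /=.
    have fi := cintegrable_echarM k f_int.
    have [i1 e1] := @cintegral_translate R n (- y) _ fi.
    transitivity (cintegral la (fun x => (echar k y * ceta y) *
      (echar k (x - y) * f (x - y)))).
      congr cintegral; apply/funext => x.
      have -> : echar k x = echar k (x - y) * echar k y by rewrite -echarD subrK.
      by ring.
    by rewrite cintegralZl// e1 -fourierE mulrC.
  rewrite cintegralZl; first by rewrite mulrC.
  exact: cintegrable_echarM.
have m0 : measurable_fun setT (fun z : rV * rV =>
    (cmod (echar k z.1 * (ceta z.2 * f (z.1 - z.2))))%:E).
  by apply/measurable_EFinP; exact: cmeasurable_cmod.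
have p0 (z : rV * rV) : (0 <= (cmod (echar k z.1 * (ceta z.2 * f (z.1 - z.2))))%:E)%E.
  by rewrite lee_fin cmod_ge0.
rewrite (@fubini_tonelli _ _ _ _ _ la la _ m0 p0) /=.
have /cintegrableP[_ If] := f_int.
have /cintegrableP[_ Ic] := ceta_int.
have mc0 : measurable_fun setT (fun x => (cmod (f x))%:E).
  by apply/measurable_EFinP; exact: cmeasurable_cmod.
have mc1 : measurable_fun setT (fun x => (cmod (ceta x))%:E).
  by apply/measurable_EFinP; exact: cmeasurable_cmod.
have c0 (z : R[i]) : (0 <= (cmod z)%:E)%E by rewrite lee_fin cmod_ge0.
rewrite (_ : (\int[la]_y _)%E = (\int[la]_y ((cmod (ceta y))%:E *
   \int[la]_x (cmod (f x))%:E))%E); last first.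
  apply: eq_integral => y _.
  rewrite -(@ge0_integral_translate R n (- y) (fun x => (cmod (f x))%:E))//.
  rewrite -ge0_integralZl//; last exact: (measurable_translate y mc0).
  by apply: eq_integral => x _; rewrite !cmodM cmod_echar mul1r EFinM.
rewrite ge0_integralZr//; last exact: integral_ge0.
rewrite lte_mul_pinfty// ?integral_ge0// ge0_fin_numE// integral_ge0//.
Qed.

(** As [eta] has integral 1, [convol x - f x] is the integral over y of [eta y] times f (x - y) - f
    x; Tonelli then averages the translation errors of [f] over the support of [eta]. *)
Lemma conv_dist (e : R) : 0 <= e -> (\int[la]_x (eta x)%:E = 1)%E ->
  (forall y, enorm y < delta -> (\int[la]_x (cmod (f (x - y) - f x))%:E <= e%:E)%E) ->
  (\int[la]_x (cmod (convol x - f x))%:E <= (2 * e)%:E)%E.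
Proof.
move=> e0 eta1 fe.
have c0 (z : R[i]) : (0 <= (cmod z)%:E)%E by rewrite lee_fin cmod_ge0.
have cm d (T : measurableType d) (g : T -> R[i]) : cmeasurable g ->
    measurable_fun setT (fun t => (cmod (g t))%:E).
  by move=> mg; apply/measurable_EFinP; exact: cmeasurable_cmod.
pose D (z : rV * rV) : R[i] := ceta z.2 * (f (z.1 - z.2) - f z.1).
have mD : cmeasurable D.
  apply: cmeasurableM; first exact: (cmeasurable_comp mceta measurable_snd).
  apply: cmeasurableB; first exact: (cmeasurable_comp mf msub).
  exact: (cmeasurable_comp mf measurable_fst).
have convE x : convol x - f x = cintegral la (fun y => D (x, y)).
  have ci : cintegrable la (fun y => ceta y * f x).
    by under eq_fun do rewrite mulrC; exact: cintegrableZl.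
  rewrite /convol {1}(_ : f x = cintegral la (fun y => ceta y * f x)).
    rewrite -cintegralB//; congr cintegral; apply/funext => y.
    by rewrite /D /= mulrBr.
  under [X in cintegral _ X]eq_fun do rewrite mulrC.
  rewrite cintegralZl// (_ : cintegral la ceta = 1) ?mulr1//.
  by apply: eqc => /=; rewrite /Rintegral ?eta1 ?integral0.
apply: (@le_trans _ _ (2%:E * \int[la]_x \int[la]_y (cmod (D (x, y)))%:E)%E).
  have mI : measurable_fun setT (fun x => \int[la]_y (cmod (D (x, y)))%:E)%E.
    exact: (@measurable_fun_fubini_tonelli_F _ _ _ _ _ la (fun z => (cmod (D z))%:E) (cm _ _ _ mD)).
  rewrite -ge0_integralZl//; last by move=> x _; exact: integral_ge0.
  apply: ge0_le_integral => //.
  - by apply: cm; apply: cmeasurableB => //; exact: cmeasurable_conv.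
  - exact: measurable_funeM.
  - move=> x _; rewrite convE; apply: cmod_cintegral_le.
    rewrite (_ : (fun y => _) = (fun y => ceta y * f (x - y) - f x * ceta y)).
      by apply: cintegrableB => //; exact: cintegrableZl.
    by apply/funext => y; rewrite /D /=; ring.
rewrite (@fubini_tonelli _ _ _ _ _ la la (fun z => (cmod (D z))%:E) (cm _ _ _ mD))//.
rewrite EFinM; apply: lee_pmul => //; first by apply: integral_ge0 => y _; exact: integral_ge0.
apply: (@le_trans _ _ (\int[la]_y ((eta y)%:E * e%:E))%E).
  apply: ge0_le_integral => //.
  - by move=> y _; exact: integral_ge0.
  - exact: (@measurable_fun_fubini_tonelli_G _ _ _ _ _ la (fun z => (cmod (D z))%:E) (cm _ _ _ mD)).
  - by apply: emeasurable_funM => //; exact/measurable_EFinP.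
  - move=> y _; have /andP[e1 e2] := eta0 y.
    have [yd|/eta_supp e3] := pselect (eball delta y); last first.
      rewrite e3 mul0e /D /ceta /= e3.
      by rewrite integral0_eq// => x _; rewrite mul0r cmod0.
    rewrite (_ : (\int[la]_x _)%E = ((eta y)%:E * \int[la]_x (cmod (f (x - y) - f x))%:E)%E).
      by apply: lee_pmul => //; [exact: integral_ge0|exact: fe].
    rewrite -ge0_integralZl//; last first.
      apply: cm; apply: cmeasurableB => //; apply: (cmeasurable_comp mf).
      exact: (measurable_translate (u := idfun) y (@measurable_id _ _ _)).
    by apply: eq_integral => x _; rewrite /D /= cmodM cmodR ger0_norm// EFinM.
rewrite ge0_integralZr//.
- by rewrite eta1 mul1e.
- exact/measurable_EFinP.
- by move=> x _; rewrite lee_fin; have /andP[] := eta0 x.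
Qed.

End convolution.
End fourier_transform.

(** * Variance and spectral measure *)

Section variance.
Context d (T : measurableType d) (R : realType) (P : probability T R).
Implicit Types X : T -> R[i].

Lemma integrable_sqr_cmod (mu : {measure set T -> \bar R}) X : cmeasurable X ->
  (\int[mu]_w ((cmod (X w)) ^+ 2)%:E < +oo)%E ->
  mu.-integrable setT (fun w => ((cmod (X w)) ^+ 2)%:E).
Proof.
move=> mX X2; apply/integrableP; split.
  by apply/measurable_EFinP; apply: measurable_funX; exact: cmeasurable_cmod.
by under eq_integral do rewrite gee0_abs ?lee_fin ?sqr_ge0//.
Qed.

Lemma measurable_sqr_cmod X : cmeasurable X ->
  measurable_fun setT (fun w => ((cmod (X w)) ^+ 2)%:E).
Proof.
by move=> mX; apply/measurable_EFinP; apply: measurable_funX; exact: cmeasurable_cmod.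
Qed.

Lemma sqr_cmod_integral_le (mu : {measure set T -> \bar R}) X Y :
  cmeasurable X -> cmeasurable Y ->
  (\int[mu]_w ((cmod (X w)) ^+ 2)%:E <=
   2%:E * \int[mu]_w ((cmod (Y w)) ^+ 2)%:E +
   2%:E * \int[mu]_w ((cmod (X w - Y w)) ^+ 2)%:E)%E.
Proof.
move=> mX mY; have mXY := cmeasurableB mX mY.
have s0 (z : R[i]) : (0 <= (cmod z ^+ 2)%:E)%E by rewrite lee_fin sqr_ge0.
rewrite -!ge0_integralZl//; try exact: measurable_sqr_cmod.
rewrite -ge0_integralD//; try (by move=> w _; rewrite mule_ge0);
  try (by apply: measurable_funeM; exact: measurable_sqr_cmod).
apply: ge0_le_integral => //.
- exact: measurable_sqr_cmod.
- by apply: emeasurable_funD; apply: measurable_funeM; exact: measurable_sqr_cmod.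
- move=> w _; rewrite -!EFinM -EFinD lee_fin.
  have {1}-> : X w = Y w + (X w - Y w) by rewrite addrC subrK.
  exact: sqr_cmodD.
Qed.

Lemma integral_probability_cst (r : R) : (\int[P]_w r%:E = r%:E)%E.
Proof. by rewrite integral_cst// [X in (_ * X)%E]probability_setT mule1. Qed.

Lemma sqr_integrable_cintegrable X : cmeasurable X ->
  (\int[P]_w ((cmod (X w)) ^+ 2)%:E < +oo)%E -> cintegrable P X.
Proof.
move=> mX X2; apply: (@le_cintegrable _ _ _ _ _ (fun w => 1 + (cmod (X w)) ^+ 2)) => //.
  by move=> w; have := sqr_ge0 (cmod (X w) - 1); nra.
have := integrableD measurableT (finite_measure_integrable_cst P 1 measurableT)
  (integrable_sqr_cmod mX X2).
exact.
Qed.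

Lemma integral_centered X : cmeasurable X ->
  (\int[P]_w ((cmod (X w)) ^+ 2)%:E < +oo)%E ->
  (\int[P]_w ((cmod (X w - cintegral P X)) ^+ 2)%:E =
   \int[P]_w ((cmod (X w)) ^+ 2)%:E - ((cmod (cintegral P X)) ^+ 2)%:E)%E.
Proof.
move=> mX X2; have [Xr Xi] := sqr_integrable_cintegrable mX X2.
have X2i := integrable_sqr_cmod mX X2.
set m := cintegral P X; pose a := complex.Re m; pose b := complex.Im m.
have ai : P.-integrable setT (fun w => (2 * a * complex.Re (X w))%:E).
  exact: (integrableZl measurableT (2 * a) Xr).
have bi : P.-integrable setT (fun w => (2 * b * complex.Im (X w))%:E).
  exact: (integrableZl measurableT (2 * b) Xi).
have ci : P.-integrable setT (EFin \o cst (a ^+ 2 + b ^+ 2)).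
  exact: finite_measure_integrable_cst.
have -> : (\int[P]_w ((cmod (X w)) ^+ 2)%:E = (\int[P]_w (cmod (X w) ^+ 2))%:E)%E.
  by rewrite /Rintegral fineK//; exact: integrable_fin_num.
have Yi : P.-integrable setT (fun w => ((cmod (X w - m)) ^+ 2)%:E).
  apply: integrable_sqr_cmod; first by apply: cmeasurableB => //; exact: cmeasurable_cst.
  have := sqr_cmod_integral_le P (cmeasurableB mX (cmeasurable_cst _ m)) mX.
  move/le_lt_trans; apply; apply: lte_add_pinfty; apply: lte_mul_pinfty => //.
  under eq_integral => w _.
    rewrite (_ : X w - m - X w = - m); last by ring.
    over.
  by rewrite integral_probability_cst ltry.
have -> : (\int[P]_w ((cmod (X w - m)) ^+ 2)%:E = (\int[P]_w (cmod (X w - m) ^+ 2))%:E)%E.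
  by rewrite /Rintegral fineK//; exact: integrable_fin_num.
rewrite -EFinB; congr EFin.
have E w : cmod (X w - m) ^+ 2 = (cmod (X w) ^+ 2 - 2 * a * complex.Re (X w)) -
    (2 * b * complex.Im (X w) - (a ^+ 2 + b ^+ 2)).
  by rewrite !cmod_sqr ReB ImB /a /b; ring.
under eq_Rintegral do rewrite E.
rewrite RintegralB//; last 2 first.
- exact: (integrableB measurableT X2i ai).
- exact: (integrableB measurableT bi ci).
rewrite RintegralB// RintegralB// !RintegralZl// Rintegral_cst//.
have P1 : fine (P setT) = 1 by rewrite probability_setT.
rewrite P1 mulr1.
by rewrite cmod_sqr -[complex.Re m]/a -[complex.Im m]/b
  -[\int[P]_x complex.Re (X x)]/a -[\int[P]_x complex.Im (X x)]/b; ring.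
Qed.

(** When the second moment is infinite, so is the centred one, since constants are square integrable
    for a probability. The formula thus applies before square integrability is known. *)
Lemma cvariance_centered X : cintegrable P X ->
  cvariance P X = (\int[P]_w ((cmod (X w - cintegral P X)) ^+ 2)%:E)%E.
Proof.
move=> Xi; have mX := cintegrable_cmeasurable Xi; rewrite /cvariance.
have [X2|] := ltP (\int[P]_w ((cmod (X w)) ^+ 2)%:E)%E +oo%E.
  by rewrite integral_centered.
rewrite leye_eq => /eqP X2; rewrite X2 addye//.
set m := cintegral P X.
have [f|] := ltP (\int[P]_w ((cmod (X w - m)) ^+ 2)%:E)%E +oo%E; last first.
  by rewrite leye_eq => /eqP ->.
have : (+oo < +oo :> \bar R)%E; last by rewrite ltxx.
rewrite -{1}X2.
apply: (le_lt_trans (sqr_cmod_integral_le P mX (cmeasurableB mX (cmeasurable_cst _ m)))).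
apply: lte_add_pinfty; apply: lte_mul_pinfty => //.
under eq_integral => w _.
  rewrite (_ : X w - (X w - m) = m); last by ring.
  over.
by rewrite integral_probability_cst ltry.
Qed.

End variance.

Lemma measurable_enorm_lt_translate (R : realType) n (k : 'rV[R]_n) (r : R) :
  measurable ((fun y : 'rV[R]_n => y - k) @^-1` eball r).
Proof.
rewrite -[X in measurable X]setTI.
have : measurable_fun setT (fun y : 'rV[R]_n => y - k).
  by have := measurable_fun_affine 1 (- k); under eq_fun do rewrite scale1r.
by apply => //; exact: measurable_enorm_lt.
Qed.

Lemma cos_ge_cos1 (R : realType) (x : R) : `|x| <= 1 -> cos 1 <= cos x.
Proof.
move=> x1; have p2 := @pi_ge2 R.
have i1 : `|x| \in `[0, pi] by rewrite in_itv /= normr_ge0 /=; lra.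
have i2 : (1 : R) \in `[0, pi] by rewrite in_itv /= ler01 /=; lra.
by rewrite -[cos x]cos_norm leNgt (ltr_cos i2 i1) -leNgt.
Qed.

(** * The spectral formula for test functions *)

Section test_functions.
Context {R : realType} {n : nat} {d : measure_display} {Omega : measurableType d}.
Local Notation rV := 'rV[R]_n.
Local Notation la := (@lebesgue_rV R n).
Variables (P : probability Omega R) (Phi : Omega -> set rV -> R[i]).
Variable M : Omega -> {measure set rV -> \bar R}.
Hypothesis M_lf : forall w, locally_finite (M w).
Hypothesis M2 : forall A, measurable A -> bounded_rV A ->
      (\int[P]_w ((fine (M w A)) ^+ 2)%:E < +oo)%E.
Hypothesis mI : forall f, cmeasurable f -> cmeasurable (fun w => cm_integral (Phi w) f).
Hypothesis IB : forall w f g, cintegrable (M w) f -> cintegrable (M w) g ->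
        cm_integral (Phi w) (fun x => f x - g x) =
        cm_integral (Phi w) f - cm_integral (Phi w) g.
Hypothesis I_le : forall w f, cintegrable (M w) f ->
   ((cmod (cm_integral (Phi w) f))%:E <= 2%:E * \int[M w]_x (cmod (f x))%:E)%E.
Hypothesis mM : forall g : rV -> \bar R, measurable_fun setT g ->
  (forall x, 0 <= g x)%E -> measurable_fun setT (fun w => \int[M w]_x g x)%E.
Variable beta : {measure set rV -> \bar R}.
Hypothesis hbeta : is_bartlett_measure P Phi beta.
Implicit Types f g : rV -> R[i].

Lemma test_function_bounds g : test_function g -> exists a b : R,
  [/\ 0 <= b, forall x, cmod (g x) <= b & forall x, ~ eball a x -> g x = 0].
Proof.
move=> [mg [b gb] /compact_bounded_rV[a ga]]; exists a, b; split => //.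
  exact: le_trans (cmod_ge0 _) (gb 0).
move=> x xa; apply: contrapT => /eqP gx; apply: xa; apply: ga.
exact: subset_closure.
Qed.

Lemma bounded_support_test g (a b : R) : cmeasurable g ->
  (forall x, cmod (g x) <= b) -> (forall x, ~ eball a x -> g x = 0) ->
  test_function g.
Proof.
move=> mg gb ga; split => //; first by exists b.
apply: bounded_closure_compact; exists a => x /= /eqP gx.
by apply: contrapT => /ga.
Qed.

Lemma test_functionB f g : test_function f -> test_function g ->
  test_function (fun x => f x - g x).
Proof.
move=> tf tg; have [a [b [b0 fb fa]]] := test_function_bounds tf.
have [a' [b' [b'0 gb ga]]] := test_function_bounds tg.
have [mf _ _] := tf; have [mg _ _] := tg.
apply: (@bounded_support_test _ (Num.max a a') (b + b')).
- exact: cmeasurableB.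
- by move=> x; rewrite (le_trans (cmodB _ _))// lerD.
- move=> x xa; rewrite fa ?ga ?subrr// => h; apply: xa;
    by apply: eball_sub h; rewrite le_max lexx ?orbT.
Qed.

Lemma test_cintegrable (m : {measure set rV -> \bar R}) g : locally_finite m ->
  test_function g -> cintegrable m g.
Proof.
move=> mlf tg; have [a [b [b0 gb ga]]] := test_function_bounds tg.
have [mg _ _] := tg; apply/cintegrableP; split => //.
have mE := @measurable_enorm_lt R n a.
apply: (@le_lt_trans _ _ (\int[m]_x (b%:E * (\1_(eball a : set rV) x)%:E))%E).
  apply: ge0_le_integral => //.
  - by move=> x _; rewrite lee_fin cmod_ge0.
  - by apply/measurable_EFinP; exact: cmeasurable_cmod.
  - by apply: measurable_funeM; apply/measurable_EFinP; exact: measurable_indic.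
  - move=> x _; rewrite indicE -EFinM lee_fin; case: (boolP (x \in _)) => xa.
      by rewrite mulr1.
    by rewrite ga ?cmod0 ?mulr0// => h; case/negP: xa; rewrite inE.
rewrite ge0_integralZl//; last by apply/measurable_EFinP; exact: measurable_indic.
rewrite integral_indic// setIT; apply: lte_mul_pinfty => //.
by apply: mlf => //; exact: bounded_eball.
Qed.

Lemma cm_integral_sqr_le g (a b : R) : 0 <= b -> cmeasurable g ->
  (forall x, cmod (g x) <= b) -> (forall x, ~ eball a x -> g x = 0) ->
  (\int[P]_w ((cmod (cm_integral (Phi w) g)) ^+ 2)%:E <=
   ((2 * b) ^+ 2)%:E * \int[P]_w ((fine (M w (eball a))) ^+ 2)%:E)%E.
Proof.
move=> b0 mg gb ga; have tg := bounded_support_test mg gb ga.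
have mE := @measurable_enorm_lt R n a.
have bE := @bounded_eball R n a.
have I1 w : cmod (cm_integral (Phi w) g) <= 2 * b * fine (M w (eball a)).
  have gi := test_cintegrable (M_lf w) tg.
  rewrite -lee_fin; apply: (le_trans (I_le gi)).
  rewrite -mulrA EFinM; apply: lee_pmul => //.
    by apply: integral_ge0 => x _; rewrite lee_fin cmod_ge0.
  have -> : (b * fine (M w (eball a)))%:E = (\int[M w]_x (b%:E * (\1_(eball a : set rV) x)%:E))%E.
    rewrite ge0_integralZl//; last by apply/measurable_EFinP; exact: measurable_indic.
    rewrite integral_indic// setIT EFinM fineK// ge0_fin_numE//.
    exact: M_lf.
  apply: ge0_le_integral => //.
  - by move=> x _; rewrite lee_fin cmod_ge0.
  - by apply/measurable_EFinP; exact: cmeasurable_cmod.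
  - by apply: measurable_funeM; apply/measurable_EFinP; exact: measurable_indic.
  - move=> x _; rewrite indicE -EFinM lee_fin; case: (boolP (x \in _)) => xa.
      by rewrite mulr1.
    by rewrite ga ?cmod0 ?mulr0// => h; case/negP: xa; rewrite inE.
have mMB : measurable_fun setT (fun w => M w (eball a)).
  rewrite (_ : (fun w => _) = (fun w => \int[M w]_x (\1_(eball a : set rV) x)%:E)%E).
    by apply: mM => //; apply/measurable_EFinP; exact: measurable_indic.
  by apply/funext => w; rewrite integral_indic// setIT.
have mf2 : measurable_fun setT (fun w => ((fine (M w (eball a))) ^+ 2)%:E).
  by apply/measurable_EFinP; apply: measurable_funX; exact: measurableT_comp.
rewrite -ge0_integralZl//; last by rewrite lee_fin sqr_ge0.
apply: ge0_le_integral => //.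
- by move=> w _; rewrite lee_fin sqr_ge0.
- by apply: measurable_sqr_cmod; exact: mI.
- exact: measurable_funeM.
- move=> w _; rewrite -EFinM lee_fin -exprMn ler_sqr ?nnegrE ?cmod_ge0//.
  by rewrite !mulr_ge0// fine_ge0.
Qed.

Lemma test_sqr_integrable g : test_function g ->
  (\int[P]_w ((cmod (cm_integral (Phi w) g)) ^+ 2)%:E < +oo)%E.
Proof.
move=> tg; have [a [b [b0 gb ga]]] := test_function_bounds tg.
have [mg _ _] := tg; apply: (le_lt_trans (cm_integral_sqr_le b0 mg gb ga)).
rewrite lte_mul_pinfty ?lee_fin ?sqr_ge0//; apply: M2.
  exact: measurable_enorm_lt.
exact: bounded_eball.
Qed.

Definition spectral_const : R := (2 * pi) ^+ n.

Lemma spectral_const_gt0 : 0 < spectral_const.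
Proof. by rewrite exprn_gt0// mulr_gt0// pi_gt0. Qed.

(** The diagonal case of the defining covariance formula, in which both sides are real and finite;
    every later appeal to that formula goes through this case. *)
Lemma test_variance g : test_function g ->
  let X w := cm_integral (Phi w) g in
  (\int[beta]_k ((cmod (fourier g k)) ^+ 2)%:E =
   spectral_const%:E * \int[P]_w ((cmod (X w - cintegral P X)) ^+ 2)%:E)%E.
Proof.
move=> tg X; have [mg _ _] := tg.
have mX : cmeasurable X by exact: mI.
have X2 : (\int[P]_w ((cmod (X w)) ^+ 2)%:E < +oo)%E by exact: test_sqr_integrable.
have [bi] := hbeta.2 g g tg tg; rewrite /ccovariance.
have -> : (fun w => cm_integral (Phi w) g * (cm_integral (Phi w) g)^*%C) =
    (fun w => (cmod (X w) ^+ 2)%:C) by apply/funext => w; rewrite mulcJ.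
have gE : (fun k => fourier g k * (fourier g k)^*%C) =
    (fun k => (cmod (fourier g k) ^+ 2)%:C) by apply/funext => w; rewrite mulcJ.
rewrite gE in bi *; rewrite mulcJ => /(congr1 (@complex.Re R)).
have c2 : 0 < (2 * pi : R) ^+ n := spectral_const_gt0.
rewrite ReB Re_mulc /= mul0r subr0 => E.
have bfin : (\int[beta]_k ((cmod (fourier g k)) ^+ 2)%:E)%E \is a fin_num.
  by apply: integrable_fin_num => //; exact: bi.1.
have Pfin : (\int[P]_w ((cmod (X w)) ^+ 2)%:E)%E \is a fin_num.
  by apply: integrable_fin_num => //; exact: integrable_sqr_cmod.
rewrite integral_centered// -(fineK bfin) -(fineK Pfin) -EFinB -EFinM.
congr EFin; rewrite -[fine (integral P _ _)]/(\int[P]_w (cmod (X w) ^+ 2)).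
rewrite [_ - _]E /spectral_const mulrA mulfV ?gt_eqF// mul1r//.
Qed.

(* Tested on the modulated indicator x |-> e^(i<k, x>) 1_B1(x), whose Fourier
   transform is bounded below on k + B1. *)
Lemma spectral_translate_bounded : exists2 C : R, 0 <= C & forall k,
  (beta ((fun y => (y - k)%R) @^-1` eball 1%R) <= C%:E)%E.
Proof.
pose Q : set rV := eball 1.
have mQ : measurable Q by exact: measurable_enorm_lt.
have laQf : la Q \is a fin_num by exact: lebesgue_eball_fin.
have q0 : 0 < fine (la Q).
  by rewrite fine_gt0// lebesgue_eball_gt0//= ltey_eq laQf.
(* For k' in k + B1 and x in B1 the phase <k' - k, x> has modulus at most 1, so the transform at k'
   has real part at least cos 1 times the volume of B1. The modulus of the modulated indicator does
   not depend on k, hence neither does the resulting bound. *)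
pose q := cos 1 * fine (la Q).
have q20 : 0 < q by rewrite mulr_gt0// cos1_gt0.
have M2f : (\int[P]_w ((fine (M w Q)) ^+ 2)%:E)%E \is a fin_num.
  rewrite ge0_fin_numE; first by apply: M2 => //; exact: bounded_eball.
  by apply: integral_ge0 => w _; rewrite lee_fin sqr_ge0.
pose m2 := fine (\int[P]_w ((fine (M w Q)) ^+ 2)%:E)%E.
have m20 : 0 <= m2 by rewrite fine_ge0// integral_ge0// => w _; rewrite lee_fin sqr_ge0.
have s0 := spectral_const_gt0.
exists ((q ^+ 2)^-1 * (spectral_const * (4 * m2))).
  by rewrite !mulr_ge0 ?invr_ge0 ?sqr_ge0// ltW.
move=> k; set D := _ @^-1` _.
have mD : measurable D by exact: (measurable_enorm_lt_translate k).
pose ind x : R[i] := (\1_Q x)%:C.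
pose g x := echar (- k) x * ind x.
have mind : cmeasurable ind by apply: cmeasurable_real; exact: measurable_indic.
have mg : cmeasurable g by apply: cmeasurableM => //; exact: cmeasurable_echar.
have gb x : cmod (g x) <= 1.
  rewrite cmodM cmod_echar mul1r cmodR indicE.
  by case: (_ \in _); rewrite ?normr1 ?normr0.
have ga x : ~ eball 1 x -> g x = 0.
  by move=> xQ; rewrite /g /ind indicE memNset// mulr0.
have tg := bounded_support_test mg gb ga.
have indi : cintegrable la ind.
  apply: test_cintegrable; first exact: lebesgue_locally_finite.
  apply: (@bounded_support_test _ 1 1) => //.
  - by move=> x; rewrite cmodR indicE; case: (_ \in _); rewrite ?normr1 ?normr0.
  - by move=> x xQ; rewrite /ind indicE memNset.
have low k' : D k' -> q <= cmod (fourier g k').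
  move=> Dk'; rewrite fourier_modulation.
  apply: le_trans (Re_le_cmod _); apply: le_trans (ler_norm _).
  have [ri _] := cintegrable_echarM (k' - k) indi.
  rewrite /=.
  have hQ : la.-integrable setT (fun x => (\1_Q x)%:E) by exact: indi.1.
  have hi : la.-integrable setT (fun x => (cos 1 * \1_Q x)%:E).
    exact: (integrableZl measurableT (cos 1) hQ).
  have -> : q = \int[la]_x (cos 1 * \1_Q x).
    rewrite RintegralZl//.
    by rewrite /q; congr (_ * _); rewrite /Rintegral integral_indic// setIT.
  apply: le_Rintegral => // x _ /=.
  rewrite indicE mulr0 subr0; case: (boolP (x \in Q)) => xQ; last by rewrite !mulr0.
  rewrite !mulr1; apply: cos_ge_cos1.
  rewrite inE in xQ; apply: (le_trans (dotp_le _ _)).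
  rewrite -[leRHS]mulr1; apply: ler_pM; rewrite ?enorm_ge0//; apply: ltW => //.
have b1 : ((q ^+ 2)%:E * beta D <= \int[beta]_k ((cmod (fourier g k)) ^+ 2)%:E)%E.
  have mfg : cmeasurable (fourier g) by exact: cmeasurable_fourier.
  have -> : ((q ^+ 2)%:E * beta D = \int[beta]_k ((q ^+ 2)%:E * (\1_D k)%:E))%E.
    rewrite ge0_integralZl//; last 2 first.
    - by apply/measurable_EFinP; exact: measurable_indic.
    - by rewrite lee_fin sqr_ge0.
    by rewrite integral_indic// setIT.
  apply: ge0_le_integral => //.
  - by move=> k' _; rewrite -EFinM lee_fin mulr_ge0// sqr_ge0.
  - by apply: measurable_funeM; apply/measurable_EFinP; exact: measurable_indic.
  - exact: measurable_sqr_cmod.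
  - move=> k' _; rewrite -EFinM lee_fin indicE; case: (boolP (k' \in D)) => kD.
      rewrite inE in kD; have := low _ kD.
      by rewrite mulr1 => h; rewrite ler_sqr ?nnegrE ?cmod_ge0// (ltW q20).
    by rewrite mulr0 sqr_ge0.
have b2 : (\int[beta]_k ((cmod (fourier g k)) ^+ 2)%:E <= (spectral_const * (4 * m2))%:E)%E.
  rewrite test_variance// EFinM; apply: lee_pmul; rewrite ?lee_fin ?(ltW s0)//.
    by apply: integral_ge0 => w _; rewrite lee_fin sqr_ge0.
  rewrite integral_centered; [|exact: mI|exact: test_sqr_integrable].
  apply: (@le_trans _ _ (\int[P]_w ((cmod (cm_integral (Phi w) g)) ^+ 2)%:E)%E).
    by rewrite leeBlDr// leeDl// lee_fin sqr_ge0.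
  apply: (le_trans (cm_integral_sqr_le ler01 mg gb ga)).
  by rewrite mulr1 [X in (_ <= X)%E]EFinM /m2 (fineK M2f) (_ : (2:R) ^+ 2 = 4)//; rewrite expr2 -natrM.
have q2 : 0 < q ^+ 2 by rewrite exprn_gt0.
have -> : beta D = (((q ^+ 2)^-1)%:E * ((q ^+ 2)%:E * beta D))%E.
  by rewrite muleA -EFinM mulVf ?mul1e// lt0r_neq0.
rewrite [X in (_ <= X)%E]EFinM; apply: lee_pmul; rewrite ?lee_fin ?invr_ge0 ?sqr_ge0//.
  by rewrite mule_ge0// lee_fin sqr_ge0.
exact: (le_trans b1 b2).
Qed.

End test_functions.

Lemma cvg_ereal_small (R : realType) (u : nat -> \bar R) (e : R) :
  u k @[k --> \oo] --> 0%E -> 0 < e -> \forall k \near \oo, (u k <= e%:E)%E.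
Proof.
move=> /fine_cvgP[fin /cvgrPdist_lt lim0] e0.
apply: filterS2 fin (lim0 _ e0) => k /= h1; rewrite sub0r normrN => h2.
by rewrite -(fineK h1) lee_fin (le_trans (ler_norm _))// ltW.
Qed.

(** * Mollified truncations *)

Section approximation.
Context {R : realType} {n : nat}.
Local Notation rV := 'rV[R]_n.
Local Notation la := (@lebesgue_rV R n).
Implicit Types f g : rV -> R[i].

Let Q : set rV := eball 1.
Let q : R := fine (la Q).

Let mQ : measurable Q. Proof. exact: measurable_enorm_lt. Qed.

Let q0 : 0 < q.
Proof.
rewrite /q fine_gt0// lebesgue_eball_gt0//= ltey_eq.
by rewrite lebesgue_eball_fin.
Qed.

Definition ball_kernel (x : rV) : R := q^-1 * \1_Q x.
Definition mollifier (delta : R) (x : rV) : R := delta ^- n * ball_kernel (delta^-1 *: x).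
(** At scale [delta] the transform of the mollifier is [mollifier_symbol (delta *: k)]; it has
    modulus at most 2 and tends to 1 as [delta] tends to 0. *)
Definition mollifier_symbol (k : rV) : R[i] := fourier (fun x => (ball_kernel x)%:C) k.

Let mker : measurable_fun setT ball_kernel.
Proof. by apply: measurable_funM => //; exact: measurable_indic. Qed.

Let ker_ge0 x : 0 <= ball_kernel x.
Proof. by rewrite mulr_ge0// invr_ge0 ltW. Qed.

Let ker_int1 : (\int[la]_x (ball_kernel x)%:E = 1)%E.
Proof.
under eq_integral do rewrite EFinM.
rewrite ge0_integralZl//; last 2 first.
- by apply/measurable_EFinP; exact: measurable_indic.
- by rewrite lee_fin invr_ge0 ltW.
rewrite integral_indic// setIT.
transitivity ((q^-1)%:E * q%:E)%E.
  by congr (_ * _)%E; rewrite /q fineK// lebesgue_eball_fin.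
by rewrite -EFinM mulVf// gt_eqF.
Qed.

Let mscal (r : R) : measurable_fun setT (fun x : rV => r *: x).
Proof. by have := @measurable_fun_affine R n r 0; under eq_fun do rewrite addr0. Qed.

Lemma measurable_mollifier delta : measurable_fun setT (mollifier delta).
Proof.
apply: measurable_funM => //; exact: (measurableT_comp mker (mscal delta^-1)).
Qed.

Section positive_delta.
Variable delta : R.
Hypothesis d0 : 0 < delta.

Let dn0 : 0 < delta ^- n. Proof. by rewrite invr_gt0 exprn_gt0. Qed.

Lemma mollifier_bounds x : 0 <= mollifier delta x <= delta ^- n * q^-1.
Proof.
rewrite /mollifier mulr_ge0 ?(ltW dn0)//= ler_wpM2l ?(ltW dn0)//.
rewrite /ball_kernel indicE; case: (_ \in _); rewrite ?mulr1// mulr0 invr_ge0 ltW//.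
Qed.

Lemma mollifier_supp x : ~ eball delta x -> mollifier delta x = 0.
Proof.
move=> xd; rewrite /mollifier /ball_kernel indicE memNset ?mulr0//.
rewrite /Q /eball /= enormZ gtr0_norm ?invr_gt0// => h; apply: xd.
by rewrite /eball /=; rewrite ltr_pdivrMl// mulr1 in h.
Qed.

Lemma mollifier_int1 : (\int[la]_x (mollifier delta x)%:E = 1)%E.
Proof.
have di : 0 < delta^-1 by rewrite invr_gt0.
have mk : measurable_fun setT (EFin \o ball_kernel) by exact/measurable_EFinP.
under eq_integral do rewrite EFinM -[X in ball_kernel X]addr0.
rewrite ge0_integralZl//; last 3 first.
- apply/measurable_EFinP; apply: (measurableT_comp mker).
  exact: measurable_fun_affine.
- by move=> x _; rewrite lee_fin.
- by rewrite lee_fin ltW.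
rewrite (@ge0_integral_affine R n delta^-1 0 (EFin \o ball_kernel))//=.
by rewrite ker_int1 mule1 -EFinM exprVn invrK mulVf// gt_eqF// exprn_gt0.
Qed.

Lemma ball_kernel_cintegrable : cintegrable la (fun x => (ball_kernel x)%:C).
Proof.
apply: (@bounded_support_cintegrable R n _ 1 q^-1).
- by rewrite invr_ge0 ltW.
- exact: cmeasurable_real.
- move=> x; rewrite cmodR ger0_norm// /ball_kernel indicE.
  by case: (_ \in _); rewrite ?mulr1// mulr0 invr_ge0 ltW.
- by move=> x xQ; rewrite /ball_kernel indicE memNset ?mulr0.
Qed.

Lemma fourier_mollifier k :
  fourier (fun x => (mollifier delta x)%:C) k = mollifier_symbol (delta *: k).
Proof.
rewrite (_ : (fun x => _) = (fun x => (delta ^- n)%:C *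
   (ball_kernel (delta^-1 *: x))%:C)); last by apply/funext => x; rewrite rmorphM.
rewrite fourierZ; last exact: (cintegrable_dilation d0 ball_kernel_cintegrable).
rewrite (fourier_dilation _ d0 ball_kernel_cintegrable) mulrA -rmorphM.
by rewrite mulVf ?mul1r// gt_eqF// exprn_gt0.
Qed.

End positive_delta.

Lemma mollifier_symbol_le k : cmod (mollifier_symbol k) <= 2.
Proof.
rewrite -lee_fin; apply: (le_trans (fourier_le k ball_kernel_cintegrable)).
under eq_integral do rewrite cmodR ger0_norm//.
by rewrite ker_int1 mule1.
Qed.

Lemma mollifier_symbol0 : mollifier_symbol 0 = 1.
Proof.
rewrite /mollifier_symbol fourier0; apply: eqc => /=; rewrite /Rintegral.
  by rewrite ker_int1.
by rewrite integral0.
Qed.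

(** Cutting off both |x| and |f| makes [f0] bounded with bounded support, so that its convolution
    with a mollifier is a test function. *)
Lemma truncation f (e : R) : cintegrable la f -> 0 < e ->
  exists (f0 : rV -> R[i]) (B r : R), [/\ cmeasurable f0,
    forall x, cmod (f0 x) <= B, forall x, ~ eball r x -> f0 x = 0 &
    (\int[la]_x (cmod (f0 x - f x))%:E <= e%:E)%E].
Proof.
move=> fi e0; have mf := cintegrable_cmeasurable fi.
have mcf : measurable_fun setT (fun x => cmod (f x)) by exact: cmeasurable_cmod.
pose A m : set rV := eball m%:R `&` [set x | cmod (f x) < m%:R].
have mA m : measurable (A m).
  apply: measurableI; first exact: measurable_enorm_lt.
  have := mcf measurableT _ (measurable_itv `]-oo, (m%:R : R)[).
  by rewrite setTI; congr measurable; apply/seteqP; split => x /=; rewrite in_itv.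
pose g m x : R[i] := (\1_(A m) x)%:C * f x.
have mg m : cmeasurable (g m).
  by apply: cmeasurableM => //; apply: cmeasurable_real; exact: measurable_indic.
have [] := @dominated_convergence _ _ _ la setT measurableT
   (fun m x => (cmod (g m x - f x))%:E) (cst 0%E) (fun x => (cmod (f x))%:E).
- by move=> m; apply/measurable_EFinP; apply: cmeasurable_cmod; exact: cmeasurableB.
- exact: measurable_cst.
- apply: nearW => x _; apply: cvg_near_cst.
  have /= h1 : \forall m \near \oo, enorm x < m%:R by exact: nbhs_infty_gtr.
  have /= h2 : \forall m \near \oo, cmod (f x) < m%:R by exact: nbhs_infty_gtr.
  apply: filterS2 h1 h2 => m h1 h2.
  by rewrite /g indicE mem_set//= mul1r subrr cmod0.
- exact: cintegrable_cmod.
- apply: nearW => x m _; rewrite gee0_abs ?lee_fin ?cmod_ge0// /g indicE.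
  by case: (_ \in _); rewrite ?mul1r ?mul0r ?subrr ?cmod0 ?cmod_ge0// sub0r cmodN.
move=> _ _; rewrite [X in _ --> X]integral0_eq// => lim0.
have [m hm] := filter_ex (cvg_ereal_small lim0 e0).
exists (g m), m%:R, m%:R; split => //.
- move=> x; rewrite cmodM cmodR indicE; case: (boolP (x \in A m)).
    by rewrite inE => -[_ /= /ltW h]; rewrite normr1 mul1r.
  by rewrite normr0 mul0r.
- move=> x xm; rewrite /g indicE memNset ?mul0r// => -[xm' _]; exact: xm.
Qed.

Variable beta : {measure set rV -> \bar R}.
Hypothesis test_beta : forall g, test_function g ->
  (\int[beta]_k ((cmod (fourier g k)) ^+ 2)%:E < +oo)%E.

(** The scale [delta] is fixed first, for [f] itself. The truncation [f0] is chosen afterwards: its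
    transform is uniformly close to that of [f], which alone gives nothing in L^2([beta]), as [beta]
    may be infinite; but the error is multiplied by the transform of the mollifier, which is a test
    function, so that this transform lies in L^2([beta]). *)
Lemma test_approximation f (e : R) : cintegrable la f -> 0 < e ->
  (\int[beta]_k ((cmod (fourier f k)) ^+ 2)%:E < +oo)%E ->
  exists g, [/\ test_function g, (\int[la]_x (cmod (g x - f x))%:E <= e%:E)%E &
    (\int[beta]_k ((cmod (fourier g k - fourier f k)) ^+ 2)%:E <= e%:E)%E].
Proof.
move=> fi e0 f2; have mf := cintegrable_cmeasurable fi.
have mff : cmeasurable (fourier f) by exact: cmeasurable_fourier.
have e8 : 0 < e / 8 by rewrite divr_gt0.
have [d1 d10 hd1] := ctranslation_cont fi e8.
pose D (m : nat) : R := m.+1%:R^-1.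
have D0 m : 0 < D m by rewrite invr_gt0.
have msym : cmeasurable mollifier_symbol.
  exact: cmeasurable_fourier (cintegrable_cmeasurable ball_kernel_cintegrable).
have e4 : 0 < e / 4 by rewrite divr_gt0.
pose h m k := ((cmod (fourier f k * (mollifier_symbol (D m *: k) - 1))) ^+ 2)%:E : \bar R.
have hlim k : h m k @[m --> \oo] --> 0%E.
  apply/fine_cvgP; split; first exact: nearW.
  apply/cvgrPdist_le => eps eps0.
  have F1 : 0 < cmod (fourier f k) ^+ 2 + 1 by rewrite ltr_wpDl// sqr_ge0.
  pose t := Num.sqrt (eps / (cmod (fourier f k) ^+ 2 + 1)).
  have t0 : 0 < t by rewrite sqrtr_gt0 divr_gt0.
  have [delta dl0 hdl] := fourier_cont 0 ball_kernel_cintegrable t0.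
  have k1 : 0 < enorm k + 1 by rewrite ltr_wpDl// enorm_ge0.
  have dk0 : 0 < delta / (enorm k + 1) by rewrite divr_gt0.
  have := near_infty_natSinv_lt (PosNum dk0).
  apply: filterS => m /= hm; rewrite sub0r normrN ger0_norm ?sqr_ge0//.
  have : cmod (mollifier_symbol (D m *: k) - 1) <= t.
    rewrite -mollifier_symbol0; apply: hdl; rewrite subr0 enormZ gtr0_norm//.
    apply: (@le_lt_trans _ _ (D m * (enorm k + 1))).
      by rewrite ler_wpM2l ?lerDl// ltW.
    by rewrite -ltr_pdivlMr.
  move=> hs; rewrite [X in X <= _](_ : _ =
      cmod (fourier f k) ^+ 2 * cmod (mollifier_symbol (D m *: k) - 1) ^+ 2); last first.
    by rewrite -exprMn -cmodM.
  have hs2 : cmod (mollifier_symbol (D m *: k) - 1) ^+ 2 <= eps / (cmod (fourier f k) ^+ 2 + 1).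
    rewrite -(@sqr_sqrtr _ (eps / _)); last by rewrite ltW// divr_gt0.
    by rewrite ler_sqr ?nnegrE ?cmod_ge0// ltW.
  apply: (@le_trans _ _ ((cmod (fourier f k) ^+ 2 + 1) * (eps / (cmod (fourier f k) ^+ 2 + 1)))).
    by apply: ler_pM; rewrite ?sqr_ge0// lerDl.
  by rewrite mulrCA mulfV ?mulr1// gt_eqF.
have mh m : cmeasurable (fun k => fourier f k * (mollifier_symbol (D m *: k) - 1)).
  apply: cmeasurableM => //; apply: cmeasurableB; last exact: cmeasurable_cst.
  exact: (cmeasurable_comp msym (mscal (D m))).
(* The symbol has modulus at most 2, so its distance to 1 is at most 3, whence the factor 9 in the
   majorant. *)
have gi : beta.-integrable setT (fun k => (9 * cmod (fourier f k) ^+ 2)%:E).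
  exact: (integrableZl measurableT 9 (integrable_sqr_cmod mff f2)).
have [] := @dominated_convergence _ _ _ beta setT measurableT h (cst 0%E) _ _ _ _ gi.
- by move=> m; exact: measurable_sqr_cmod.
- exact: measurable_cst.
- by apply: nearW => k _; exact: hlim.
- apply: nearW => k m _; rewrite gee0_abs ?lee_fin ?sqr_ge0// cmodM exprMn mulrC.
  rewrite ler_wpM2r ?sqr_ge0//.
  have s3 : cmod (mollifier_symbol (D m *: k) - 1) <= 3.
    apply: (le_trans (cmodB _ _)).
    have -> : cmod (1 : R[i]) = 1 by exact: ComplexField.Normc.normc1.
    by have := mollifier_symbol_le (D m *: k); lra.
  by have := cmod_ge0 (mollifier_symbol (D m *: k) - 1); nra.
move=> _ _; rewrite [X in _ --> X]integral0_eq// => lim0.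
have [m [/= hm1 hm2]] := filter_ex (filterI (cvg_ereal_small lim0 e4)
  (near_infty_natSinv_lt (PosNum d10))).
pose delta := D m.
have dl0 : 0 < delta by exact: D0.
pose ceta x : R[i] := (mollifier delta x)%:C.
have teta : test_function ceta.
  apply: (@bounded_support_test R n _ delta (delta ^- n * q^-1)).
  - by apply: cmeasurable_real; exact: measurable_mollifier.
  - by move=> x; have /andP[a b] := mollifier_bounds dl0 x; rewrite cmodR ger0_norm.
  - by move=> x xd; rewrite /ceta mollifier_supp.
have mfe : cmeasurable (fourier ceta) by apply: cmeasurable_fourier; case: teta.
pose I2 := fine (\int[beta]_k ((cmod (fourier ceta k)) ^+ 2)%:E)%E.
have I2E : (\int[beta]_k ((cmod (fourier ceta k)) ^+ 2)%:E = I2%:E)%E.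
  rewrite /I2 fineK// ge0_fin_numE; first exact: test_beta.
  by apply: integral_ge0 => k _; rewrite lee_fin sqr_ge0.
have I20 : 0 <= I2.
  by rewrite fine_ge0// integral_ge0// => k _; rewrite lee_fin sqr_ge0.
(* The three bounds serve, in this order, the L^1 error 5 e' + e / 4, the replacement of e'^2 by e',
   and the estimate 8 e' I2 <= e / 2; [I2 + 1] avoids a division by 0. *)
pose e' := Num.min (e / 20) (Num.min 1 (e / (16 * (I2 + 1)))).
have e'0 : 0 < e' by rewrite !lt_min ltr01 !divr_gt0// mulr_gt0// ltr_wpDl.
have e'1 : e' <= e / 20 by rewrite ge_min lexx.
have e'2 : e' <= 1 by rewrite !ge_min lexx orbT.
have e'3 : e' <= e / (16 * (I2 + 1)) by rewrite !ge_min lexx !orbT.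
have [f0 [B [r [mf0 f0B f0r f0e]]]] := truncation fi e'0.
have B0 : 0 <= B by exact: le_trans (cmod_ge0 _) (f0B 0).
have f0i : cintegrable la f0 by exact: (bounded_support_cintegrable B0 mf0 f0B f0r).
have meta := measurable_mollifier delta.
have c0 (z : R[i]) : (0 <= (cmod z)%:E)%E by rewrite lee_fin cmod_ge0.
have cm (g : rV -> R[i]) : cmeasurable g ->
    measurable_fun setT (fun x => (cmod (g x))%:E).
  by move=> mg; apply/measurable_EFinP; exact: cmeasurable_cmod.
have tri (u v w : rV -> R[i]) : cmeasurable u -> cmeasurable v -> cmeasurable w ->
    (\int[la]_x (cmod (u x - w x))%:E <= \int[la]_x (cmod (u x - v x))%:E +
       \int[la]_x (cmod (v x - w x))%:E)%E.
  move=> mu mv mw; rewrite -ge0_integralD//; try by apply: cm; exact: cmeasurableB.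
  apply: ge0_le_integral => //.
  - by apply: cm; exact: cmeasurableB.
  - by apply: emeasurable_funD; apply: cm; exact: cmeasurableB.
  - move=> x _; rewrite -EFinD lee_fin.
    have -> : u x - w x = (u x - v x) + (v x - w x) by rewrite addrA subrK.
    exact: cmodD.
pose g := convol (mollifier delta) f0.
have tg : test_function g.
  exact: (conv_test_function meta (mollifier_bounds dl0) (mollifier_supp dl0) mf0 f0B f0r).
have mg : cmeasurable g by case: tg.
exists g; split => //.
- apply: (le_trans (tri _ _ _ mg mf0 mf)).
  have h1 : (\int[la]_x (cmod (g x - f0 x))%:E <= (2 * (2 * e' + e / 8))%:E)%E.
    apply: (conv_dist meta (mollifier_bounds dl0) (mollifier_supp dl0) mf0 f0B).
    + by rewrite addr_ge0// ?mulr_ge0// ltW.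
    + exact: mollifier_int1.
    + move=> y yd.
      have mtr (u : rV -> R[i]) : cmeasurable u -> cmeasurable (fun x : rV => u (x - y)).
        move=> mu; apply: (cmeasurable_comp mu).
        exact: (measurable_translate (u := idfun) y (@measurable_id _ _ _)).
      apply: (le_trans (tri _ (fun x : rV => f (x - y)) _ (mtr _ mf0) (mtr _ mf) mf0)).
      have k1 : (\int[la]_x (cmod (f0 (x - y) - f (x - y)))%:E <= e'%:E)%E.
        rewrite (@ge0_integral_translate R n (- y) (fun x => (cmod (f0 x - f x))%:E))//.
        by apply: cm; exact: cmeasurableB.
      have k2 : (\int[la]_x (cmod (f (x - y) - f x))%:E <= (e / 8)%:E)%E.
        by apply: hd1; exact: lt_trans yd hm2.
      have k3 : (\int[la]_x (cmod (f x - f0 x))%:E <= e'%:E)%E.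
        by under eq_integral do rewrite cmod_distC.
      apply: (@le_trans _ _ (e'%:E + ((e / 8)%:E + e'%:E))%E).
        apply: leeD => //.
        by apply: (le_trans (tri _ f _ (mtr _ mf) mf mf0)); exact: leeD.
      by rewrite -!EFinD lee_fin; lra.
  apply: (@le_trans _ _ ((2 * (2 * e' + e / 8))%:E + e'%:E)%E); first exact: leeD.
  by rewrite -EFinD lee_fin; lra.
- have ff0 k : cmod (fourier f0 k - fourier f k) <= 2 * e'.
    rewrite -fourierB// -lee_fin; apply: (le_trans (fourier_le k (cintegrableB f0i fi))).
    by rewrite EFinM; apply: lee_pmul => //; exact: integral_ge0.
  have gE k : fourier g k = mollifier_symbol (delta *: k) * fourier f0 k.
    rewrite /g (fourier_conv meta (mollifier_bounds dl0) (mollifier_supp dl0) mf0 f0B f0r).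
    by rewrite fourier_mollifier.
  have s0 (z : R[i]) : (0 <= (cmod z ^+ 2)%:E)%E by rewrite lee_fin sqr_ge0.
  rewrite [X in (X <= _)%E](_ : _ =
    \int[beta]_k (cmod (fourier g k - fourier f k) ^+ 2)%:E)%E//.
  apply: (@le_trans _ _ (\int[beta]_k ((8 * e' ^+ 2)%:E * (cmod (fourier ceta k) ^+ 2)%:E +
      2%:E * h m k))%E).
    have mgf : measurable_fun setT (fun k => (cmod (fourier g k - fourier f k) ^+ 2)%:E).
      apply: measurable_sqr_cmod; apply: cmeasurableB => //.
      exact: cmeasurable_fourier.
    apply: ge0_le_integral; [exact: measurableT|by move=> k _; exact: s0|exact: mgf| |].
    + by apply: emeasurable_funD; apply: measurable_funeM; exact: measurable_sqr_cmod.
    + move=> k _; rewrite /h -!EFinM -EFinD lee_fin.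
      rewrite /ceta fourier_mollifier// gE -/delta.
      set s := mollifier_symbol _.
      (* This separates the truncation error, damped by the symbol [s], from the mollification error
         of [f]. *)
      have -> : s * fourier f0 k - fourier f k =
         s * (fourier f0 k - fourier f k) + fourier f k * (s - 1) by ring.
      apply: (le_trans (sqr_cmodD _ _)); rewrite lerD2r cmodM exprMn.
      have := ff0 k; have := cmod_ge0 (fourier f0 k - fourier f k).
      have := sqr_ge0 (cmod s); move: (cmod s ^+ 2) (cmod (_ - _)) => S u S0 u0 ue.
      have : u ^+ 2 <= (2 * e') ^+ 2 by rewrite ler_sqr ?nnegrE// mulr_ge0// ltW.
      by rewrite exprMn => ?; nra.
  rewrite ge0_integralD//; last 4 first.
  + by move=> k _; rewrite mule_ge0// lee_fin mulr_ge0// sqr_ge0.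
  + by apply: measurable_funeM; exact: measurable_sqr_cmod.
  + by move=> k _; rewrite mule_ge0// s0.
  + by apply: measurable_funeM; exact: measurable_sqr_cmod.
  rewrite !ge0_integralZl//; last 4 first.
  + exact: measurable_sqr_cmod.
  + by move=> k _; exact: s0.
  + exact: measurable_sqr_cmod.
  + by rewrite lee_fin mulr_ge0// sqr_ge0.
  apply: (@le_trans _ _ ((e / 2)%:E + (e / 2)%:E)%E); last by rewrite -EFinD -splitr.
  apply: leeD; last first.
    apply: (@le_trans _ _ (2%:E * (e / 4)%:E)%E).
      by apply: lee_pmul => //; apply: integral_ge0 => k _; exact: s0.
    by rewrite -EFinM lee_fin; lra.
  rewrite I2E -EFinM lee_fin.
  have : e' * (16 * (I2 + 1)) <= e by rewrite -ler_pdivlMr// mulr_gt0// ltr_wpDl.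
  have : e' ^+ 2 <= e' by rewrite expr2 ler_piMl// ltW.
  by have := e'0; nra.
Qed.

End approximation.

Section truncated_limit.
Context d (T : measurableType d) (R : realType) (mu : {measure set T -> \bar R}).
Implicit Types X Y Z : T -> R[i].

(** With m the minimum, either m <= b, or m^2 - b^2 = (m - b)(m + b) with the first factor at most
    [c] and the second at most [2 * N]. *)
Lemma sqr_minr_le (a b c N : R) : 0 <= a -> 0 <= b -> 0 <= c -> 0 <= N ->
  a <= b + c -> (Num.min a N) ^+ 2 <= b ^+ 2 + 2 * N * c.
Proof.
move=> a0 b0 c0 N0 abc; have m0 : 0 <= Num.min a N by rewrite le_min a0 N0.
have ma : Num.min a N <= a by rewrite ge_min lexx.
have mN : Num.min a N <= N by rewrite ge_min lexx orbT.
move: (Num.min a N) m0 ma mN => m m0 ma mN.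
have [mb|bm] := leP m b; first by nra.
have h1 : (m - b) * (m + b) <= c * (m + b) by apply: ler_wpM2r; lra.
have h2 : c * (m + b) <= c * (2 * N) by apply: ler_wpM2l => //; lra.
by nra.
Qed.

(* Fatou's lemma for a sequence converging only in mean: the truncations pass to
   the limit, and then the truncation level is let to infinity. *)
Lemma sqr_cmod_integral_limit Z X (A : R) : cmeasurable Z -> cmeasurable X ->
  (forall e : R, 0 < e -> exists Y, [/\ cmeasurable Y,
    (\int[mu]_w (cmod (Z w - Y w))%:E <= e%:E)%E &
    (\int[mu]_w ((cmod (Y w - X w)) ^+ 2)%:E <= (A + e)%:E)%E]) ->
  (\int[mu]_w ((cmod (Z w - X w)) ^+ 2)%:E <= A%:E)%E.
Proof.
move=> mZ mX approx; pose D w := cmod (Z w - X w).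
have mD : measurable_fun setT D by apply: cmeasurable_cmod; exact: cmeasurableB.
have D0 w : 0 <= D w by exact: cmod_ge0.
pose g (N : nat) w := ((Num.min (D w) N%:R) ^+ 2)%:E.
have mg N : measurable_fun setT (g N).
  by apply/measurable_EFinP; apply: measurable_funX; exact: measurable_minr.
have g0 N w : (0 <= g N w)%E by rewrite lee_fin sqr_ge0.
have bound N : (\int[mu]_w g N w <= A%:E)%E.
  apply/lee_addgt0Pr => e e0; have e'0 : 0 < e / (1 + 2 * N%:R).
    by rewrite divr_gt0// ltr_pwDl// mulr_ge0.
  have [Y [mY Y1 Y2]] := approx _ e'0.
  have c0 (z : R[i]) : (0 <= (cmod z)%:E)%E by rewrite lee_fin cmod_ge0.
  have mZY : measurable_fun setT (fun w => (cmod (Z w - Y w))%:E).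
    by apply/measurable_EFinP; apply: cmeasurable_cmod; exact: cmeasurableB.
  have mYX : measurable_fun setT (fun w => (cmod (Y w - X w) ^+ 2)%:E).
    by apply: measurable_sqr_cmod; exact: cmeasurableB.
  apply: (@le_trans _ _ (\int[mu]_w ((cmod (Y w - X w) ^+ 2)%:E +
      (2 * N%:R)%:E * (cmod (Z w - Y w))%:E))%E).
    apply: ge0_le_integral => //.
    - by apply: emeasurable_funD => //; exact: measurable_funeM.
    - move=> w _; rewrite -EFinM -EFinD lee_fin; apply: sqr_minr_le => //.
      + exact: cmod_ge0.
      + exact: cmod_ge0.
      + rewrite /D; have -> : Z w - X w = (Y w - X w) + (Z w - Y w).
          by rewrite [RHS]addrC addrA subrK.
        exact: cmodD.
  rewrite ge0_integralD//; last 3 first.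
  - by move=> w _; rewrite lee_fin sqr_ge0.
  - by move=> w _; rewrite mule_ge0.
  - exact: measurable_funeM.
  rewrite ge0_integralZl//.
  apply: (le_trans (leeD Y2 (lee_wpmul2l _ Y1))); first by rewrite lee_fin mulr_ge0.
  rewrite -EFinM -!EFinD lee_fin -addrA lerD2l.
  rewrite (_ : _ + _ = (1 + 2 * N%:R) * (e / (1 + 2 * N%:R))); last by rewrite [RHS]mulrDl mul1r.
  by rewrite mulrCA mulfV ?mulr1// lt0r_neq0// ltr_pwDl// mulr_ge0.
have := @cvg_monotone_convergence _ _ _ mu setT measurableT g (fun N => mg N)
  (fun N w _ => g0 N w).
rewrite (_ : (fun w => limn (g^~ w)) = (fun w => ((D w) ^+ 2)%:E)); last first.
  apply/funext => w; apply: cvg_lim => //; apply: cvg_near_cst.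
  have : \forall N \near \oo, D w < N%:R by exact: nbhs_infty_gtr.
  by apply: filterS => N DN; rewrite /g min_l// ltW.
move=> h; apply: (cvge_to_le (h _)); last by apply: nearW => N; exact: bound.
move=> w _ m k mk; rewrite lee_fin ler_sqr ?nnegrE ?le_min ?D0 ?ler0n//.
by rewrite ge_min lexx /= ge_min ler_nat mk orbT.
Qed.

End truncated_limit.

Lemma subr_interchange (V : zmodType) (x y z t : V) :
  x - y - (z - t) = x - z - (y - t).
Proof. by rewrite !opprD addrACA. Qed.

Lemma lee_mul2 (R : realType) (a b : \bar R) : (a <= b -> 2%:E * a <= 2%:E * b)%E.
Proof. by move=> ab; apply: lee_wpmul2l; rewrite ?lee_fin. Qed.

(** [A] and [B] stand for the second moments, on one side of the comparison, of [f] and of an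
    approximating test function, [I] and [G] for those on the other side, and [k] is the factor of
    the exact identity for test functions. With [k] equal to 1 / c or c, both directions follow. For
    infinite [I] the claim is trivial because [k] is positive. *)
Lemma lee_two_step (R : realType) (A B D G I E : \bar R) (k a b : R) : 0 < k ->
  (0 <= I -> A <= 2%:E * B + 2%:E * D -> D <= a%:E -> B = k%:E * G ->
  G <= 2%:E * I + 2%:E * E -> E <= b%:E ->
  A <= (4 * k)%:E * I + (2 * a + 4 * k * b)%:E)%E.
Proof.
move=> k0 I0 + Da Be GI Eb; rewrite Be => AB; apply: (le_trans AB).
have k4 : 0 < 4 * k by rewrite mulr_gt0.
case: I I0 GI => [I I0 GI|_ _|//]; last first.
  have -> : ((4 * k)%:E * +oo = +oo)%E by rewrite muleC gt0_mulye// lte_fin.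
  exact: leey.
apply: (@le_trans _ _ (2%:E * (k%:E * (2%:E * I%:E + 2%:E * b%:E)) + 2%:E * a%:E)%E).
  apply: leeD; apply: lee_mul2 => //; apply: lee_wpmul2l; first by rewrite lee_fin ltW.
  by apply: (le_trans GI); rewrite leeD2l// lee_mul2.
by rewrite -!(EFinM, EFinD) lee_fin; lra.
Qed.

(** * Comparison of variance and spectral integral *)

Section comparison.
Context {R : realType} {n : nat} {d : measure_display} {Omega : measurableType d}.
Local Notation rV := 'rV[R]_n.
Local Notation la := (@lebesgue_rV R n).
Variables (P : probability Omega R) (Phi : Omega -> set rV -> R[i]).
Variable M : Omega -> {measure set rV -> \bar R}.
Variable C : R.
Hypothesis C0 : 0 <= C.
Hypothesis M_lf : forall w, locally_finite (M w).
Hypothesis M2 : forall A, measurable A -> bounded_rV A ->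
      (\int[P]_w ((fine (M w A)) ^+ 2)%:E < +oo)%E.
Hypothesis mI : forall f, cmeasurable f -> cmeasurable (fun w => cm_integral (Phi w) f).
Hypothesis IB : forall w f g, cintegrable (M w) f -> cintegrable (M w) g ->
        cm_integral (Phi w) (fun x => f x - g x) =
        cm_integral (Phi w) f - cm_integral (Phi w) g.
Hypothesis I_le : forall w f, cintegrable (M w) f ->
   ((cmod (cm_integral (Phi w) f))%:E <= 2%:E * \int[M w]_x (cmod (f x))%:E)%E.
Hypothesis mM : forall g : rV -> \bar R, measurable_fun setT g ->
  (forall x, 0 <= g x)%E -> measurable_fun setT (fun w => \int[M w]_x g x)%E.
Hypothesis camp : forall g : rV -> \bar R, measurable_fun setT g ->
  (forall x, 0 <= g x)%E ->
  (\int[P]_w \int[M w]_x g x = C%:E * \int[la]_x g x)%E.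
Variable beta : {measure set rV -> \bar R}.
Hypothesis hbeta : is_bartlett_measure P Phi beta.
Implicit Types f g : rV -> R[i].

Let X f w := cm_integral (Phi w) f.
Let Z f w := X f w - cintegral P (X f).
Let c := spectral_const (R := R) (n := n).

Let c0 : 0 < c. Proof. exact: spectral_const_gt0. Qed.

(** By Campbell's formula the mean of the integral of |f| is [C] times its L^1 norm. Hence the
    default value 0 of [cm_integral] is confined to a null event, and linearity holds almost
    surely. *)
Let ae_cintegrable f : cintegrable la f -> {ae P, forall w, cintegrable (M w) f}.
Proof.
move=> fi; have mf := cintegrable_cmeasurable fi.
have mcf : measurable_fun setT (fun x => (cmod (f x))%:E).
  by apply/measurable_EFinP; exact: cmeasurable_cmod.
have n0 (x : rV) : (0 <= (cmod (f x))%:E)%E by rewrite lee_fin cmod_ge0.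
have : P.-integrable setT (fun w => \int[M w]_x (cmod (f x))%:E)%E.
  apply/integrableP; split; first exact: mM.
  under eq_integral do rewrite gee0_abs ?integral_ge0//.
  rewrite camp// lte_mul_pinfty//; have /cintegrableP[_ h] := fi.
  exact: h.
move=> /(integrable_ae measurableT); apply: filterS => w /(_ I) h.
by apply/cintegrableP; split; rewrite // -ge0_fin_numE// integral_ge0.
Qed.

Lemma cm_integral_dist_le f g : cintegrable la f -> cintegrable la g ->
  (\int[P]_w (cmod (X f w - X g w))%:E <=
   (2 * C)%:E * \int[la]_x (cmod (f x - g x))%:E)%E.
Proof.
move=> fi gi; have mf := cintegrable_cmeasurable fi.
have mg := cintegrable_cmeasurable gi.
have mh : measurable_fun setT (fun x => (cmod (f x - g x))%:E).
  by apply/measurable_EFinP; apply: cmeasurable_cmod; exact: cmeasurableB.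
have n0 (z : R[i]) : (0 <= (cmod z)%:E)%E by rewrite lee_fin cmod_ge0.
rewrite EFinM -muleA -camp// -ge0_integralZl//; last 2 first.
- exact: mM.
- by move=> w _; exact: integral_ge0.
apply: ae_ge0_le_integral => //.
- apply/measurable_EFinP; apply: cmeasurable_cmod.
  by apply: cmeasurableB; exact: mI.
- by move=> w _; rewrite mule_ge0// integral_ge0.
- by apply: measurable_funeM; exact: mM.
- apply: filterS2 (ae_cintegrable fi) (ae_cintegrable gi) => w fw gw _.
  by rewrite /X -IB//; apply: I_le; exact: cintegrableB.
Qed.

Section smooth.
Variable f : rV -> R[i].
Hypothesis fi : cintegrable la f.
Hypothesis f2 : (\int[beta]_k ((cmod (fourier f k)) ^+ 2)%:E < +oo)%E.

Let mf : cmeasurable f := cintegrable_cmeasurable fi.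

Let approx (e : R) : 0 < e -> exists g, [/\ test_function g,
  (\int[la]_x (cmod (g x - f x))%:E <= e%:E)%E &
  (\int[beta]_k ((cmod (fourier g k - fourier f k)) ^+ 2)%:E <= e%:E)%E].
Proof.
move=> e0; suff tb g : test_function g ->
    (\int[beta]_k ((cmod (fourier g k)) ^+ 2)%:E < +oo)%E.
  exact: (test_approximation tb fi e0 f2).
move=> tg.
rewrite (test_variance M_lf M2 mI I_le mM hbeta tg).
have [mg _ _] := tg; have mX : cmeasurable (X g) by exact: mI.
have Xg2 := test_sqr_integrable M_lf M2 mI I_le mM tg.
rewrite integral_centered// lte_mul_pinfty//; first by rewrite lee_fin ltW.
apply: le_lt_trans Xg2.
by rewrite leeBlDr// leeDl// lee_fin sqr_ge0.
Qed.

Let test_i g : test_function g -> cintegrable la g.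
Proof. by apply: test_cintegrable; exact: lebesgue_locally_finite. Qed.

Let X_test g : test_function g -> cintegrable P (X g).
Proof.
move=> tg; apply: sqr_integrable_cintegrable; first by apply: mI; case: tg.
exact: (test_sqr_integrable M_lf M2 mI I_le mM tg).
Qed.

Let dist_finite g : cintegrable la g ->
  (\int[P]_w (cmod (X f w - X g w))%:E < +oo)%E.
Proof.
move=> gi; apply: (le_lt_trans (cm_integral_dist_le fi gi)).
have /cintegrableP[_ h] := cintegrableB fi gi.
by rewrite lte_mul_pinfty// lee_fin mulr_ge0.
Qed.

(** [X g] is square integrable for a test function [g], and [X f] differs from it by an integrable
    variable. *)
Lemma cm_integral_cintegrable : cintegrable P (X f).
Proof.
have [g [tg _ _]] := approx ltr01; have gi := test_i tg.
have mX := mI mf; have mg : cmeasurable (X g) by apply: mI; case: tg.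
have dfg : cintegrable P (fun w => X f w - X g w).
  by apply/cintegrableP; split; [exact: cmeasurableB|exact: dist_finite].
have := cintegrableD dfg (X_test tg).
by under eq_fun do rewrite subrK.
Qed.

(** The variables contribute 2 C, and their means, through [cmod_cintegral_le], another 4 C. *)
Lemma centered_dist_le g : test_function g ->
  (\int[P]_w (cmod (Z f w - Z g w))%:E <=
   (6 * C)%:E * \int[la]_x (cmod (g x - f x))%:E)%E.
Proof.
move=> tg; have gi := test_i tg.
under [X in (_ <= _ * X)%E]eq_integral do rewrite cmod_distC.
have Xi := cintegrableB cm_integral_cintegrable (X_test tg).
have mXX := cintegrable_cmeasurable Xi.
have n0 (z : R[i]) : (0 <= (cmod z)%:E)%E by rewrite lee_fin cmod_ge0.
have mc : measurable_fun setT (fun w => (cmod (X f w - X g w))%:E).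
  by apply/measurable_EFinP; exact: cmeasurable_cmod.
have h := cm_integral_dist_le fi gi.
apply: (@le_trans _ _ (\int[P]_w ((cmod (X f w - X g w))%:E +
   (cmod (cintegral P (fun w => (X f w - X g w)%R)))%:E))%E).
  apply: ge0_le_integral => //.
  - apply/measurable_EFinP; apply: cmeasurable_cmod.
    apply: cmeasurableB; apply: cmeasurableB; try exact: cmeasurable_cst.
      exact: mI.
    by apply: mI; case: tg.
  - by apply: emeasurable_funD => //; exact: measurable_cst.
  - move=> w _; rewrite -EFinD lee_fin cintegralB//; last 2 first.
    + exact: cm_integral_cintegrable.
    + exact: X_test.
    have -> : Z f w - Z g w = (X f w - X g w) - (cintegral P (X f) - cintegral P (X g)).
      by rewrite /Z subr_interchange.
    exact: cmodB.
rewrite ge0_integralD//.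
rewrite integral_probability_cst.
apply: (le_trans (leeD h (cmod_cintegral_le Xi))).
apply: (le_trans (leeD2l _ (lee_wpmul2l _ h))); first by rewrite lee_fin.
have -> : 6 * C = 2 * C + 2 * (2 * C) by ring.
by rewrite (EFinD (2 * C) (2 * (2 * C))) ge0_muleDl ?lee_fin ?mulr_ge0// (EFinM 2 (2 * C)) muleA.
Qed.

(** The difference of [h] and [g] is itself a test function, and linearity holds for every [w]
    because test functions are integrable for every locally finite measure. *)
Lemma centered_test_dist g h : test_function g -> test_function h ->
  (\int[P]_w ((cmod (Z h w - Z g w)) ^+ 2)%:E = (c^-1)%:E *
   \int[beta]_k ((cmod (fourier h k - fourier g k)) ^+ 2)%:E)%E.
Proof.
move=> tg th; have thg := test_functionB th tg.
have -> : (\int[beta]_k ((cmod (fourier h k - fourier g k)) ^+ 2)%:E =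
    \int[beta]_k ((cmod (fourier (fun x => h x - g x) k)) ^+ 2)%:E)%E.
  by apply: eq_integral => k _; rewrite fourierB//; exact: test_i.
rewrite (test_variance M_lf M2 mI I_le mM hbeta thg).
rewrite muleA -EFinM mulVf ?mul1e; last exact: lt0r_neq0.
have XE : X (fun x => h x - g x) = fun w => X h w - X g w.
  by apply/funext => w; apply: IB; exact: test_cintegrable.
have ZE w : Z h w - Z g w =
    X (fun x => h x - g x) w - cintegral P (X (fun x => h x - g x)).
  by rewrite /Z subr_interchange -cintegralB ?XE//; exact: X_test.
by apply: eq_integral => w _; rewrite ZE.
Qed.

(** For test functions [h] approximating [f], [Z h] tends to [Z f] in mean, while its square
    distance to [Z g] is known exactly on the spectral side. The factor 2 stems from passing through
    [fourier f] there. *)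
Lemma centered_sqr_dist_le g (e : R) : test_function g -> 0 <= e ->
  (\int[beta]_k ((cmod (fourier g k - fourier f k)) ^+ 2)%:E <= e%:E)%E ->
  (\int[P]_w ((cmod (Z f w - Z g w)) ^+ 2)%:E <= (2 * e / c)%:E)%E.
Proof.
move=> tg e0 ge; have Xf := cm_integral_cintegrable.
have mZ h : cmeasurable (X h) -> cmeasurable (Z h).
  by move=> mX; apply: cmeasurableB => //; exact: cmeasurable_cst.
have mXg : cmeasurable (X g) by apply: mI; case: tg.
apply: sqr_cmod_integral_limit; [by apply: mZ; exact: mI|exact: mZ|].
move=> eps eps0.
have e'0 : 0 < Num.min (eps / (6 * C + 1)) (eps * c / 2).
  by rewrite lt_min !divr_gt0 ?mulr_gt0// ltr_wpDl// mulr_ge0.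
have [h [th h1 h2]] := approx e'0; exists (Z h).
have mXh : cmeasurable (X h) by apply: mI; case: th.
split; first exact: mZ.
- apply: (le_trans (centered_dist_le th)).
  apply: (le_trans (lee_wpmul2l _ h1)); first by rewrite lee_fin mulr_ge0.
  rewrite -EFinM lee_fin.
  apply: (@le_trans _ _ ((6 * C + 1) * (eps / (6 * C + 1)))).
    by rewrite ler_pM ?mulr_ge0 ?(ltW e'0) ?lerDl// ge_min lexx.
  by rewrite mulrCA mulfV ?mulr1// lt0r_neq0// ltr_wpDl// mulr_ge0.
- rewrite centered_test_dist//.
  have mF u : cmeasurable u -> cmeasurable (fourier u) by move=> mu; exact: cmeasurable_fourier.
  have mfg : cmeasurable (fourier g) by apply: mF; case: tg.
  have mfh : cmeasurable (fourier h) by apply: mF; case: th.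
  have mff : cmeasurable (fourier f) by exact: mF.
  have h3 : (\int[beta]_k ((cmod (fourier h k - fourier g k)) ^+ 2)%:E <=
      (2 * e + 2 * (eps * c / 2))%:E)%E.
    have := @sqr_cmod_integral_le _ _ _ beta (fun k => fourier h k - fourier g k)
      (fun k => fourier f k - fourier g k) (cmeasurableB mfh mfg) (cmeasurableB mff mfg).
    move=> /le_trans; apply; rewrite [X in (_ <= X)%E]EFinD; apply: leeD.
      rewrite [X in (_ <= X)%E]EFinM; apply: lee_mul2.
      by under eq_integral do rewrite cmod_distC.
    rewrite [X in (_ <= X)%E]EFinM; apply: lee_mul2.
    under eq_integral do rewrite opprB addrA subrK.
    by apply: (le_trans h2); rewrite lee_fin ge_min lexx orbT.
  apply: (le_trans (lee_wpmul2l _ h3)); first by rewrite lee_fin invr_ge0 ltW.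
  rewrite -EFinM lee_fin le_eqVlt; apply/orP; left; apply/eqP.
  by field; exact: lt0r_neq0.
Qed.

Lemma variance_le_spectral : (cvariance P (X f) <=
  (4 / c)%:E * \int[beta]_k ((cmod (fourier f k)) ^+ 2)%:E)%E.
Proof.
have Xf := cm_integral_cintegrable; rewrite cvariance_centered//.
have mff : cmeasurable (fourier f) by exact: cmeasurable_fourier.
apply/lee_addgt0Pr => eps eps0.
(* With t = eps c / 8 the error produced by [lee_two_step] is 2 (2 t / c) + 4 t / c = 8 t / c =
   eps. *)
have e0 : 0 < eps * c / 8 by rewrite divr_gt0// mulr_gt0.
have [g [tg _ g2]] := approx e0.
have mXg : cmeasurable (X g) by apply: mI; case: tg.
have mfg : cmeasurable (fourier g) by apply: cmeasurable_fourier; case: tg.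
have mZ h : cmeasurable (X h) -> cmeasurable (Z h).
  by move=> mX; apply: cmeasurableB => //; exact: cmeasurable_cst.
have h3 : (\int[P]_w ((cmod (Z g w)) ^+ 2)%:E = (c^-1)%:E *
    \int[beta]_k ((cmod (fourier g k)) ^+ 2)%:E)%E.
  rewrite (test_variance M_lf M2 mI I_le mM hbeta tg).
  by rewrite muleA -EFinM mulVf ?mul1e//; exact: lt0r_neq0.
have I0 : (0 <= \int[beta]_k ((cmod (fourier f k)) ^+ 2)%:E)%E.
  by apply: integral_ge0 => k _; rewrite lee_fin sqr_ge0.
have ci : 0 < c^-1 by rewrite invr_gt0.
apply: (le_trans (lee_two_step ci I0 (sqr_cmod_integral_le P (mZ f (mI mf)) (mZ g mXg))
  (centered_sqr_dist_le tg (ltW e0) g2) h3 (sqr_cmod_integral_le beta mfg mff) g2)).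
rewrite leeD2l// lee_fin le_eqVlt; apply/orP; left; apply/eqP.
by field; exact: lt0r_neq0.
Qed.

Lemma spectral_le_variance : (\int[beta]_k ((cmod (fourier f k)) ^+ 2)%:E <=
  (4 * c)%:E * cvariance P (X f))%E.
Proof.
have Xf := cm_integral_cintegrable; rewrite cvariance_centered//.
have mff : cmeasurable (fourier f) by exact: cmeasurable_fourier.
apply/lee_addgt0Pr => eps eps0.
(* With t = eps / 10 the error produced by [lee_two_step] is 2 t + 4 c (2 t / c) = 10 t = eps. *)
have e0 : 0 < eps / 10 by rewrite divr_gt0.
have [g [tg _ g2]] := approx e0.
have mXg : cmeasurable (X g) by apply: mI; case: tg.
have mfg : cmeasurable (fourier g) by apply: cmeasurable_fourier; case: tg.
have mZ h : cmeasurable (X h) -> cmeasurable (Z h).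
  by move=> mX; apply: cmeasurableB => //; exact: cmeasurable_cst.
have V0 : (0 <= \int[P]_w ((cmod (Z f w)) ^+ 2)%:E)%E.
  by apply: integral_ge0 => k _; rewrite lee_fin sqr_ge0.
have g3 : (\int[beta]_k ((cmod (fourier f k - fourier g k)) ^+ 2)%:E <= (eps / 10)%:E)%E.
  by under eq_integral do rewrite cmod_distC.
have h2 : (\int[P]_w ((cmod (Z g w - Z f w)) ^+ 2)%:E <= (2 * (eps / 10) / c)%:E)%E.
  under eq_integral do rewrite cmod_distC.
  exact: (centered_sqr_dist_le tg (ltW e0) g2).
apply: (le_trans (lee_two_step c0 V0 (sqr_cmod_integral_le beta mff mfg) g3
  (test_variance M_lf M2 mI I_le mM hbeta tg)
  (sqr_cmod_integral_le P (mZ g mXg) (mZ f (mI mf))) h2)).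
rewrite leeD2l// lee_fin le_eqVlt; apply/orP; left; apply/eqP.
by field; exact: lt0r_neq0.
Qed.

End smooth.
End comparison.

(** * Spectral estimates *)

Section dyadic.
Context {R : realType}.

Lemma dyadic_exists (t : R) : 1 <= t -> exists j, 2 ^+ j <= t < 2 ^+ j.+1.
Proof.
move=> t1; have ex : exists N, t < 2 ^+ N.
  exists (Num.truncn t).+1; apply: (lt_trans (truncnS_gt t)).
  by rewrite -natrX ltr_nat ltn_expl.
case: (ex_minnP ex) => -[|j] tj jmin; first by rewrite expr0 ltNge t1 in tj.
exists j; rewrite tj andbT leNgt; apply/negP => /jmin; by rewrite ltnn.
Qed.

Lemma powR_exprn (a x : R) (j : nat) : 0 <= a -> (a ^+ j) `^ x = (a `^ x) ^+ j.
Proof. by move=> a0; rewrite -(powR_mulrn j a0) -powRrM mulrC powRrM powR_mulrn ?powR_ge0. Qed.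

Lemma le_powRN (a b x : R) : 0 < a -> a <= b -> 0 <= x -> b `^ (- x) <= a `^ (- x).
Proof.
move=> a0 ab x0; have b0 : 0 < b by exact: lt_le_trans ab.
rewrite !powRN lef_pV2 ?posrE ?powR_gt0//.
by apply: ge0_ler_powR => //; rewrite nnegrE ltW.
Qed.

(** A single term of the series suffices: j = 0 when t < 1, otherwise the j with 2^j <= t <
    2^(j+1). *)
Lemma powR_dyadic_le (alpha t : R) : 0 <= alpha -> 0 <= t ->
  (((1 + t) `^ (- alpha))%:E <= \sum_(0 <= j <oo)
     ((2 `^ (- alpha)) ^+ j)%:E * (((t < 2 ^+ j.+1)%R%:R)%:E))%E.
Proof.
move=> a0 t0; pose u (j : nat) := (((2 `^ (- alpha)) ^+ j)%:E * (((t < 2 ^+ j.+1)%R%:R)%:E))%E.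
rewrite -/u.
have u0 j : (0 <= u j)%E by rewrite mule_ge0// lee_fin ?exprn_ge0 ?powR_ge0.
suff [j uj] : exists j, (((1 + t) `^ (- alpha))%:E <= u j)%E.
  apply: (le_trans uj).
  apply: (le_trans _ (nneseries_lim_ge (u_ := u) (P := xpredT) (m := 0) j.+1 (fun i _ _ => u0 i))).
  by rewrite big_nat_recr//= leeDr// sume_ge0.
have [t1|t1] := ltP t 1.
  exists 0%N; rewrite /u expr0 expr1 mul1e (lt_le_trans t1) ?ler1n// lee_fin.
  by have := @le_powRN 1 (1 + t) alpha ltr01; rewrite powR1 lerDl; apply.
have [j /andP[j1 j2]] := dyadic_exists t1; exists j.
rewrite /u j2 mule1 lee_fin -powR_exprn//; apply: le_powRN => //.
by rewrite (le_trans j1)// lerDr.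
Qed.

(** Level j contributes 2^(-(gamma + theta) j) times 2^(gamma (j + 1)), that is 2^gamma 2^(-theta
    j); the geometric series in 2^(-theta) gives the denominator. *)
Definition dyadic_const (gamma theta : R) := 2 `^ gamma / (1 - 2 `^ (- theta)).

Lemma dyadic_ratio (theta : R) : 0 < theta -> 0 < (2 : R) `^ (- theta) < 1.
Proof.
move=> h; rewrite powR_gt0//= powRN invf_lt1 ?powR_gt0//.
have := @gt0_ltr_powR R theta h 1 2; rewrite powR1; apply; rewrite ?nnegrE//.
by rewrite ltr1n.
Qed.

Lemma dyadic_const_ge0 gamma theta : 0 < theta -> 0 <= dyadic_const gamma theta.
Proof.
by move=> /dyadic_ratio /andP[_ h]; rewrite divr_ge0 ?powR_ge0// subr_ge0 ltW.
Qed.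

Lemma geometric_nneseries_le (q : R) : 0 < q < 1 ->
  (\sum_(0 <= j <oo) (q ^+ j)%:E <= ((1 - q)^-1)%:E)%E.
Proof.
move=> /andP[q0 q1]; apply: lime_le.
  by apply: is_cvg_nneseries => j _ _; rewrite lee_fin exprn_ge0// ltW.
apply: nearW => N; rewrite sumEFin lee_fin.
have q1' : 0 < 1 - q by rewrite subr_gt0.
have -> : \sum_(0 <= i < N) q ^+ i = (1 - q ^+ N) / (1 - q).
  rewrite big_mkord; have := subrX1 q N.
  by rewrite -opprB => /eqP; rewrite eqr_oppLR -mulNr opprB => /eqP ->;
    rewrite mulrAC mulfV ?mul1r// gt_eqF.
by rewrite ler_pdivrMr// mulVf ?gt_eqF// lerBlDr lerDl exprn_ge0// ltW.
Qed.

(** The decay exceeds the growth of the sublevel sets by [theta], which makes the dyadic series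
    converge. It is applied to [beta] near 0 and to Lebesgue measure far away. *)
Lemma integral_dyadic_le d (T : measurableType d) (m : {measure set T -> \bar R})
    (D : set T) (tau : T -> R) (gamma theta B : R) : measurable D ->
  measurable_fun setT tau -> (forall x, 0 <= tau x) -> 0 < theta ->
  0 <= gamma -> 0 <= B ->
  (forall j, m ([set x | (tau x < 2 ^+ j.+1)%R] `&` D) <= (B * (2 ^+ j.+1) `^ gamma)%:E)%E ->
  (\int[m]_(x in D) ((1 + tau x) `^ (- (gamma + theta)))%:E <=
   (B * dyadic_const gamma theta)%:E)%E.
Proof.
move=> mD mtau tau0 theta0 gamma0 B0 mB; set alpha := gamma + theta.
have a0 : 0 <= alpha by rewrite addr_ge0// ltW.
pose E j := [set x | tau x < 2 ^+ j.+1].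
have mE j : measurable (E j).
  have := mtau measurableT _ (measurable_itv `]-oo, (2 ^+ j.+1 : R)[).
  by rewrite setTI; congr measurable; apply/seteqP; split => x /=; rewrite in_itv.
pose u j x := (((2 `^ (- alpha)) ^+ j)%:E * (\1_(E j) x)%:E)%E : \bar R.
have u0 j x : (0 <= u j x)%E by rewrite mule_ge0// lee_fin ?exprn_ge0 ?powR_ge0.
have mu j : measurable_fun D (u j).
  apply: measurable_funeM; apply/measurable_EFinP; exact: measurable_indic.
have s0 x : (0 <= \sum_(0 <= j <oo) u j x)%E by apply: nneseries_ge0 => j _ _.
apply: (@le_trans _ _ (\int[m]_(x in D) \sum_(0 <= j <oo) u j x)%E).
  rewrite integral_mkcond [leRHS]integral_mkcond; apply: ge0_integral_mono.
    by move=> x; rewrite patchE; case: ifP => // _; rewrite lee_fin powR_ge0.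
  move=> x; rewrite !patchE; case: ifP => // _.
  apply: (le_trans (powR_dyadic_le a0 (tau0 x))).
  apply: lee_nneseries => j *; first by rewrite mule_ge0// lee_fin ?exprn_ge0 ?powR_ge0.
  by rewrite /u indicE mem_setE.
rewrite integral_nneseries//.
have q01 := dyadic_ratio theta0; set q := 2 `^ (- theta) in q01.
have q0 : 0 < q by case/andP: q01.
have q1 : 0 < 1 - q by rewrite subr_gt0; case/andP: q01.
have -> : B * dyadic_const gamma theta = (B * 2 `^ gamma) * (1 - q)^-1.
  by rewrite /dyadic_const mulrA.
have Bg : 0 <= B * 2 `^ gamma by rewrite mulr_ge0// powR_ge0.
rewrite [leRHS]EFinM.
apply: (@le_trans _ _ ((B * 2 `^ gamma)%:E * \sum_(0 <= j <oo) (q ^+ j)%:E)%E); last first.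
  by apply: lee_wpmul2l; rewrite ?lee_fin//; exact: geometric_nneseries_le.
rewrite -nneseriesZl; last by move=> i _; rewrite lee_fin exprn_ge0// ltW.
apply: lee_nneseries => j *; first by apply: integral_ge0 => x _; exact: u0.
rewrite ge0_integralZl//; last by apply/measurable_EFinP; exact: measurable_indic.
rewrite integral_indic//.
apply: (@le_trans _ _ (((2 `^ (- alpha)) ^+ j)%:E * (B * (2 ^+ j.+1) `^ gamma)%:E)%E).
  by apply: lee_wpmul2l; rewrite ?lee_fin ?exprn_ge0 ?powR_ge0//; exact: mB.
rewrite -!EFinM lee_fin powR_exprn// exprS.
rewrite (_ : q = 2 `^ (- alpha) * 2 `^ gamma); last first.
  rewrite -powRD; last by rewrite pnatr_eq0 implybT.
  by rewrite /q /alpha; congr (_ `^ _); ring.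
rewrite exprMn le_eqVlt; apply/orP; left; apply/eqP; ring.
Qed.

End dyadic.

(** * Near and far parts of the spectral integral *)

Section spectral_estimates.
Context {R : realType} {n : nat}.
Local Notation rV := 'rV[R]_n.
Local Notation la := (@lebesgue_rV R n).
Variable f : rV -> R[i].
Hypothesis mF : cmeasurable (fourier f).

Let F2 k : \bar R := ((cmod (fourier f k)) ^+ 2)%:E.

Let F20 k : (0 <= F2 k)%E. Proof. by rewrite lee_fin sqr_ge0. Qed.

Let mF2 : measurable_fun setT F2.
Proof. by apply/measurable_EFinP; apply: measurable_funX; exact: cmeasurable_cmod. Qed.

Let mscal (r : R) : measurable_fun setT (fun x : rV => r *: x).
Proof. by have := @measurable_fun_affine R n r 0; under eq_fun do rewrite addr0. Qed.

Let q : R := fine (la (eball 1)).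

Let q0 : 0 < q.
Proof.
by rewrite fine_gt0// lebesgue_eball_gt0//= ltey_eq lebesgue_eball_fin.
Qed.

Let qE : la (eball 1 : set rV) = q%:E.
Proof. by rewrite /q fineK// lebesgue_eball_fin. Qed.

Definition tail_sup_integral (r : R) : \bar R :=
  (\int[la]_(k in ~` eball 2) ereal_sup [set F2 (r *: (k + u)%R) | u in eball 1])%E.

Let sup_ge0 r k : (0 <= ereal_sup [set F2 (r *: (k + u)%R) | u in eball 1])%E.
Proof.
apply: (@le_trans _ _ (F2 (r *: (k + 0)))) => //; apply: ereal_sup_ubound.
by exists 0 => //; rewrite /eball /= enorm0.
Qed.

(* For s > 0 the pointwise decay alone implies what is assumed when s <= 0. *)
Lemma tail_sup_integral_bound (s : R) : 0 <= n%:R + s -> fourier_smooth f s ->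
  exists C r0 : R, [/\ 0 <= C, 0 < r0 & forall r, r0 <= r ->
    (tail_sup_integral r <= (C * r `^ (- (n%:R + s)))%:E)%E].
Proof.
move=> alpha0 [[c c0 Fc] smooth]; have [s0|s0] := leP s 0.
  have [C [r0 [_ hr]]] := smooth s0.
  exists `|C|, (Num.max r0 0 + 1); split => //.
    by rewrite ltr_wpDl// le_max lexx orbT.
  move=> r rr; have r0r : r0 < r.
    by apply: lt_le_trans rr; rewrite ltr_pwDr// le_max lexx.
  apply: (le_trans (lee_abs _)); apply: (le_trans (hr _ r0r)).
  by rewrite lee_fin (ger0_norm (powR_ge0 _ _)) ler_wpM2r ?powR_ge0// ler_norm.
pose alpha := n%:R + s.
(* For |z| >= 2 and |u| < 1 the norm of z + u is at least |z| - 1 >= |z| / 2, so [tau z] is a lower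
   bound uniform over the supremum. *)
pose D : set rV := ~` eball 2; pose tau (z : rV) := enorm z / 2.
have mD : measurable D by apply: measurableC; exact: measurable_enorm_lt.
have mtau : measurable_fun setT tau by apply: measurable_funM => //; exact: measurable_enorm.
have tau0 z : 0 <= tau z by rewrite divr_ge0// enorm_ge0.
pose C := c ^+ 2 * 2 `^ alpha * (2 ^+ n * q * dyadic_const n%:R s).
have B0 : 0 <= 2 ^+ n * q by rewrite mulr_ge0 ?exprn_ge0// ltW.
have A0 : 0 <= c ^+ 2 * 2 `^ alpha by rewrite mulr_ge0 ?sqr_ge0 ?powR_ge0.
have C0 : 0 <= C by apply: (mulr_ge0 A0); apply: (mulr_ge0 B0); exact: dyadic_const_ge0.
have dy : (\int[la]_(z in D) ((1 + tau z) `^ (- alpha))%:E <=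
    (2 ^+ n * q * dyadic_const n%:R s)%:E)%E.
  apply: integral_dyadic_le => // j.
  have t2 : 0 < 2 * 2 ^+ j.+1 :> R by rewrite mulr_gt0// exprn_gt0.
  apply: (@le_trans _ _ (la (eball (2 * 2 ^+ j.+1) : set rV))).
    apply: le_measure; rewrite ?inE; [|exact: measurable_enorm_lt|].
      apply: measurableI => //.
      have := mtau measurableT _ (measurable_itv `]-oo, (2 ^+ j.+1 : R)[).
      by rewrite setTI; congr measurable; apply/seteqP; split => x /=; rewrite in_itv.
    by move=> z [/= tz _]; rewrite /eball /=; rewrite ltr_pdivrMr// mulrC in tz.
  rewrite lebesgue_eball// qE -EFinM lee_fin powR_mulrn ?exprn_ge0//.
  by rewrite exprMn mulrAC.
exists C, 1; split => // r r1; have r0 : 0 < r by exact: lt_le_trans r1.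
rewrite /tail_sup_integral -/D.
apply: (@le_trans _ _ (\int[la]_(z in D)
    ((c ^+ 2 * 2 `^ alpha * r `^ (- alpha))%:E * ((1 + tau z) `^ (- alpha))%:E))%E).
  rewrite integral_mkcond [leRHS]integral_mkcond; apply: ge0_integral_mono.
    by move=> x; rewrite patchE; case: ifP.
  move=> z; rewrite !patchE; case: ifP => // zD.
  rewrite inE in zD; have {zD}z2 : 2 <= enorm z by rewrite leNgt; apply/negP.
  apply: ge_ereal_sup => _ [u u1 <-]; rewrite -EFinM lee_fin.
  have uz : enorm z / 2 <= enorm (z + u).
    have := enormD (z + u) (- u); rewrite addrK enormN.
    by move: u1; rewrite /eball /=; lra.
  set k := r *: (z + u); have tz1 : 1 <= tau z by rewrite ler_pdivlMr// mul1r.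
  have kr : r * tau z <= enorm k by rewrite enormZ gtr0_norm// ler_pM2l.
  apply: (@le_trans _ _ ((c * (1 + enorm k) `^ (- (alpha / 2))) ^+ 2)).
    by rewrite ler_sqr ?nnegrE ?cmod_ge0 ?mulr_ge0 ?powR_ge0 ?(ltW c0).
  have -> : (c * (1 + enorm k) `^ (- (alpha / 2))) ^+ 2 =
      c ^+ 2 * (1 + enorm k) `^ (- alpha).
    rewrite exprMn -(powR_mulrn 2 (powR_ge0 _ _)) -powRrM; congr (_ * _ `^ _).
    by field.
  suff main : (1 + enorm k) `^ (- alpha) <=
      2 `^ alpha * r `^ (- alpha) * (1 + tau z) `^ (- alpha).
    by apply: (le_trans (ler_wpM2l (sqr_ge0 c) main)); rewrite !mulrA.
  (* Since tau z >= 1, r (1 + tau z) / 2 <= r tau z <= |k|, which extracts the power of [r]; the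
     division by 2 costs the factor 2^alpha. *)
  have rt : 0 < r * ((1 + tau z) / 2) by rewrite mulr_gt0// divr_gt0// ltr_pwDl.
  apply: (@le_trans _ _ ((r * ((1 + tau z) / 2)) `^ (- alpha))).
    apply: le_powRN => //; apply: (@le_trans _ _ (r * tau z)).
      by rewrite ler_pM2l//; lra.
    by rewrite (le_trans kr)// lerDr.
  rewrite powRM ?(ltW r0)//; last by rewrite divr_ge0// addr_ge0.
  rewrite powRM ?addr_ge0//.
  have -> : (2^-1 : R) `^ (- alpha) = 2 `^ alpha.
    by rewrite -powR_inv1// -powRrM mulN1r opprK.
  by rewrite le_eqVlt; apply/orP; left; apply/eqP; ring.
rewrite ge0_integralZl//; last 3 first.
- apply: measurable_funTS; apply/measurable_EFinP.
  apply: (@measurableT_comp _ _ _ _ _ _ (@powR R ^~ (- alpha))) => //.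
  by apply: measurable_funD.
- by move=> z _; rewrite lee_fin powR_ge0.
- by rewrite lee_fin mulr_ge0// powR_ge0.
apply: (le_trans (lee_wpmul2l _ dy)); first by rewrite lee_fin mulr_ge0// powR_ge0.
by rewrite -EFinM lee_fin /C mulrAC.
Qed.

Section spectral_measure.
Variable beta : {measure set rV -> \bar R}.
Hypothesis lfb : locally_finite beta.

Section far.
Variable K : R.
Hypothesis K0 : 0 < K.
Hypothesis betaK : forall k, (beta ((fun y => (y - k)%R) @^-1` eball 1%R) <= K%:E)%E.

(* Average over z the integral on the ball of radius a around a z, and use Tonelli.
   The supremum in [tail_sup_integral] is never known to be measurable, whence the
   monotonicity of the integral without measurability. *)
Lemma far_integral_le (a r : R) : 0 < a <= 1 ->
  (\int[beta]_(k in ~` eball (3 * a)%R) F2 (r *: k) <=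
   (K / q)%:E * tail_sup_integral (r * a))%E.
Proof.
move=> /andP[a0 a1]; set D : set rV := ~` _.
have mD : measurable D by apply: measurableC; exact: measurable_enorm_lt.
have [m mE] := locally_finite_sigma_finite lfb.
rewrite (eq_measure_integral m); last by move=> A _ _; exact/esym/mE.
pose g k : \bar R := ((\1_D k)%:E * F2 (r *: k))%E.
have g0 k : (0 <= g k)%E by rewrite mule_ge0// lee_fin.
have mg : measurable_fun setT g.
  apply: emeasurable_funM; last exact: (measurableT_comp mF2 (mscal r)).
  by apply/measurable_EFinP; exact: measurable_indic.
have -> : (\int[m]_(k in D) F2 (r *: k) = \int[m]_k g k)%E.
  rewrite integral_mkcond; apply: eq_integral => k _; rewrite patchE /g indicE.
  by case: (k \in D); rewrite ?mul1e ?mul0e.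
pose E : set (rV * rV) := [set p | enorm (p.2 - a *: p.1) < a].
have mE' : measurable E.
  have h : measurable_fun setT (fun p : rV * rV => p.2 - a *: p.1).
    apply: measurable_fun_coorP => i; under eq_fun do rewrite !mxE.
    apply: measurable_funB; last apply: measurable_funM => //.
      exact: (measurableT_comp (measurable_coor i) measurable_snd).
    exact: (measurableT_comp (measurable_coor i) measurable_fst).
  by have := h measurableT _ (@measurable_enorm_lt R n a); rewrite setTI.
pose H (p : rV * rV) : \bar R := ((\1_E p)%:E * g p.2)%E.
have H0 p : (0 <= H p)%E by rewrite mule_ge0// lee_fin.
have mH : measurable_fun setT H.
  apply: emeasurable_funM; last exact: (measurableT_comp mg measurable_snd).
  by apply/measurable_EFinP; exact: measurable_indic.
have ton := @fubini_tonelli _ _ _ _ R la m H mH H0.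
pose T z : \bar R := (\int[m]_k H (z, k))%E.
have T0 z : (0 <= T z)%E by apply: integral_ge0.
have mT : measurable_fun setT T by exact: (@measurable_fun_fubini_tonelli_F _ _ _ _ _ m H mH).
(* For fixed k the points z with |k - a z| < a form the unit ball around k / a, of volume [q] for
   every [a]. *)
have inner k : (\int[la]_z H (z, k) = q%:E * g k)%E.
  rewrite /H /= ge0_integralZr//; last first.
    apply/measurable_EFinP.
    apply: (measurableT_comp (measurable_indic mE') (g := fun z : rV => (z, k))).
    by apply: measurable_fun_pair => //; exact: measurable_cst.
  congr (_ * _)%E.
  have -> : (\int[la]_z (\1_E (z, k))%:E = \int[la]_z (\1_(eball 1 : set rV) (z + - (a^-1 *: k))%R)%:E)%E.
    apply: eq_integral => z _; congr ((_)%:R)%:E; congr nat_of_bool.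
    apply/idP/idP; rewrite !inE /E /eball /=.
      move=> h; rewrite enormB (_ : _ - z = a^-1 *: (k - a *: z)).
        by rewrite enormZ gtr0_norm ?invr_gt0// ltr_pdivrMl// mulr1.
      by rewrite scalerBr scalerA mulVf ?scale1r// gt_eqF.
    move=> h; rewrite enormB (_ : a *: z - k = a *: (z - a^-1 *: k)).
      by rewrite enormZ gtr0_norm// gtr_pMr.
    by rewrite scalerBr scalerA mulfV ?scale1r// gt_eqF.
  rewrite (@ge0_integral_translate R n (- (a^-1 *: k)) (fun z => (\1_(eball 1 : set rV) z)%:E))//.
    by rewrite integral_indic// ?setIT//; exact: measurable_enorm_lt.
  by apply/measurable_EFinP; apply: measurable_indic; exact: measurable_enorm_lt.
have qT : (q%:E * \int[m]_k g k = \int[la]_z T z)%E.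
  rewrite -ge0_integralZl//; last by rewrite lee_fin ltW.
  by rewrite ton; apply: eq_integral => k _; rewrite inner.
have KT : ((K^-1)%:E * \int[la]_z T z <= tail_sup_integral (r * a))%E.
  rewrite -ge0_integralZl//; last by rewrite lee_fin invr_ge0 ltW.
  rewrite /tail_sup_integral [leRHS]integral_mkcond; apply: ge0_integral_mono.
    by move=> z; rewrite mule_ge0// lee_fin invr_ge0 ltW.
  (* If |z| < 2, a point within [a] of a z has norm below 3 a and so lies outside [D]; this is why
     the radius 3 a is removed. *)
  move=> z; rewrite patchE; case: ifPn => z2; last first.
    have {}z2 : enorm z < 2.
      rewrite ltNge; apply/negP => z2'; case/negP: z2.
      by rewrite inE /eball /=; apply/negP; rewrite -leNgt.
    rewrite /T integral0_eq ?mule0// => k _; rewrite /H /g !indicE.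
    case: (boolP ((z, k) \in E)) => zk; last by rewrite mul0e.
    case: (boolP (k \in D)) => kD; last by rewrite mul0e mule0.
    exfalso; move: zk kD; rewrite !inE /E /D /eball /= => zk; apply.
    have := enormD (k - a *: z) (a *: z); rewrite subrK enormZ gtr0_norm//.
    have : a * enorm z < a * 2 by rewrite ltr_pM2l.
    by move: zk; lra.
  set S := ereal_sup _; have S0 : (0 <= S)%E by exact: sup_ge0.
  pose B : set rV := [set k | enorm (k - a *: z) < a].
  have mB : measurable B by exact: (measurable_enorm_lt_translate (a *: z)).
  have TS : (T z <= S * m B)%E.
    have -> : (S * m B = \int[m]_k (S * (\1_B k)%:E))%E.
      rewrite ge0_integralZl//; last by apply/measurable_EFinP; exact: measurable_indic.
      by rewrite integral_indic// setIT.
    apply: ge0_integral_mono => [k|k]; first exact: H0.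
    rewrite /H /g !indicE /=.
    case: (boolP ((z, k) \in E)) => zk; last by rewrite mul0e mule_ge0// lee_fin.
    have kB : k \in B by move: zk; rewrite !inE.
    rewrite kB mul1e mule1; apply: (@le_trans _ _ (F2 (r *: k))).
      by rewrite -[leRHS]mul1e; apply: lee_wpmul2r => //; rewrite lee_fin; case: (k \in D).
    (* With u = k / a - z one has |u| < 1 and r k = (r a)(z + u). *)
    apply: ereal_sup_ubound; exists (a^-1 *: k - z) => //.
      move: kB; rewrite inE /B /eball /= => h.
      rewrite (_ : _ - z = a^-1 *: (k - a *: z)).
        by rewrite enormZ gtr0_norm ?invr_gt0// ltr_pdivrMl// mulr1.
      by rewrite scalerBr scalerA mulVf ?scale1r// gt_eqF.
    by rewrite addrC subrK scalerA -mulrA mulfV ?mulr1// gt_eqF.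
  (* As a <= 1, the ball of radius [a] lies in a unit ball, whose mass is at most [K]. *)
  have BK : (m B <= K%:E)%E.
    rewrite [leLHS]mE; apply: le_trans (betaK (a *: z)); apply: le_measure; rewrite ?inE//.
      exact: measurable_enorm_lt_translate.
    by move=> k /= h; rewrite /eball /=; exact: lt_le_trans h a1.
  have -> : S = ((K^-1)%:E * (S * K%:E))%E.
    by rewrite muleCA -EFinM mulVf ?mule1// gt_eqF.
  apply: lee_wpmul2l; first by rewrite lee_fin invr_ge0 ltW.
  by apply: (le_trans TS); exact: lee_wpmul2l.
apply: le_trans (lee_wpmul2l _ KT); last by rewrite lee_fin divr_ge0// ltW.
rewrite -qT muleA -EFinM muleA -EFinM.
by rewrite (_ : K / q / K * q = 1) ?mul1e//; field; rewrite !gt_eqF.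
Qed.

End far.

(** The points of the ball with r |k| < 2^(j+1) lie in a ball of radius at most 2^(j+1) / r, of mass
    at most eta r^-gamma (2^(j+1))^gamma. The bound is linear in [eta], as the little-o statement
    requires. *)
Lemma near_integral_le (c gamma theta eta delta r : R) : 0 <= gamma -> 0 < theta ->
  0 < r -> 0 <= eta ->
  (forall k, cmod (fourier f k) <= c * (1 + enorm k) `^ (- ((gamma + theta) / 2))) ->
  (forall e, 0 < e <= delta -> (beta (eball e) <= (eta * e `^ gamma)%:E)%E) ->
  (\int[beta]_(k in eball delta) F2 (r *: k) <=
   (c ^+ 2 * (eta * r `^ (- gamma) * dyadic_const gamma theta))%:E)%E.
Proof.
move=> gamma0 theta0 r0 eta0 Fc betae; pose alpha := gamma + theta.
have mD := @measurable_enorm_lt R n delta.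
pose tau (k : rV) := r * enorm k.
have mtau : measurable_fun setT tau by apply: measurable_funM => //; exact: measurable_enorm.
have tau0 k : 0 <= tau k by rewrite mulr_ge0 ?enorm_ge0// ltW.
have B0 : 0 <= eta * r `^ (- gamma) by rewrite mulr_ge0// powR_ge0.
have dy : (\int[beta]_(k in eball delta) ((1 + tau k) `^ (- alpha))%:E <=
    (eta * r `^ (- gamma) * dyadic_const gamma theta)%:E)%E.
  apply: integral_dyadic_le => // j.
  pose e : R := Num.min delta (2 ^+ j.+1 / r).
  have t0 : 0 < 2 ^+ j.+1 / r by rewrite divr_gt0// exprn_gt0.
  have sub : [set k | (tau k < 2 ^+ j.+1)%R] `&` eball delta `<=` (eball e : set rV).
    move=> k [/= tk kd]; rewrite /eball /= lt_min kd/= ltr_pdivlMr// mulrC.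
    exact: tk.
  have mS : measurable ([set k | (tau k < 2 ^+ j.+1)%R] `&` eball delta).
    apply: measurableI => //.
    have := mtau measurableT _ (measurable_itv `]-oo, (2 ^+ j.+1 : R)[).
    by rewrite setTI; congr measurable; apply/seteqP; split => x /=; rewrite in_itv.
  apply: (@le_trans _ _ (beta (eball e))).
    by apply: le_measure; rewrite ?inE//; exact: measurable_enorm_lt.
  have -> : eta * r `^ (- gamma) * (2 ^+ j.+1) `^ gamma = eta * (2 ^+ j.+1 / r) `^ gamma.
    rewrite powRM ?exprn_ge0 ?invr_ge0 ?(ltW r0)// -[in RHS]powR_inv1 ?(ltW r0)//.
    by rewrite -powRrM mulN1r -mulrA [in LHS](mulrC (r `^ _)).
  have [e0|e0] := ltP 0 e.
    apply: (le_trans (betae _ _)); first by rewrite e0 ge_min lexx.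
    rewrite lee_fin ler_wpM2l//; apply: ge0_ler_powR => //.
    - by rewrite nnegrE ltW.
    - by rewrite nnegrE ltW.
    - by rewrite ge_min lexx orbT.
  rewrite (_ : eball e = set0) ?measure0 ?lee_fin ?mulr_ge0 ?powR_ge0//.
  by rewrite -subset0 => k; rewrite /eball /= => /(le_lt_trans (enorm_ge0 _)); rewrite ltNge e0.
apply: (@le_trans _ _ (\int[beta]_(k in eball delta)
   ((c ^+ 2)%:E * ((1 + tau k) `^ (- alpha))%:E))%E).
  rewrite integral_mkcond [leRHS]integral_mkcond; apply: ge0_integral_mono.
    by move=> x; rewrite patchE; case: ifP.
  move=> k; rewrite !patchE; case: ifP => // _; rewrite -EFinM lee_fin.
  have c0 : 0 <= c * (1 + enorm (r *: k)) `^ (- ((gamma + theta) / 2)).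
    exact: le_trans (cmod_ge0 _) (Fc (r *: k)).
  apply: (@le_trans _ _ ((c * (1 + enorm (r *: k)) `^ (- ((gamma + theta) / 2))) ^+ 2)).
    by rewrite ler_sqr ?nnegrE ?cmod_ge0.
  rewrite exprMn -(powR_mulrn 2 (powR_ge0 _ _)) -powRrM enormZ gtr0_norm//.
  by rewrite (_ : - ((gamma + theta) / 2) * 2 = - alpha)// /alpha; field.
rewrite ge0_integralZl//; last 3 first.
- apply: measurable_funTS; apply/measurable_EFinP.
  apply: (@measurableT_comp _ _ _ _ _ _ (@powR R ^~ (- alpha))) => //.
  by apply: measurable_funD.
- by move=> z _; rewrite lee_fin powR_ge0.
- by rewrite lee_fin sqr_ge0.
by rewrite [leRHS]EFinM; apply: lee_wpmul2l => //; rewrite lee_fin sqr_ge0.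
Qed.

End spectral_measure.

End spectral_estimates.

Section near_filters.
Context {R : realType}.
Implicit Types Q : R -> Prop.

Lemma near_pinftyP Q : (\forall x \near +oo, Q x) <->
  exists2 M, 0 < M & forall x, M <= x -> Q x.
Proof.
split=> [[M [_ MQ]]|[M M0 MQ]].
  exists (Num.max M 0 + 1); first by rewrite ltr_wpDl// le_max lexx orbT.
  move=> x Mx; apply: MQ; apply: lt_le_trans Mx.
  by rewrite ltr_pwDr// le_max lexx.
by exists M; split; [exact: num_real|move=> x /ltW; exact: MQ].
Qed.

Lemma near_at_right0P Q : (\forall x \near 0^'+, Q x) <->
  exists2 delta, 0 < delta & forall x, 0 < x <= delta -> Q x.
Proof.
split=> [[e /= e0 eQ]|[delta d0 dQ]].
  exists (e / 2); first by rewrite divr_gt0.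
  move=> x /andP[x0 xe]; apply: eQ => //=.
  by rewrite sub0r normrN gtr0_norm// (le_lt_trans xe)// ltr_pdivrMr// ltr_pMr// ltr1n.
exists delta => //= x; rewrite /ball_ /= sub0r normrN => xd x0.
by apply: dQ; rewrite x0 ltW// (le_lt_trans _ xd)// ler_norm.
Qed.

End near_filters.

(** * The dilated spectral integral *)

Section scaled_energy.
Context {R : realType} {n : nat}.
Local Notation rV := 'rV[R]_n.
Local Notation la := (@lebesgue_rV R n).
Variable beta : {measure set rV -> \bar R}.
Hypothesis lfb : locally_finite beta.
Variable f : rV -> R[i].
Hypothesis fi : cintegrable la f.

Definition scaled_energy (r : R) : \bar R :=
  (\int[beta]_k ((cmod (fourier f (r *: k))) ^+ 2)%:E)%E.

Let mscaled (r : R) : cmeasurable (fun k : rV => fourier f (r *: k)).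
Proof.
have mF := cmeasurable_fourier (cintegrable_cmeasurable fi).
apply: (cmeasurable_comp mF).
by have := @measurable_fun_affine R n r 0; under eq_fun do rewrite addr0.
Qed.

Lemma scaled_energy_ge0 r : (0 <= scaled_energy r)%E.
Proof. by apply: integral_ge0 => k _; rewrite lee_fin sqr_ge0. Qed.

Lemma energy_dilation r : 0 < r ->
  (\int[beta]_k ((cmod (fourier (fun x => f (r^-1 *: x)%R) k)) ^+ 2)%:E =
   (r ^+ (2 * n))%:E * scaled_energy r)%E.
Proof.
move=> r0; rewrite -ge0_integralZl//; last 3 first.
- exact: measurable_sqr_cmod.
- by move=> k _; rewrite lee_fin sqr_ge0.
- by rewrite lee_fin exprn_ge0// ltW.
apply: eq_integral => k _; rewrite fourier_dilation// cmodM exprMn cmodR EFinM.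
by congr ((_)%:E * _)%E; rewrite ger0_norm ?exprn_ge0 ?(ltW r0)// -exprM mulnC.
Qed.

Lemma scaled_energy_split (delta r : R) : scaled_energy r =
  (\int[beta]_(k in eball delta) ((cmod (fourier f (r *: k))) ^+ 2)%:E +
   \int[beta]_(k in ~` eball delta) ((cmod (fourier f (r *: k))) ^+ 2)%:E)%E.
Proof.
have mE := @measurable_enorm_lt R n delta.
rewrite /scaled_energy -ge0_integral_setU//; first by rewrite setUv.
- exact: measurableC.
- by rewrite setUv; exact: measurable_sqr_cmod.
- by move=> k _; rewrite lee_fin sqr_ge0.
- by apply/disj_setPS; rewrite setICr.
Qed.

Lemma scaled_energy_lower : cintegral la f != 0 -> exists a e0 : R,
  [/\ 0 < a, 0 < e0 & forall r, 0 < r ->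
    (beta (eball (e0 / r)) <= a%:E * scaled_energy r)%E].
Proof.
move=> f0; have m0 : 0 < cmod (cintegral la f).
  rewrite lt_neqAle cmod_ge0 andbT eq_sym; apply: contra f0 => /eqP h.
  by rewrite -cmod_eq0 h.
set m := cmod _ in m0; have m2 : 0 < m / 2 by rewrite divr_gt0.
have [e0 e00 he] := fourier_cont 0 fi m2.
exists ((m / 2) ^- 2), e0; split => //; first by rewrite invr_gt0 exprn_gt0.
move=> r r0; have mE := @measurable_enorm_lt R n (e0 / r).
have q0 : 0 < (m / 2) ^+ 2 by rewrite exprn_gt0.
have -> : (beta (eball (e0 / r)) =
    ((m / 2) ^- 2)%:E * (((m / 2) ^+ 2)%:E * beta (eball (e0 / r))))%E.
  by rewrite muleA -EFinM mulVf ?mul1e// gt_eqF.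
apply: lee_wpmul2l; first by rewrite lee_fin invr_ge0 ltW.
have -> : (((m / 2) ^+ 2)%:E * beta (eball (e0 / r)) =
    \int[beta]_k (((m / 2) ^+ 2)%:E * (\1_(eball (e0 / r) : set rV) k)%:E))%E.
  rewrite ge0_integralZl//; last 2 first.
  - by apply/measurable_EFinP; exact: measurable_indic.
  - by rewrite lee_fin ltW.
  by rewrite integral_indic// setIT.
apply: ge0_integral_mono => k; first by rewrite mule_ge0// lee_fin ltW.
rewrite indicE -EFinM lee_fin; case: (boolP (k \in _)) => kE; last first.
  by rewrite mulr0 sqr_ge0.
rewrite inE /eball /= ltr_pdivlMr// in kE.
have : cmod (fourier f (r *: k) - fourier f 0) <= m / 2.
  by apply: he; rewrite subr0 enormZ gtr0_norm// mulrC.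
rewrite fourier0 => h; rewrite mulr1 ler_sqr ?nnegrE ?cmod_ge0 ?(ltW m2)//.
have := cmodD (fourier f (r *: k)) (cintegral la f - fourier f (r *: k)).
rewrite addrC subrK -/m cmod_distC; move: h.
by rewrite -/m; lra.
Qed.

Variables (gamma theta K : R).
Hypothesis gamma0 : 0 <= gamma.
Hypothesis theta0 : 0 < theta.
Hypothesis smooth : fourier_smooth f (gamma - n%:R + theta).
Hypothesis K0 : 0 < K.
Hypothesis betaK : forall k, (beta ((fun y => (y - k)%R) @^-1` eball 1%R) <= K%:E)%E.

Let sE : n%:R + (gamma - n%:R + theta) = gamma + theta. Proof. by ring. Qed.

Let alpha0 : 0 <= n%:R + (gamma - n%:R + theta).
Proof. by rewrite sE addr_ge0// ltW. Qed.

Lemma energy_tail_le (delta : R) : 0 < delta -> exists C r0 : R,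
  [/\ 0 <= C, 0 < r0 & forall r, r0 <= r ->
   (\int[beta]_(k in ~` eball delta) ((cmod (fourier f (r *: k))) ^+ 2)%:E <=
    (C * r `^ (- (gamma + theta)))%:E)%E].
Proof.
(* The choice gives a <= 1, as [far_integral_le] requires, and 3 a <= delta, so that its domain
   contains the complement of the ball of radius [delta]. *)
move=> d0; pose a := Num.min (delta / 3) 1.
have a01 : 0 < a <= 1 by rewrite lt_min ltr01 divr_gt0// ge_min lexx orbT.
have /andP[a0 _] := a01.
have a3 : 3 * a <= delta by rewrite mulrC -ler_pdivlMr// ge_min lexx.
have [C [r0 [C0 r00 hr]]] := tail_sup_integral_bound alpha0 smooth.
rewrite sE in hr; set q := fine (la (eball 1)).
have q0 : 0 <= q by rewrite fine_ge0.
exists (K / q * (C * a `^ (- (gamma + theta)))), (r0 / a); split.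
- by rewrite !mulr_ge0 ?invr_ge0 ?powR_ge0// ltW.
- by rewrite divr_gt0.
move=> r; rewrite ler_pdivrMr// => rr; have r0' : 0 <= r.
  by rewrite -(pmulr_lge0 _ a0) (le_trans (ltW r00)).
have mF := cmeasurable_fourier (cintegrable_cmeasurable fi).
have mC (e : R) : measurable (~` eball e : set rV).
  by apply: measurableC; exact: measurable_enorm_lt.
apply: (@le_trans _ _ (\int[beta]_(k in ~` eball (3 * a)%R)
    ((cmod (fourier f (r *: k))) ^+ 2)%:E)%E).
  apply: ge0_subset_integral => //.
  - apply: measurable_funTS; exact: measurable_sqr_cmod.
  - by move=> k _; rewrite lee_fin sqr_ge0.
  - by apply: subsetC; exact: eball_sub.
apply: (le_trans (far_integral_le mF lfb K0 betaK r a01)).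
apply: (le_trans (lee_wpmul2l _ (hr _ rr))); first by rewrite lee_fin divr_ge0// ltW.
rewrite -EFinM lee_fin powRM ?(ltW a0)// le_eqVlt; apply/orP; left; apply/eqP.
by rewrite /q; ring.
Qed.

(** In the converse direction nothing is known about the decay of [beta] at 0; there the transform
    is bounded and [beta] is locally finite, and the tail is controlled by [energy_tail_le].
    Finiteness is what the comparison with the variance asks for. *)
Lemma scaled_energy_fin : exists2 r0 : R, 0 < r0 &
  forall r, r0 <= r -> (scaled_energy r < +oo)%E.
Proof.
have [C [r0 [C0 r00 hr]]] := energy_tail_le ltr01.
exists r0 => // r rr; rewrite (scaled_energy_split 1) lte_add_pinfty//; last first.
  by apply: (le_lt_trans (hr _ rr)); rewrite ltry.
have [[c c0 Fc] _] := smooth.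
have mE := @measurable_enorm_lt R n 1.
apply: (@le_lt_trans _ _ (\int[beta]_(k in eball 1%R) (c ^+ 2)%:E)%E).
  rewrite integral_mkcond [leRHS]integral_mkcond; apply: ge0_integral_mono.
    by move=> k; rewrite patchE; case: ifP => // _; rewrite lee_fin sqr_ge0.
  move=> k; rewrite !patchE; case: ifP => // _; rewrite lee_fin.
  rewrite ler_sqr ?nnegrE ?cmod_ge0 ?(ltW c0)//; apply: (le_trans (Fc _)).
  rewrite ler_piMr ?(ltW c0)// sE.
  have e1 : 0 <= enorm (r *: k) by exact: enorm_ge0.
  have := @le_powRN R 1 (1 + enorm (r *: k)) ((gamma + theta) / 2) ltr01.
  by rewrite powR1; apply; [rewrite lerDl|rewrite divr_ge0// -sE].
rewrite integral_cst// lte_mul_pinfty ?lee_fin ?sqr_ge0//.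
by apply: lfb => //; exact: bounded_eball.
Qed.

(** [D] is fixed before [eta] and [delta], whereas [C] may depend on [delta]. For little-o, [eta] is
    taken small first and [r] large afterwards. *)
Lemma scaled_energy_upper : exists2 D : R, 0 <= D & forall eta delta : R,
  0 <= eta -> 0 < delta ->
  (forall e, 0 < e <= delta -> (beta (eball e) <= (eta * e `^ gamma)%:E)%E) ->
  exists C r0 : R, [/\ 0 <= C, 0 < r0 & forall r, r0 <= r ->
    (scaled_energy r <= ((D * eta + C * r `^ (- theta)) * r `^ (- gamma))%:E)%E].
Proof.
have [[c c0 Fc] _] := smooth; rewrite sE in Fc.
exists (c ^+ 2 * dyadic_const gamma theta).
  by rewrite mulr_ge0 ?sqr_ge0 ?dyadic_const_ge0.
move=> eta delta eta0 d0 betae.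
have [C [r0 [C0 r00 hr]]] := energy_tail_le d0.
exists C, r0; split => // r rr; have rp : 0 < r by exact: lt_le_trans rr.
rewrite (scaled_energy_split delta).
apply: (le_trans (leeD (near_integral_le gamma0 theta0 rp eta0 Fc betae) (hr _ rr))).
rewrite -EFinD lee_fin opprD powRD; last by rewrite (gt_eqF rp) implybT.
by rewrite le_eqVlt; apply/orP; left; apply/eqP; ring.
Qed.

End scaled_energy.

(** Dilation multiplies the spectral integral by r^(2n), and the normalisation of the variance by
    r^-n leaves the factor r^n. *)
Lemma variance_scaled_energy (R : realType) (n : nat) (d : measure_display)
    (Omega : measurableType d) (P : probability Omega R)
    (theta : 'rV[R]_n -> Omega -> Omega) (Phi : Omega -> set 'rV[R]_n -> R[i])
    (beta : {measure set 'rV[R]_n -> \bar R}) :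
  measure_preserving_flow P theta -> random_complex_measure Phi ->
  flow_invariant theta Phi -> locally_abs_square_integrable P Phi ->
  is_bartlett_measure P Phi beta ->
  exists K A : R, [/\ 0 < K, 0 < A,
    forall k, (beta ((fun y => (y - k)%R) @^-1` eball 1%R) <= K%:E)%E &
    forall f r, cintegrable (lebesgue_rV n) f -> 0 < r ->
      (scaled_energy beta f r < +oo)%E ->
      let V := (cvariance P (fun w => cm_integral (Phi w) (fun x => f (r^-1 *: x)%R))
                * (r ^- n)%:E)%E in
      [/\ (0 <= V)%E, (V <= (A * r ^+ n)%:E * scaled_energy beta f r)%E &
          ((r ^+ n)%:E * scaled_energy beta f r <= A%:E * V)%E]].
Proof.
move=> flow rPhi iPhi sPhi hbeta.
have [M [C [C0 Mlf M2 mcamp [mI IB I_le]]]] := random_integral_dominated flow rPhi iPhi sPhi.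
have mM (g : 'rV[R]_n -> \bar R) (mg : measurable_fun setT g)
    (g0 : forall x, (0 <= g x)%E) := (mcamp g mg g0).1.
have camp (g : 'rV[R]_n -> \bar R) (mg : measurable_fun setT g)
    (g0 : forall x, (0 <= g x)%E) := (mcamp g mg g0).2.
have [K K0 betaK] := spectral_translate_bounded Mlf M2 mI I_le mM hbeta.
pose c := spectral_const (R := R) (n := n).
have c0 : 0 < c by exact: spectral_const_gt0.
(* [A] dominates both factors 4 / c and 4 c of the two directions; adding 1 to [K] makes it
   positive. *)
exists (K + 1), (4 / c + 4 * c); split.
- by rewrite ltr_wpDl.
- by rewrite addr_gt0// ?divr_gt0// mulr_gt0.
- by move=> k; apply: (le_trans (betaK k)); rewrite lee_fin lerDl.
move=> f r fi r0 Efin V.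
have rn : 0 < r ^+ n by rewrite exprn_gt0.
have fri := cintegrable_dilation r0 fi.
have eE := energy_dilation beta fi r0.
set E := scaled_energy beta f r in Efin eE *.
have E0 : (0 <= E)%E by exact: scaled_energy_ge0.
have fr2 : (\int[beta]_k ((cmod (fourier (fun x => f (r^-1 *: x)%R) k)) ^+ 2)%:E < +oo)%E.
  by rewrite eE lte_mul_pinfty// lee_fin exprn_ge0// ltW.
have Xi := cm_integral_cintegrable C0 Mlf M2 mI IB I_le mM camp hbeta fri fr2.
have h1 := variance_le_spectral C0 Mlf M2 mI IB I_le mM camp hbeta fri fr2.
have h2 := spectral_le_variance C0 Mlf M2 mI IB I_le mM camp hbeta fri fr2.
rewrite eE in h1 h2; rewrite -/c in h1 h2.
set W := cvariance _ _ in h1 h2.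
have VE : V = (W * (r ^- n)%:E)%E by [].
have W0 : (0 <= W)%E.
  by rewrite /W cvariance_centered//; apply: integral_ge0 => w _; rewrite lee_fin sqr_ge0.
have ri : (0 <= (r ^- n)%:E)%E by rewrite lee_fin invr_ge0 ltW.
have r2 : r ^- n * r ^+ (2 * n) = r ^+ n by rewrite mul2n -addnn exprD mulKf// gt_eqF.
have V0 : (0 <= V)%E by rewrite VE mule_ge0.
split => //.
- rewrite VE; apply: (le_trans (lee_wpmul2r ri h1)).
  rewrite muleC !muleA -!EFinM; apply: lee_wpmul2r => //; rewrite lee_fin.
  rewrite mulrAC r2 mulrC ler_wpM2r ?(ltW rn)// lerDl mulr_ge0 ?(ltW c0)//.
- rewrite -r2 EFinM -muleA.
  apply: (le_trans (lee_wpmul2l ri h2)).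
  rewrite muleCA (muleC _ W) -VE; apply: lee_wpmul2r => //.
  by rewrite lee_fin lerDr divr_ge0// ltW.
Qed.

(** * Transfer to the Landau statements *)

Lemma powR_natD (R : realType) (r p : R) (n : nat) : 0 < r ->
  r `^ (n%:R + p) = r ^+ n * r `^ p.
Proof.
by move=> r0; rewrite powRD ?powR_mulrn ?(ltW r0)// (gt_eqF r0) implybT.
Qed.

Lemma normalized_ball_le (R : realType) (n : nat) (e p C : R) (b : \bar R) :
  0 < e -> (`|(e ^- n)%:E * b| <= (C * `|e `^ p|)%:E)%E ->
  (b <= (`|C| * e `^ (n%:R + p))%:E)%E.
Proof.
move=> e0 h; have en : 0 < e ^+ n by rewrite exprn_gt0.
have -> : b = ((e ^+ n)%:E * ((e ^- n)%:E * b))%E.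
  by rewrite muleA -EFinM mulfV ?mul1e// gt_eqF.
have h' := le_trans (lee_abs _) h.
apply: (le_trans (lee_wpmul2l _ h')); first by rewrite lee_fin ltW.
rewrite -EFinM lee_fin powR_natD// mulrCA (ger0_norm (powR_ge0 _ _)).
by rewrite ler_wpM2r ?ler_norm// mulr_ge0 ?(ltW en)// powR_ge0.
Qed.

Theorem theorem3p7 (R : realType) (d : nat) (hd : (0 < d)%N)
    (disp : measure_display) (Omega : measurableType disp)
    (P : probability Omega R)
    (theta : 'rV[R]_d -> Omega -> Omega)
    (htheta : measure_preserving_flow P theta)
    (Phi : Omega -> set 'rV[R]_d -> R[i])
    (hPhi : random_complex_measure Phi)
    (hinv : flow_invariant theta Phi)
    (hsq : locally_abs_square_integrable P Phi)
    (beta : {measure set 'rV[R]_d -> \bar R})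
    (hbeta : is_bartlett_measure P Phi beta)
    (p : R) (hp : - d%:R <= p)
    (f : 'rV[R]_d -> R[i])
    (hf : cintegrable (lebesgue_rV d) f)
    (vartheta : R) (hvartheta : 0 < vartheta)
    (hsmooth : fourier_smooth f (p + vartheta)) :
  let scaled_var (r : R) : \bar R :=
    (cvariance P (fun w => cm_integral (Phi w) (fun x => f (r^-1 *: x)))
       * (r ^- d)%:E)%E in
  let power (r : R) : R := r `^ (- p) in
  [/\ p_uniform beta p -> ebigO +oo scaled_var power,
      cintegral (lebesgue_rV d) f != 0 ->
        ebigO +oo scaled_var power -> p_uniform beta p,
      beyond_p_uniform beta p -> elittleo +oo scaled_var power &
      cintegral (lebesgue_rV d) f != 0 ->
        elittleo +oo scaled_var power -> beyond_p_uniform beta p].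
Proof.
(* [gamma] is the exponent in the bound for [beta] on small balls; the boundary case p = -d gives
   gamma = 0. *)
move=> scaled_var power; pose gamma := d%:R + p.
have gamma0 : 0 <= gamma by rewrite /gamma -lerBlDl sub0r.
have smooth : fourier_smooth f (gamma - d%:R + vartheta).
  by rewrite /gamma [d%:R + p]addrC addrK.
have [K [A [K0 A0 betaK hV]]] := variance_scaled_energy htheta hPhi hinv hsq hbeta.
have lfb := hbeta.1.
have upper : exists2 D : R, 0 <= D & forall eta delta : R, 0 <= eta -> 0 < delta ->
    (forall e, 0 < e <= delta -> (beta (eball e) <= (eta * e `^ gamma)%:E)%E) ->
    exists C r0 : R, [/\ 0 <= C, 0 < r0 & forall r, r0 <= r ->
      (`|scaled_var r| <= ((D * eta + C * r `^ (- vartheta)) * `|power r|)%:E)%E].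
  have [D D0 hD] := scaled_energy_upper lfb hf gamma0 hvartheta smooth K0 betaK.
  exists (A * D); first by rewrite mulr_ge0// ltW.
  move=> eta delta eta0 delta0 /(hD _ _ eta0 delta0)[C [r0 [C0 r00 hr]]].
  exists (A * C), r0; split => //; first by rewrite mulr_ge0// ltW.
  move=> r rr; have rp : 0 < r by exact: lt_le_trans rr.
  have Efin := le_lt_trans (hr _ rr) (ltry _).
  have [V0 Vle _] := hV f r hf rp Efin.
  rewrite gee0_abs//; apply: (le_trans Vle).
  apply: (le_trans (lee_wpmul2l _ (hr _ rr))).
    by rewrite lee_fin mulr_ge0 ?(ltW A0)// exprn_ge0// ltW.
  rewrite -EFinM lee_fin (ger0_norm (powR_ge0 _ _)) /power.
  have -> : - p = d%:R + - gamma by rewrite /gamma opprD addrA subrr add0r.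
  by rewrite powR_natD// le_eqVlt; apply/orP; left; apply/eqP; ring.
(* Since (e0 / r)^-d = e0^-d r^d, normalising the ball produces exactly the factor r^d in the
   comparison of energy and variance. *)
have lower : cintegral (lebesgue_rV d) f != 0 -> exists L e0 r0 : R,
    [/\ 0 < L, 0 < e0, 0 < r0 & forall r, r0 <= r ->
     (((e0 / r) ^- d)%:E * beta (eball (e0 / r)%R) <= L%:E * `|scaled_var r|)%E].
  move=> f0; have [a [e0 [a0 e00 hlow]]] := scaled_energy_lower beta hf f0.
  have [r0 r00 hfin] := scaled_energy_fin lfb hf gamma0 hvartheta smooth K0 betaK.
  have ed : 0 < e0 ^+ d by rewrite exprn_gt0.
  exists (e0 ^- d * a * A), e0, r0; split => //.
    by rewrite !mulr_gt0// invr_gt0.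
  move=> r rr; have rp : 0 < r by exact: lt_le_trans rr.
  have [V0 _ Vge] := hV f r hf rp (hfin _ rr).
  have rd : 0 < r ^+ d by rewrite exprn_gt0.
  rewrite gee0_abs//; apply: (le_trans (lee_wpmul2l _ (hlow _ rp))).
    by rewrite lee_fin invr_ge0 exprn_ge0// ltW// divr_gt0.
  rewrite [leRHS](_ : _ = ((e0 ^- d * a)%:E * (A%:E * scaled_var r))%E); last first.
    by rewrite [RHS]muleA -EFinM.
  apply: le_trans (lee_wpmul2l _ Vge).
    rewrite !muleA -!EFinM le_eqVlt; apply/orP; left; apply/eqP.
    congr (_%:E * _)%E; rewrite expr_div_n invf_div; field.
    by rewrite gt_eqF.
  by rewrite lee_fin mulr_ge0 ?invr_ge0// ltW.
(* The substitution r = e0 / e turns large [r] into small [e], and (e0 / e)^-p = e0^-p e^p explains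
   the constant. It is explicit in [C], so that O and o follow alike. *)
have converse (L e0 r0 C : R) : 0 < L -> 0 < e0 -> 0 < r0 ->
    (forall r, r0 <= r ->
     (((e0 / r) ^- d)%:E * beta (eball (e0 / r)%R) <= L%:E * `|scaled_var r|)%E) ->
    (\forall r \near +oo, (`|scaled_var r| <= (C * `|power r|)%:E)%E) ->
    \forall e \near 0^'+, (`|(e ^- d)%:E * beta (eball e)| <=
      (L * C * e0 `^ (- p) * `|e `^ p|)%:E)%E.
  move=> L0 e00 r00 hL /near_pinftyP[M M0 hM]; apply/near_at_right0P.
  exists (e0 / Num.max r0 M).
    by rewrite divr_gt0// lt_max r00.
  move=> e /andP[ep]; rewrite ler_pdivlMr ?lt_max ?r00// => em.
  have rm : Num.max r0 M <= e0 / e by rewrite ler_pdivlMr// mulrC.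
  have [rr Mr] : r0 <= e0 / e /\ M <= e0 / e by move: rm; rewrite ge_max => /andP[].
  have eE : e0 / (e0 / e) = e by field; rewrite !gt_eqF.
  have := hL _ rr; rewrite eE => hb; rewrite gee0_abs; last first.
    by rewrite mule_ge0// lee_fin invr_ge0 exprn_ge0// ltW.
  apply: (le_trans hb); apply: (le_trans (lee_wpmul2l _ (hM _ Mr))).
    by rewrite lee_fin ltW.
  rewrite -EFinM lee_fin !(ger0_norm (powR_ge0 _ _)) /power.
  rewrite powRM ?(ltW e00) ?invr_ge0 ?(ltW ep)//.
  rewrite -[e^-1](powR_inv1 (ltW ep)) -powRrM mulN1r opprK.
  by rewrite le_eqVlt; apply/orP; left; apply/eqP; ring.
split.
- move=> [C /near_at_right0P[delta delta0 hC]].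
  have [D D0 hD] := upper.
  have [|C1 [r0 [C10 r00 hr]]] := hD `|C| delta (normr_ge0 _) delta0.
    by move=> e /[dup] /andP[e0 _] /hC /(normalized_ball_le e0).
  (* For r >= 1 the factor r^-vartheta is at most 1. *)
  exists (D * `|C| + C1); apply/near_pinftyP; exists (Num.max r0 1).
    by rewrite lt_max ltr01 orbT.
  move=> r; rewrite ge_max => /andP[rr r1]; apply: (le_trans (hr _ rr)).
  rewrite lee_fin ler_wpM2r// lerD2l ler_piMr//.
  by have := @le_powRN R 1 r vartheta ltr01 r1 (ltW hvartheta); rewrite powR1.
- move=> f0 [C hC]; have [L [e0 [r0 [L0 e00 r00 hL]]]] := lower f0.
  by exists (L * C * e0 `^ (- p)); exact: (converse _ _ _ _ L0 e00 r00 hL hC).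
- move=> hb e e0; have [D D0 hD] := upper.
  (* Half of [e] is reserved for each summand; D eta <= e / 2, with D + 1 in the denominator because
     [D] may be 0. *)
  pose eta := e / (2 * (D + 1)); have D1 : 0 < D + 1 by rewrite ltr_wpDl.
  have eta0 : 0 < eta by rewrite divr_gt0// mulr_gt0.
  have /near_at_right0P[delta delta0 hC] := hb _ eta0.
  have [|C1 [r0 [C10 r00 hr]]] := hD eta delta (ltW eta0) delta0.
    move=> x /[dup] /andP[x0 _] /hC /(normalized_ball_le x0).
    by rewrite (gtr0_norm eta0).
  (* For r >= y^(1/vartheta) one has r^-vartheta <= 1 / y, and C1 / y <= e / 2; adding 1 keeps [y]
     positive when [C1] is 0. *)
  pose y := 2 * C1 / e + 1.
  have y0 : 0 < y by rewrite ltr_wpDl// divr_ge0 ?mulr_ge0// ltW.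
  pose r1 := y `^ (vartheta^-1); have r10 : 0 < r1 by rewrite powR_gt0.
  apply/near_pinftyP; exists (Num.max r0 r1); first by rewrite lt_max r00.
  move=> r; rewrite ge_max => /andP[rr rr1]; apply: (le_trans (hr _ rr)).
  rewrite lee_fin ler_wpM2r//.
  have rv : r `^ (- vartheta) <= y^-1.
    have := le_powRN r10 rr1 (ltW hvartheta); move=> /le_trans; apply.
    by rewrite powRN /r1 -powRrM mulVf ?powRr1 ?(ltW y0)// gt_eqF.
  have h1 : D * eta <= e / 2.
    rewrite /eta (_ : e / 2 = (D + 1) * (e / (2 * (D + 1)))); last first.
      by field; rewrite gt_eqF.
    by rewrite ler_wpM2r ?(ltW eta0)// lerDl.
  have h2 : C1 * r `^ (- vartheta) <= e / 2.
    apply: (le_trans (ler_wpM2l C10 rv)); rewrite ler_pdivrMr//.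
    rewrite /y mulrDr mulr1 (_ : e / 2 * (2 * C1 / e) = C1); last first.
      by field; rewrite gt_eqF.
    by rewrite lerDl divr_ge0// ltW.
  by rewrite [leRHS]splitr lerD.
- move=> f0 hsv e ep; have [L [e0 [r0 [L0 e00 r00 hL]]]] := lower f0.
  have q0 : 0 < L * e0 `^ (- p) by rewrite mulr_gt0// powR_gt0.
  (* The tolerance is rescaled so that the constant delivered by [converse] is exactly [e]. *)
  have e'0 : 0 < e / (L * e0 `^ (- p)) by rewrite divr_gt0.
  have := converse _ _ _ _ L0 e00 r00 hL (hsv _ e'0).
  rewrite (_ : L * _ * _ = e)//.
  by rewrite mulrAC mulrCA mulfV ?mulr1// gt_eqF.
Qed.
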